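(* Let $n=3-\frac1m$, where $m\in\mathbb N$, and let $\theta>0$. Then there exists a unique solution $H\in C^1([0,1])\cap C^3((0,1))$ of the problem $$H^{n-1}\frac{d^3H}{dx^3}=-1+x\ \text{ for } x\in(0,1),\qquad \Big(H,\frac{dH}{dx}\Big)=(0,\theta)\ \text{ at } x=0,\qquad \frac{dH}{dx}=0\ \text{ at } x=1,$$ with the asymptotic $$H=\theta x\Big(1+v\big(x\log x,x^{\beta}\big)\Big)\qquad\text{for } 0\le x\ll1,$$ where $\beta=3-n=\frac1m$ and $v=v(x_1,x_2)$ is an analytic function in a neighborhood of $(x_1,x_2)=(0,0)$ with $v(0,0)=0$ but $v\not\equiv0$. Moreover, the dependence of $v$ on both $x_1$ and $x_2$ is in general non-trivial, i.e. there are admissible parameter values $(m,\theta)$ for which $v$ depends non-trivially on $x_1$ as well as on $x_2$.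
   Context: $\mathbb N=\{1,2,3,\dots\}$. The unknown $H$ is the height of a film and the differential equation is understood on the set where $H>0$; thus a solution is positive on $(0,1)$. ''For $0\le x\ll1$'' means: there is a constant $c>0$ such that the assertion holds for all $0\le x\le c$; the expression $x\log x$ is understood as $0$ at $x=0$. *)

(* Defs.v *)
From Stdlib Require Import Reals.
From Coquelicot Require Import Coquelicot.
Local Open Scope R_scope.

Definition unit_itv (x : R) : Prop := 0 <= x <= 1.

(* [D_in] and [continue_in] are relative to [0,1], hence one-sided at 0 and 1;
   the values of [H] outside [0,1] play no role. *)
Definition C1_unit_itv (H dH : R -> R) : Prop :=
  (forall x, unit_itv x -> D_in H dH unit_itv x) /\
  (forall x, unit_itv x -> continue_in dH unit_itv x).

(* [ex_derive_n H 3 x] alone would not do: [Derive] is total, so it does not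
   imply that the lower-order derivatives exist. *)
Definition C3_open_unit_itv (H : R -> R) : Prop :=
  forall (k : nat) (x : R), (k <= 3)%nat -> 0 < x < 1 ->
    ex_derive_n H k x /\ continuous (Derive_n H k) x.

Definition film_solution (n theta : R) (H : R -> R) : Prop :=
  exists dH : R -> R,
    C1_unit_itv H dH /\
    C3_open_unit_itv H /\
    (forall x, 0 < x < 1 -> 0 < H x) /\
    (forall x, 0 < x < 1 ->
       Rpower (H x) (n - 1) * Derive_n H 3 x = - 1 + x) /\
    H 0 = 0 /\ dH 0 = theta /\ dH 1 = 0.

Definition is_abs_sum2 (u : nat -> nat -> R) (s : R) : Prop :=
  (forall i, ex_series (fun j => Rabs (u i j))) /\
  ex_series (fun i => Series (fun j => Rabs (u i j))) /\
  is_series (fun i => Series (u i)) s.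

Definition box (p1 p2 r x1 x2 : R) : Prop :=
  Rabs (x1 - p1) < r /\ Rabs (x2 - p2) < r.

Definition analytic2_at (v : R -> R -> R) (p1 p2 : R) : Prop :=
  exists (a : nat -> nat -> R) (r : R), 0 < r /\
    forall x1 x2, box p1 p2 r x1 x2 ->
      is_abs_sum2 (fun i j => a i j * (x1 - p1) ^ i * (x2 - p2) ^ j) (v x1 x2).

(* Power of a nonnegative base with a positive exponent: [Rpower 0 b] is 1. *)
Definition rpow (x b : R) : R :=
  if Rle_dec x 0 then 0 else Rpower x b.

(* [v] is analytic in the neighborhood [box 0 0 r] of the origin; its values
   outside that box are irrelevant. Since [ln 0 = 0], [x * ln x] is 0 at 0. *)
Definition film_expansion (n theta : R) (H : R -> R)
    (v : R -> R -> R) (r : R) : Prop :=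
  0 < r /\
  (forall p1 p2, box 0 0 r p1 p2 -> analytic2_at v p1 p2) /\
  v 0 0 = 0 /\
  exists c : R, 0 < c <= 1 /\
    forall x, 0 <= x <= c ->
      box 0 0 r (x * ln x) (rpow x (3 - n)) /\
      H x = theta * x * (1 + v (x * ln x) (rpow x (3 - n))).

Definition nonzero_on_box (v : R -> R -> R) (r : R) : Prop :=
  exists x1 x2, box 0 0 r x1 x2 /\ v x1 x2 <> 0.

Definition depends_on_fst (v : R -> R -> R) (r : R) : Prop :=
  exists x1 y1 x2, box 0 0 r x1 x2 /\ box 0 0 r y1 x2 /\ v x1 x2 <> v y1 x2.

Definition depends_on_snd (v : R -> R -> R) (r : R) : Prop :=
  exists x1 x2 y2, box 0 0 r x1 x2 /\ box 0 0 r x1 y2 /\ v x1 x2 <> v x1 y2.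

(* Main.v *)
(** Write [H = theta x (1 + u)] and [D = x d/dx]. With [beta = 1/m] and [p = n - 1 = 2 - beta],
    the equation becomes [(D + 1) D (D - 1) u = - kap x^beta (1 - x) (1 + u)^(-p)], where
    [kap = theta^(-p-1)]. Near [0] it is solved by [u = sum_k x^(k beta) P_k(ln x)] with
    polynomials [P_k] of degree at most [k/m]; in terms of [xi = x^beta] and [eta = x ln x]
    this is a power series. The only resonance is [k = m], where the kernel of [D - 1] leaves
    one free parameter [b], the coefficient of [x], and forces a multiple of [x ln x]. An l1
    norm on the polynomials, chosen so that [d/dL] is dominated by the weight [k beta], gives
    convergence.

    If [H], [K] solve the equation with the same data at [0], then [w = H - K] satisfies
    [w''' = a w] with [a >= 0], so [w w'' - w'^2/2] and [w w'] increase from [0]. This yields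
    uniqueness when [w'] also vanishes at [1]. Moreover [(H - K)/x^2] has a limit at [0], and
    [H = K] near [0] as soon as that limit vanishes; hence every solution coincides near [0]
    with the series solution for a suitable [b].

    For existence, the singular factor is cut off near [0], the regularised problem is solved
    by shooting on [H''(0)], and the same energy argument shows that the regularised
    solutions are uniformly Cauchy.

    For [m = 1], an expansion in [x^beta] alone would make [H'''] bounded, against
    [H H''' -> -1]; an expansion in [x ln x] alone is refuted by comparing the orders [1],
    [x (ln x)^2] and [x ln x]. *)

Require Import Defs.
From Stdlib Require Import Reals Lra Lia List Arith Classical IndefiniteDescription.
From Coquelicot Require Import Coquelicot.
Import ListNotations.
Local Open Scope R_scope.

(** * Calculus at the right of 0 *)

(** Near 0 the third derivative behaves like -theta^(-p) x^(beta-2), so H'' is unbounded there and a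
    solution has no initial value H''(0) to shoot on or to compare. This shapes everything. The
    cutoff restores such a value, and the bounds that must survive its removal are stated for H and
    its increments. The energy of two solutions starts from 0 only because x H'' tends to 0, which
    comes from the continuity of H' at 0 together with the monotonicity of H''. The datum that
    replaces H''(0) is the resonant coefficient b: the singular parts of two solutions with the same
    H(0) and H'(0) coincide, and what is left of their difference is of order x^2.

    The global solution is produced without any information on its expansion, so it has to be
    identified with a series solution afterwards. The claim on the dependence of v concerns every
    admissible v, not only the one constructed; it is proved for m = 1, theta = 1, where n = 2 and
    the equation is H H''' = -1 + x. *)

Lemma is_derive_continuity_pt (f : R -> R) (x l : R) :
  is_derive f x l -> continuity_pt f x.
Proof.
  intros Hd. apply continuity_pt_filterlim.
  apply (ex_derive_continuous f x). now exists l.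
Qed.

Lemma is_derive_eq (f : R -> R) (x a b : R) : is_derive f x a -> a = b -> is_derive f x b.
Proof. now intros H <-. Qed.

Lemma is_derive_Rplus (f g : R -> R) (x a b : R) :
  is_derive f x a -> is_derive g x b -> is_derive (fun y => f y + g y) x (a + b).
Proof. intros Hf Hg. apply (is_derive_plus f g x a b Hf Hg). Qed.

Lemma is_derive_Rminus (f g : R -> R) (x a b : R) :
  is_derive f x a -> is_derive g x b -> is_derive (fun y => f y - g y) x (a - b).
Proof. intros Hf Hg. apply (is_derive_minus f g x a b Hf Hg). Qed.

Lemma is_derive_Ropp (f : R -> R) (x a : R) :
  is_derive f x a -> is_derive (fun y => - f y) x (- a).
Proof. intros Hf. apply (is_derive_opp f x a Hf). Qed.

Lemma is_derive_Rmult (f g : R -> R) (x a b : R) :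
  is_derive f x a -> is_derive g x b ->
  is_derive (fun y => f y * g y) x (a * g x + f x * b).
Proof.
  intros Hf Hg. apply (is_derive_mult f g x a b Hf Hg). intros; apply Rmult_comm.
Qed.

Lemma is_derive_Rconst (c x : R) : is_derive (fun _ => c) x 0.
Proof. apply (is_derive_const c x). Qed.

Lemma is_derive_Rid (x : R) : is_derive (fun y => y) x 1.
Proof. apply (is_derive_id x). Qed.

Lemma is_derive_Rcomp (f g : R -> R) (x a b : R) :
  is_derive f (g x) a -> is_derive g x b -> is_derive (fun y => f (g y)) x (b * a).
Proof. intros Hf Hg. apply (is_derive_comp f g x a b Hf Hg). Qed.

Lemma is_derive_Rscal (c x : R) : is_derive (Rmult c) x c.
Proof.
  eapply is_derive_eq; [apply (is_derive_Rmult (fun _ => c) (fun y => y))|].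
  - apply is_derive_Rconst.
  - apply is_derive_Rid.
  - ring.
Qed.

Lemma is_derive_Rshift (c x : R) : is_derive (Rplus c) x 1.
Proof.
  eapply is_derive_eq; [apply (is_derive_Rplus (fun _ => c) (fun y => y))|].
  - apply is_derive_Rconst.
  - apply is_derive_Rid.
  - ring.
Qed.

Lemma is_derive_Rreflect (c x : R) : is_derive (Rminus c) x (-1).
Proof.
  eapply is_derive_eq; [apply (is_derive_Rminus (fun _ => c) (fun y => y))|].
  - apply is_derive_Rconst.
  - apply is_derive_Rid.
  - ring.
Qed.

(* Unification eta-reduces [fun y => c * y] to [Rmult c], hence the partial
   applications. *)
Ltac derive_step :=
  lazymatch goal with
  | H : is_derive ?f ?x _ |- is_derive ?f ?x _ => exact H
  | |- is_derive (Rmult _) _ _ => apply is_derive_Rscal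
  | |- is_derive (Rplus _) _ _ => apply is_derive_Rshift
  | |- is_derive (Rminus _) _ _ => apply is_derive_Rreflect
  | |- is_derive (fun y => _ + _) _ _ => eapply is_derive_Rplus
  | |- is_derive (fun y => _ - _) _ _ => eapply is_derive_Rminus
  | |- is_derive (fun y => _ * _) _ _ => eapply is_derive_Rmult
  | |- is_derive (fun y => - _) _ _ => eapply is_derive_Ropp
  | |- is_derive (fun y => y) _ _ => apply is_derive_Rid
  | |- is_derive (fun _ => ?c) _ _ => apply is_derive_Rconst
  end.
Ltac derive_as := eapply is_derive_eq; [repeat derive_step|cbv beta].

Lemma MVT_is_derive (f df : R -> R) (a b : R) :
  a < b ->
  (forall x, a <= x <= b -> continuity_pt f x) ->
  (forall x, a < x < b -> is_derive f x (df x)) ->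
  exists c, a < c < b /\ f b - f a = df c * (b - a).
Proof.
  intros Hab Hc Hd.
  assert (pr1 : forall c, a < c < b -> derivable_pt f c).
  { intros c Hcab. exists (df c). apply is_derive_Reals. now apply Hd. }
  assert (pr2 : forall c, a < c < b -> derivable_pt id c).
  { intros c _. apply derivable_pt_id. }
  destruct (MVT f id a b pr1 pr2 Hab Hc) as (c & P & Heq).
  { intros c _. apply derivable_continuous_pt, derivable_pt_id. }
  exists c. split; [exact P|].
  rewrite (derive_pt_eq_0 f c (df c) (pr1 c P)) in Heq.
  2: { apply is_derive_Reals. now apply Hd. }
  rewrite (derive_pt_eq_0 id c 1 (pr2 c P)) in Heq by apply derivable_pt_lim_id.
  unfold id in Heq. lra.
Qed.

Lemma le_of_derive_nonneg (f df : R -> R) (a b : R) :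
  a <= b ->
  (forall x, a <= x <= b -> continuity_pt f x) ->
  (forall x, a < x < b -> is_derive f x (df x)) ->
  (forall x, a < x < b -> 0 <= df x) ->
  f a <= f b.
Proof.
  intros Hab Hc Hd Hp. destruct (Rle_lt_or_eq_dec a b Hab) as [Hlt|Heq].
  - destruct (MVT_is_derive f df a b Hlt Hc Hd) as (c & Hcab & E).
    pose proof (Hp c Hcab). nra.
  - subst; lra.
Qed.

Lemma le_of_derive_nonneg_closed (f df : R -> R) (a b : R) :
  a <= b ->
  (forall x, a <= x <= b -> is_derive f x (df x)) ->
  (forall x, a < x < b -> 0 <= df x) ->
  f a <= f b.
Proof.
  intros Hab Hd Hp. apply (le_of_derive_nonneg f df); auto.
  - intros x Hx. apply (is_derive_continuity_pt f x (df x)); auto.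
  - intros x Hx. apply Hd; lra.
Qed.

(** The mean value theorem on both sides of x gives two slopes, the left one being the larger;
    eliminating them yields the chord inequality. It is kept free of division so that the left end
    can later tend to 0. *)
Lemma concave_chord (g dg : R -> R) (a b : R) :
  a < b ->
  (forall x, a <= x <= b -> continuity_pt g x) ->
  (forall x, a < x < b -> is_derive g x (dg x)) ->
  (forall x y, a < x -> x <= y -> y < b -> dg y <= dg x) ->
  forall x, a <= x <= b -> (b - x) * g a + (x - a) * g b <= (b - a) * g x.
Proof.
  intros Hab Hc Hd Hm x Hx.
  destruct (Req_dec x a) as [->|Hxa]; [lra|].
  destruct (Req_dec x b) as [->|Hxb]; [lra|].
  destruct (MVT_is_derive g dg a x) as (c1 & Hc1 & E1); [lra| | |].
  { intros; apply Hc; lra. } { intros; apply Hd; lra. }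
  destruct (MVT_is_derive g dg x b) as (c2 & Hc2 & E2); [lra| | |].
  { intros; apply Hc; lra. } { intros; apply Hd; lra. }
  assert (H12 : dg c2 <= dg c1) by (apply Hm; lra).
  assert (0 <= (b - x) * (x - a) * (dg c1 - dg c2)).
  { apply Rmult_le_pos; [apply Rmult_le_pos|]; lra. }
  replace (g a) with (g x - dg c1 * (x - a)) by lra.
  replace (g b) with (g x + dg c2 * (b - x)) by lra.
  nra.
Qed.

(** * Limits from the right at 0 *)

Definition lim0 (f : R -> R) (l : R) : Prop := limit1_in f (fun x => 0 < x) l 0.

Lemma lim0_intro (f : R -> R) (l : R) :
  (forall e, 0 < e -> exists d, 0 < d /\ forall x, 0 < x < d -> Rabs (f x - l) < e) ->
  lim0 f l.
Proof.
  intros H e He. destruct (H e He) as (d & Hd & Hx).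
  exists d. split; [exact Hd|]. intros x [Hx0 Hxd].
  simpl in *. unfold Rdist in *. apply Hx. rewrite Rminus_0_r, Rabs_right in Hxd; lra.
Qed.

Lemma lim0_elim (f : R -> R) (l : R) :
  lim0 f l ->
  forall e, 0 < e -> exists d, 0 < d /\ forall x, 0 < x < d -> Rabs (f x - l) < e.
Proof.
  intros H e He. destruct (H e He) as (d & Hd & Hx).
  exists d. split; [exact Hd|]. intros x Hx0.
  apply (Hx x). split; [lra|]. simpl. unfold Rdist. rewrite Rminus_0_r, Rabs_right; lra.
Qed.

Lemma lim0_plus (f g : R -> R) (a b : R) :
  lim0 f a -> lim0 g b -> lim0 (fun x => f x + g x) (a + b).
Proof. apply limit_plus. Qed.

Lemma lim0_minus (f g : R -> R) (a b : R) :
  lim0 f a -> lim0 g b -> lim0 (fun x => f x - g x) (a - b).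
Proof. apply limit_minus. Qed.

Lemma lim0_mult (f g : R -> R) (a b : R) :
  lim0 f a -> lim0 g b -> lim0 (fun x => f x * g x) (a * b).
Proof. apply limit_mul. Qed.

Lemma lim0_const (a : R) : lim0 (fun _ => a) a.
Proof.
  apply lim0_intro. intros e He. exists 1. split; [lra|].
  intros x _. rewrite Rminus_diag, Rabs_R0. exact He.
Qed.

Lemma lim0_id : lim0 (fun x => x) 0.
Proof.
  apply lim0_intro. intros e He. exists e. split; [lra|].
  intros x Hx. rewrite Rminus_0_r, Rabs_right; lra.
Qed.

Lemma lim0_eq (f : R -> R) (a b : R) : lim0 f a -> a = b -> lim0 f b.
Proof. now intros H <-. Qed.

Lemma lim0_ext_loc (f g : R -> R) (l c : R) :
  0 < c -> (forall x, 0 < x < c -> f x = g x) -> lim0 f l -> lim0 g l.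
Proof.
  intros Hc E H. apply lim0_intro. intros e He.
  destruct (lim0_elim f l H e He) as (d & Hd & Hx).
  exists (Rmin c d). split; [now apply Rmin_glb_lt|].
  intros x Hx'. pose proof (Rmin_l c d). pose proof (Rmin_r c d).
  rewrite <- E by lra. apply Hx. lra.
Qed.

Lemma lim0_le (f g : R -> R) (a b c : R) :
  0 < c -> (forall x, 0 < x < c -> f x <= g x) -> lim0 f a -> lim0 g b -> a <= b.
Proof.
  intros Hc E Hf Hg. apply Rnot_lt_le. intros Hba.
  destruct (lim0_elim f a Hf ((a - b) / 2)) as (d1 & Hd1 & H1); [lra|].
  destruct (lim0_elim g b Hg ((a - b) / 2)) as (d2 & Hd2 & H2); [lra|].
  set (d := Rmin c (Rmin d1 d2)).
  assert (0 < d) by (unfold d; repeat apply Rmin_glb_lt; lra).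
  assert (d <= c /\ d <= d1 /\ d <= d2) as (? & ? & ?).
  { unfold d. pose proof (Rmin_l c (Rmin d1 d2)). pose proof (Rmin_r c (Rmin d1 d2)).
    pose proof (Rmin_l d1 d2). pose proof (Rmin_r d1 d2). lra. }
  specialize (H1 (d / 2) ltac:(lra)). specialize (H2 (d / 2) ltac:(lra)).
  specialize (E (d / 2) ltac:(lra)).
  apply Rabs_def2 in H1. apply Rabs_def2 in H2. lra.
Qed.

Lemma lim0_unique (f : R -> R) (a b : R) : lim0 f a -> lim0 f b -> a = b.
Proof.
  intros Ha Hb. apply Rle_antisym; eapply (lim0_le f f _ _ 1); eauto; intros; lra.
Qed.

Lemma lim0_squeeze (f g : R -> R) (l c : R) :
  0 < c -> (forall x, 0 < x < c -> Rabs (f x - l) <= g x) -> lim0 g 0 -> lim0 f l.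
Proof.
  intros Hc E Hg. apply lim0_intro. intros e He.
  destruct (lim0_elim g 0 Hg e He) as (d & Hd & Hx).
  exists (Rmin c d). split; [now apply Rmin_glb_lt|].
  intros x Hx'. pose proof (Rmin_l c d). pose proof (Rmin_r c d).
  specialize (E x ltac:(lra)). specialize (Hx x ltac:(lra)).
  apply Rabs_def2 in Hx. lra.
Qed.

Lemma lim0_eventually_lt (f : R -> R) (l M : R) :
  lim0 f l -> l < M -> exists d, 0 < d /\ forall x, 0 < x < d -> f x < M.
Proof.
  intros H Hl. destruct (lim0_elim f l H (M - l)) as (d & Hd & Hx); [lra|].
  exists d. split; [exact Hd|]. intros x Hx0. specialize (Hx x Hx0).
  apply Rabs_def2 in Hx. lra.
Qed.

Lemma lim0_eventually_gt (f : R -> R) (l M : R) :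
  lim0 f l -> M < l -> exists d, 0 < d /\ forall x, 0 < x < d -> M < f x.
Proof.
  intros H Hl. destruct (lim0_elim f l H (l - M)) as (d & Hd & Hx); [lra|].
  exists d. split; [exact Hd|]. intros x Hx0. specialize (Hx x Hx0).
  apply Rabs_def2 in Hx. lra.
Qed.

Lemma lim0_scale (f : R -> R) (k l : R) :
  0 < k -> lim0 f l -> lim0 (fun x => f (k * x)) l.
Proof.
  intros Hk H. apply lim0_intro. intros e He.
  destruct (lim0_elim f l H e He) as (d & Hd & Hx).
  exists (d / k). split; [now apply Rdiv_lt_0_compat|].
  intros x Hx'. apply Hx. split; [apply Rmult_lt_0_compat; lra|].
  replace d with (k * (d / k)) by (field; lra). apply Rmult_lt_compat_l; lra.
Qed.

Lemma continuity_pt_lim0 (f : R -> R) : continuity_pt f 0 -> lim0 f (f 0).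
Proof.
  intros H. apply lim0_intro. intros e He. destruct (H e He) as (d & Hd & Hx).
  exists d. split; [exact Hd|]. intros x Hx0.
  apply (Hx x). split; [split; [exact I|lra]|].
  simpl. unfold Rdist. rewrite Rminus_0_r, Rabs_right; lra.
Qed.

(** Stands in for integration from 0 when the derivative may be unbounded there: a nondecreasing
    function stays above its right limit at 0. *)
Lemma lim0_le_of_derive_nonneg (f df : R -> R) (l c : R) :
  (forall x, 0 < x < c -> is_derive f x (df x)) ->
  (forall x, 0 < x < c -> 0 <= df x) ->
  lim0 f l -> forall x, 0 < x < c -> l <= f x.
Proof.
  intros Hd Hp Hl x Hx.
  apply (lim0_le f (fun _ => f x) l (f x) x); [lra| |exact Hl|apply lim0_const].
  intros y Hy. apply (le_of_derive_nonneg_closed f df); [lra| |];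
    intros; [apply Hd|apply Hp]; lra.
Qed.

(** L'Hopital's rule from the right: as soon as df lies within e/2 of l, monotonicity puts f between
    the lines of slope l - e/2 and l + e/2 through the origin. *)
Lemma lim0_div_id (f df : R -> R) (l c : R) :
  0 < c ->
  (forall x, 0 < x < c -> is_derive f x (df x)) ->
  lim0 f 0 -> lim0 df l -> lim0 (fun x => f x / x) l.
Proof.
  intros Hc Hd Hf Hdf. apply lim0_intro. intros e He.
  destruct (lim0_elim df l Hdf (e / 2)) as (d & Hd0 & Hx); [lra|].
  exists (Rmin c d). split; [now apply Rmin_glb_lt|].
  intros x Hx'. pose proof (Rmin_l c d). pose proof (Rmin_r c d).
  assert (Hu : 0 <= (l + e / 2) * x - f x).
  { apply (lim0_le_of_derive_nonneg (fun x => (l + e / 2) * x - f x)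
             (fun x => (l + e / 2) - df x) 0 (Rmin c d)); [| | |exact Hx'].
    - intros y Hy. pose proof (Hd y ltac:(lra)) as Hdy. derive_as; ring.
    - intros y Hy. specialize (Hx y ltac:(lra)). apply Rabs_def2 in Hx. lra.
    - apply (lim0_eq _ ((l + e / 2) * 0 - 0)); [|ring].
      apply lim0_minus; [apply lim0_mult; [apply lim0_const|apply lim0_id]|exact Hf]. }
  assert (Hv : 0 <= f x - (l - e / 2) * x).
  { apply (lim0_le_of_derive_nonneg (fun x => f x - (l - e / 2) * x)
             (fun x => df x - (l - e / 2)) 0 (Rmin c d)); [| | |exact Hx'].
    - intros y Hy. pose proof (Hd y ltac:(lra)) as Hdy. derive_as; ring.
    - intros y Hy. specialize (Hx y ltac:(lra)). apply Rabs_def2 in Hx. lra.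
    - apply (lim0_eq _ (0 - (l - e / 2) * 0)); [|ring].
      apply lim0_minus; [exact Hf|apply lim0_mult; [apply lim0_const|apply lim0_id]]. }
  assert (E : f x / x - l = (f x - l * x) / x) by (field; lra).
  rewrite E. apply Rabs_def1.
  - apply (Rmult_lt_reg_r x); [lra|]. unfold Rdiv.
    rewrite Rmult_assoc, Rinv_l, Rmult_1_r by lra. nra.
  - apply (Rmult_lt_reg_r x); [lra|]. unfold Rdiv.
    rewrite Rmult_assoc, Rinv_l, Rmult_1_r by lra. nra.
Qed.

(** * Bounds for real powers *)

Lemma exp_le_mono (x y : R) : x <= y -> exp x <= exp y.
Proof. intros H. apply Rnot_lt_le. intros Hn. apply exp_lt_inv in Hn. lra. Qed.

Lemma Rpower_pos (x y : R) : 0 < Rpower x y.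
Proof. apply exp_pos. Qed.

Lemma is_derive_Rpower (a x : R) :
  0 < x -> is_derive (fun y => Rpower y a) x (a * Rpower x (a - 1)).
Proof. intros Hx. apply is_derive_Reals. now apply derivable_pt_lim_power. Qed.

Lemma Rpower_opp_antitone (p x y : R) :
  0 <= p -> 0 < x -> x <= y -> Rpower y (- p) <= Rpower x (- p).
Proof.
  intros Hp Hx Hxy. rewrite !Rpower_Ropp. apply Rinv_le_contravar.
  - apply Rpower_pos.
  - apply Rle_Rpower_l; lra.
Qed.

(** By the mean value theorem; the derivative of x^(-p) is largest in modulus at the left end mu. *)
Lemma Rpower_opp_lipschitz (p mu x y : R) :
  0 < p -> 0 < mu -> mu <= x -> mu <= y ->
  Rabs (Rpower x (- p) - Rpower y (- p)) <= p * Rpower mu (- p - 1) * Rabs (x - y).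
Proof.
  intros Hp Hmu.
  assert (key : forall x y, mu <= x -> x < y ->
    Rabs (Rpower x (- p) - Rpower y (- p)) <= p * Rpower mu (- p - 1) * Rabs (x - y)).
  { clear x y. intros x y Hx Hxy.
    destruct (MVT_is_derive (fun z => Rpower z (- p))
                (fun z => - p * Rpower z (- p - 1)) x y Hxy) as (c & Hc & E).
    { intros z Hz. eapply is_derive_continuity_pt, is_derive_Rpower. lra. }
    { intros z Hz. apply is_derive_Rpower. lra. }
    rewrite Rabs_minus_sym, E, Rabs_mult, (Rabs_minus_sym x y).
    apply Rmult_le_compat_r; [apply Rabs_pos|].
    rewrite Rabs_mult, Rabs_Ropp, (Rabs_right p) by lra.
    apply Rmult_le_compat_l; [lra|].
    rewrite Rabs_right by (apply Rle_ge, Rlt_le, Rpower_pos).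
    replace (- p - 1) with (- (p + 1)) by ring.
    apply Rpower_opp_antitone; lra. }
  intros Hx Hy. destruct (Rtotal_order x y) as [H|[H|H]].
  - now apply key.
  - subst. rewrite !Rminus_diag, Rabs_R0. lra.
  - rewrite Rabs_minus_sym, (Rabs_minus_sym x y). now apply key.
Qed.

Lemma lim0_Rpower (b : R) : 0 < b -> lim0 (fun x => Rpower x b) 0.
Proof.
  intros Hb. apply lim0_intro. intros e He.
  exists (Rpower e (/ b)). split; [apply Rpower_pos|].
  intros x [Hx0 Hx]. rewrite Rminus_0_r, Rabs_right by (apply Rle_ge, Rlt_le, Rpower_pos).
  replace e with (Rpower (Rpower e (/ b)) b).
  - apply Rlt_Rpower_l; lra.
  - rewrite Rpower_mult, Rinv_l, Rpower_1; lra.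
Qed.

(** * The linear equation w''' = a w *)

(** Serves when the sign of the derivative is known only up to the very point b at which the
    conclusion is drawn. *)
Lemma lim0_le_of_derive_nonneg_at (f df : R -> R) (l b : R) :
  0 < b ->
  (forall x, 0 < x <= b -> is_derive f x (df x)) ->
  (forall x, 0 < x <= b -> 0 <= df x) ->
  lim0 f l -> l <= f b.
Proof.
  intros Hb Hd Hp Hl.
  apply (lim0_le f (fun _ => f b) l (f b) b); [lra| |exact Hl|apply lim0_const].
  intros y Hy. apply (le_of_derive_nonneg_closed f df); [lra| |];
    intros; [apply Hd|apply Hp]; lra.
Qed.

(** The limit is the infimum of f, taken as minus the supremum of -f. *)
Lemma lim0_of_nondecreasing (f : R -> R) (c : R) :
  0 < c ->
  (forall x y, 0 < x -> x <= y -> y < c -> f x <= f y) ->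
  (forall x, 0 < x < c -> 0 <= f x) ->
  exists l, 0 <= l /\ lim0 f l /\ forall x, 0 < x < c -> l <= f x.
Proof.
  intros Hc Hm Hp.
  set (E := fun z => exists x, 0 < x < c /\ z = - f x).
  destruct (completeness E) as (s & Hub & Hlub).
  - exists 0. intros z (x & Hx & ->). specialize (Hp x Hx). lra.
  - exists (- f (c / 2)), (c / 2). split; [lra|reflexivity].
  - assert (Hl : forall x, 0 < x < c -> - s <= f x).
    { intros x Hx. specialize (Hub (- f x)). cut (- f x <= s); [lra|].
      apply Hub. exists x. now split. }
    exists (- s). split; [|split; [|exact Hl]].
    + cut (s <= 0); [lra|]. apply Hlub. intros z (x & Hx & ->).
      specialize (Hp x Hx). lra.
    + apply lim0_intro. intros e He.
      assert (Hex : exists x, 0 < x < c /\ f x < - s + e).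
      { apply NNPP. intros Hn. cut (s <= s - e); [lra|]. apply Hlub.
        intros z (x & Hx & ->). apply Rnot_lt_le. intros Hlt. apply Hn.
        exists x. split; [exact Hx|lra]. }
      destruct Hex as (x & Hx & Hfx). exists x. split; [lra|].
      intros y Hy. specialize (Hl y ltac:(lra)). specialize (Hm y x ltac:(lra) ltac:(lra) ltac:(lra)).
      apply Rabs_def1; lra.
Qed.

Section Linear.

Variables (c : R) (a w w1 w2 : R -> R).
Hypothesis c_pos : 0 < c.
Hypothesis w_der : forall x, 0 < x < c -> is_derive w x (w1 x).
Hypothesis w1_der : forall x, 0 < x < c -> is_derive w1 x (w2 x).
Hypothesis w2_der : forall x, 0 < x < c -> is_derive w2 x (a x * w x).
Hypothesis a_nonneg : forall x, 0 < x < c -> 0 <= a x.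
Hypothesis w_lim : lim0 w 0.
Hypothesis w1_lim : lim0 w1 0.
Hypothesis ww2_lim : lim0 (fun x => w x * w2 x) 0.

(** In the derivative of w w'' - w'^2/2 the terms w' w'' cancel and a w^2 is left. *)
Lemma linear_energy (x : R) : 0 < x < c -> w1 x * w1 x / 2 <= w x * w2 x.
Proof.
  intros Hx.
  cut (0 <= w x * w2 x - w1 x * w1 x * / 2); [unfold Rdiv; lra|].
  apply (lim0_le_of_derive_nonneg (fun y => w y * w2 y - w1 y * w1 y * / 2)
           (fun y => a y * (w y * w y)) 0 c); [| | |exact Hx].
  - intros y Hy. pose proof (w_der y Hy). pose proof (w1_der y Hy).
    pose proof (w2_der y Hy). derive_as. field.
  - intros y Hy. apply Rmult_le_pos; [now apply a_nonneg|nra].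
  - apply (lim0_eq _ (0 - 0 * 0 * / 2)); [|ring].
    apply lim0_minus; [exact ww2_lim|].
    apply lim0_mult; [|apply lim0_const]. now apply lim0_mult.
Qed.

Lemma linear_ww1_mono (x y : R) : 0 < x -> x <= y -> y < c -> w x * w1 x <= w y * w1 y.
Proof.
  intros Hx Hxy Hy.
  apply (le_of_derive_nonneg_closed (fun y => w y * w1 y)
           (fun y => w1 y * w1 y + w y * w2 y)); [exact Hxy| |].
  - intros z Hz. pose proof (w_der z ltac:(lra)). pose proof (w1_der z ltac:(lra)).
    derive_as. ring.
  - intros z Hz. pose proof (linear_energy z ltac:(lra)). nra.
Qed.

Lemma linear_ww1_nonneg (x : R) : 0 < x < c -> 0 <= w x * w1 x.
Proof.
  intros Hx. apply (lim0_le (fun y => w y * w1 y) (fun _ => w x * w1 x) 0 _ x).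
  - lra.
  - intros y Hy. apply linear_ww1_mono; lra.
  - apply (lim0_eq _ (0 * 0)); [|ring]. now apply lim0_mult.
  - apply lim0_const.
Qed.

Lemma linear_sqr_mono (x y : R) : 0 < x -> x <= y -> y < c -> w x * w x <= w y * w y.
Proof.
  intros Hx Hxy Hy.
  apply (le_of_derive_nonneg_closed (fun y => w y * w y)
           (fun y => 2 * (w y * w1 y))); [exact Hxy| |].
  - intros z Hz. pose proof (w_der z ltac:(lra)). derive_as. ring.
  - intros z Hz. pose proof (linear_ww1_nonneg z ltac:(lra)). lra.
Qed.

(** The hypothesis bounds w w' by any e > 0 at points arbitrarily close to c. As w w' is nonnegative
    and nondecreasing, it vanishes identically; so w^2 is constant, equal to its limit 0. *)
Lemma linear_zero_of_right_end :
  (forall x e, 0 < x < c -> 0 < e -> exists y, x < y < c /\ w y * w1 y < e) ->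
  forall x, 0 < x < c -> w x = 0.
Proof.
  intros Hend.
  assert (Hz : forall x, 0 < x < c -> w x * w1 x = 0).
  { intros x Hx. apply Rle_antisym; [|now apply linear_ww1_nonneg].
    apply Rnot_lt_le. intros Hlt.
    destruct (Hend x _ Hx Hlt) as (y & Hy & Hye).
    pose proof (linear_ww1_mono x y ltac:(lra) ltac:(lra) ltac:(lra)). lra. }
  intros x Hx.
  assert (H0 : 0 <= - (w x * w x)).
  { apply (lim0_le_of_derive_nonneg (fun y => - (w y * w y)) (fun _ => 0) 0 c);
      [| | |exact Hx].
    - intros y Hy. pose proof (w_der y Hy). derive_as.
      pose proof (Hz y Hy). lra.
    - intros; lra.
    - apply (lim0_eq _ (0 - 0 * 0)); [|ring].
      apply (lim0_ext_loc (fun y => 0 - w y * w y) _ _ 1); [lra|intros; ring|].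
      apply lim0_minus; [apply lim0_const|now apply lim0_mult]. }
  nra.
Qed.

(** A change of sign would produce a zero of w to the right of a point where w is nonzero, against
    the monotonicity of w^2. *)
Lemma linear_sign :
  (forall x, 0 < x < c -> 0 <= w x) \/ (forall x, 0 < x < c -> w x <= 0).
Proof.
  destruct (classic (exists x, 0 < x < c /\ w x < 0)) as [(x1 & Hx1 & Hn)|H1].
  2: { left. intros x Hx. apply Rnot_lt_le. intros H. apply H1. eauto. }
  right. intros x2 Hx2. apply Rnot_lt_le. intros Hp.
  assert (Hzero : exists z, 0 < z < c /\ w z = 0 /\ (x1 <= z \/ x2 <= z)).
  { destruct (Rtotal_order x1 x2) as [Hlt|[Heq|Hgt]].
    - destruct (Ranalysis5.IVT_interv w x1 x2) as (z & Hz & E); try lra.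
      + intros z Hz. eapply is_derive_continuity_pt, w_der. lra.
      + exists z. repeat split; try lra.
    - subst; lra.
    - destruct (Ranalysis5.IVT_interv (fun y => - w y) x2 x1) as (z & Hz & E); try lra.
      + intros z Hz. eapply is_derive_continuity_pt.
        apply is_derive_Ropp, w_der. lra.
      + exists z. repeat split; try lra. }
  destruct Hzero as (z & Hz & E & [Hle|Hle]).
  - pose proof (linear_sqr_mono x1 z ltac:(lra) Hle ltac:(lra)). rewrite E in H. nra.
  - pose proof (linear_sqr_mono x2 z ltac:(lra) Hle ltac:(lra)). rewrite E in H. nra.
Qed.

Hypothesis w_nonneg : forall x, 0 < x < c -> 0 <= w x.

Lemma linear_w2_mono (x y : R) : 0 < x -> x <= y -> y < c -> w2 x <= w2 y.
Proof.
  intros Hx Hxy Hy.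
  apply (le_of_derive_nonneg_closed w2 (fun y => a y * w y)); [exact Hxy| |].
  - intros z Hz. apply w2_der. lra.
  - intros z Hz. apply Rmult_le_pos; [apply a_nonneg|apply w_nonneg]; lra.
Qed.

(** Since w'' is nondecreasing, its integral over (0, y) is at most y w''(x). *)
Lemma linear_w1_le (x y : R) : 0 < y -> y <= x -> x < c -> w1 y <= y * w2 x.
Proof.
  intros Hy Hyx Hx. cut (0 <= y * w2 x - w1 y); [lra|].
  apply (lim0_le_of_derive_nonneg_at (fun y => y * w2 x - w1 y)
           (fun y => w2 x - w2 y) 0 y Hy).
  - intros z Hz. pose proof (w1_der z ltac:(lra)). derive_as. ring.
  - intros z Hz. pose proof (linear_w2_mono z x ltac:(lra) ltac:(lra) ltac:(lra)). lra.
  - apply (lim0_eq _ (0 * w2 x - 0)); [|ring]. apply lim0_minus; [|exact w1_lim].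
    apply lim0_mult; [apply lim0_id|apply lim0_const].
Qed.

Lemma linear_w_le (x : R) : 0 < x < c -> w x <= x * x / 2 * w2 x.
Proof.
  intros Hx. cut (0 <= x * x * (w2 x / 2) - w x); [unfold Rdiv; lra|].
  apply (lim0_le_of_derive_nonneg_at (fun y => y * y * (w2 x / 2) - w y)
           (fun y => y * w2 x - w1 y) 0 x); [lra| | |].
  - intros z Hz. pose proof (w_der z ltac:(lra)). derive_as. field.
  - intros z Hz. pose proof (linear_w1_le x z ltac:(lra) ltac:(lra) ltac:(lra)). lra.
  - apply (lim0_eq _ (0 * 0 * (w2 x / 2) - 0)); [|ring]. apply lim0_minus; [|exact w_lim].
    repeat apply lim0_mult; try apply lim0_id; apply lim0_const.
Qed.

Lemma linear_w2_nonneg (x : R) : 0 < x < c -> 0 <= w2 x.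
Proof.
  intros Hx. pose proof (linear_w_le x Hx). pose proof (w_nonneg x Hx).
  apply Rnot_lt_le. intros Hn. assert (Hq : 0 < x * x / 2) by nra.
  pose proof (Rmult_lt_0_compat _ (- w2 x) Hq ltac:(lra)). lra.
Qed.

(** The derivative of w/x^2 is (x w' - 2 w)/x^3, and its numerator starts from 0 with derivative x
    w'' - w' >= 0. *)
Lemma linear_quotient_mono (x y : R) :
  0 < x -> x <= y -> y < c -> w x / (x * x) <= w y / (y * y).
Proof.
  intros Hx Hxy Hy.
  assert (Hk : forall z, 0 < z < c -> 0 <= z * w1 z - 2 * w z).
  { intros z Hz.
    apply (lim0_le_of_derive_nonneg_at (fun y => y * w1 y - 2 * w y)
             (fun y => y * w2 y - w1 y) 0 z); [lra| | |].
    - intros t Ht. pose proof (w_der t ltac:(lra)). pose proof (w1_der t ltac:(lra)).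
      derive_as. ring.
    - intros t Ht. pose proof (linear_w1_le t t ltac:(lra) ltac:(lra) ltac:(lra)). lra.
    - apply (lim0_eq _ (0 * 0 - 2 * 0)); [|ring]. apply lim0_minus.
      + apply lim0_mult; [apply lim0_id|exact w1_lim].
      + apply lim0_mult; [apply lim0_const|exact w_lim]. }
  apply (le_of_derive_nonneg_closed (fun z => w z / (z * z))
           (fun z => (z * w1 z - 2 * w z) / (z * z * z))); [exact Hxy| |].
  - intros z Hz. pose proof (w_der z ltac:(lra)) as Hd.
    assert (Hq : is_derive (fun z => z * z) z (2 * z)) by (derive_as; ring).
    eapply is_derive_eq.
    + apply (is_derive_div w (fun z => z * z) z _ _ Hd Hq). nra.
    + field. lra.
  - intros z Hz. apply Rmult_le_pos; [apply Hk; lra|].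
    apply Rlt_le, Rinv_0_lt_compat. repeat apply Rmult_lt_0_compat; lra.
Qed.

Lemma linear_quotient_lim : exists l, lim0 (fun x => w x / (x * x)) l.
Proof.
  destruct (lim0_of_nondecreasing (fun x => w x / (x * x)) c c_pos) as (l & _ & Hl & _).
  - intros; now apply linear_quotient_mono.
  - intros x Hx. apply Rmult_le_pos; [now apply w_nonneg|].
    apply Rlt_le, Rinv_0_lt_compat. nra.
  - now exists l.
Qed.

(** The monotone w'' has a limit l >= 0 at 0, and w/x^2 >= l/2 forces l = 0. From w <= (x^2/2) w''
    and the bound on a one gets w''' <= (C/2) x^(b-1) w'', whose coefficient is integrable at 0;
    Gronwall's argument then gives w'' = 0. *)
Lemma linear_zero_of_quotient_lim (C b : R) :
  0 < b -> (forall x, 0 < x < c -> a x <= C * Rpower x (b - 3)) -> 0 <= C ->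
  lim0 (fun x => w x / (x * x)) 0 -> forall x, 0 < x < c -> w x = 0.
Proof.
  intros Hb Ha HC Hq.
  destruct (lim0_of_nondecreasing w2 c c_pos) as (l & Hl0 & Hl & Hle).
  { apply linear_w2_mono. } { apply linear_w2_nonneg. }
  assert (Hw1 : forall y, 0 < y < c -> y * l <= w1 y).
  { intros y Hy. cut (0 <= w1 y - y * l); [lra|].
    apply (lim0_le_of_derive_nonneg_at (fun y => w1 y - y * l) (fun y => w2 y - l) 0 y);
      [lra| | |].
    - intros z Hz. pose proof (w1_der z ltac:(lra)). derive_as. ring.
    - intros z Hz. pose proof (Hle z ltac:(lra)). lra.
    - apply (lim0_eq _ (0 - 0 * l)); [|ring]. apply lim0_minus; [exact w1_lim|].
      apply lim0_mult; [apply lim0_id|apply lim0_const]. }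
  assert (Hw : forall y, 0 < y < c -> l / 2 <= w y / (y * y)).
  { intros y Hy. cut (0 <= w y - y * y * (l / 2)).
    { intros H. apply (Rmult_le_reg_r (y * y)); [nra|]. unfold Rdiv.
      rewrite (Rmult_assoc (w y)), Rinv_l by nra. lra. }
    apply (lim0_le_of_derive_nonneg_at (fun y => w y - y * y * (l / 2))
             (fun y => w1 y - y * l) 0 y); [lra| | |].
    - intros z Hz. pose proof (w_der z ltac:(lra)). derive_as. field.
    - intros z Hz. pose proof (Hw1 z ltac:(lra)). lra.
    - apply (lim0_eq _ (0 - 0 * 0 * (l / 2))); [|ring]. apply lim0_minus; [exact w_lim|].
      repeat apply lim0_mult; try apply lim0_id; apply lim0_const. }
  assert (Hl0' : l / 2 <= 0).
  { apply (lim0_le (fun _ => l / 2) (fun x => w x / (x * x)) _ _ c c_pos);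
      [exact Hw|apply lim0_const|exact Hq]. }
  assert (l = 0) by lra. subst l. clear Hl0 Hl0' Hw Hw1 Hle.
  (* K x^b is the primitive of (C/2) x^(b-1), so exp(- K x^b) is the integrating factor of the
     Gronwall step. *)
  set (K := C / (2 * b)).
  assert (HK : 0 <= K) by (unfold K; apply Rle_mult_inv_pos; lra).
  assert (Hg : forall x, 0 < x < c -> 0 <= - (w2 x * exp (- (K * Rpower x b)))).
  { intros x Hx.
    apply (lim0_le_of_derive_nonneg
      (fun x => - (w2 x * exp (- (K * Rpower x b))))
      (fun x => (K * b * Rpower x (b - 1) * w2 x - a x * w x) * exp (- (K * Rpower x b)))
      0 c); [| | |exact Hx].
    - intros y Hy. pose proof (w2_der y Hy).
      assert (He : is_derive (fun x => exp (- (K * Rpower x b))) y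
                (- (K * (b * Rpower y (b - 1))) * exp (- (K * Rpower y b)))).
      { apply is_derive_Rcomp.
        - apply is_derive_exp.
        - pose proof (is_derive_Rpower b y ltac:(lra)). derive_as. ring. }
      derive_as. ring.
    - intros y Hy. apply Rmult_le_pos; [|apply Rlt_le, exp_pos].
      assert (E : Rpower y (b - 1) = Rpower y (b - 3) * (y * y)).
      { replace (y * y) with (Rpower y 2).
        - rewrite <- Rpower_plus. f_equal. ring.
        - replace 2 with (1 + 1) by ring. rewrite Rpower_plus, Rpower_1; lra. }
      rewrite E.
      pose proof (linear_w_le y Hy) as Hwl. pose proof (Ha y Hy) as Hay.
      pose proof (Rpower_pos y (b - 3)). pose proof (w_nonneg y Hy).
      pose proof (linear_w2_nonneg y Hy).
      assert (a y * w y <= C * Rpower y (b - 3) * (y * y / 2 * w2 y)).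
      { apply Rmult_le_compat; auto. }
      assert (EK : K * b = C / 2) by (unfold K; field; lra).
      rewrite EK. lra.
    - apply (lim0_eq _ (0 - 0 * 1)); [|ring].
      apply (lim0_ext_loc (fun y => 0 - w2 y * exp (- (K * Rpower y b))) _ _ 1);
        [lra|intros; ring|].
      apply lim0_minus; [apply lim0_const|]. apply lim0_mult; [exact Hl|].
      apply (lim0_squeeze _ (fun x => K * Rpower x b) _ 1); [lra| |].
      + intros y Hy. pose proof (Rpower_pos y b).
        assert (0 <= K * Rpower y b) by nra.
        pose proof (exp_ineq1_le (- (K * Rpower y b))).
        assert (exp (- (K * Rpower y b)) <= 1).
        { rewrite <- exp_0. apply exp_le_mono. lra. }
        apply Rabs_le. lra.
      + apply (lim0_eq _ (K * 0)); [|ring].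
        apply lim0_mult; [apply lim0_const|now apply lim0_Rpower]. }
  intros x Hx. specialize (Hg x Hx).
  pose proof (exp_pos (- (K * Rpower x b))) as He.
  pose proof (linear_w_le x Hx). pose proof (w_nonneg x Hx).
  assert (w2 x <= 0).
  { apply Rnot_lt_le. intros Hn. pose proof (Rmult_lt_0_compat _ _ Hn He). lra. }
  assert (0 < x * x / 2) by nra. nra.
Qed.

End Linear.

(** * Comparison of solutions *)

(** A solution near 0, with the equation solved for H''' and the data at 0 as right limits, and no
    condition at 1. The global solution and the series solutions are all of this kind, so they can
    be compared with each other. *)
Definition local_solution (p theta c : R) (H H1 H2 : R -> R) : Prop :=
  (forall x, 0 < x < c -> 0 < H x /\ is_derive H x (H1 x) /\ is_derive H1 x (H2 x) /\
     is_derive H2 x (- (1 - x) * Rpower (H x) (- p))) /\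
  lim0 H 0 /\ lim0 H1 theta.

Lemma local_solution_restrict (p theta c c' : R) (H H1 H2 : R -> R) :
  c' <= c -> local_solution p theta c H H1 H2 -> local_solution p theta c' H H1 H2.
Proof.
  intros Hc (Hs & Hl). split; [|exact Hl]. intros x Hx. apply Hs. lra.
Qed.

(** H'' is nonincreasing because H''' <= 0. Hence x H''(x) lies between H'(2x) - H'(x) and 2 (H'(x)
    - H'(x/2)), and both tend to theta - theta = 0. *)
Lemma local_solution_lim_xH2 (p theta c : R) (H H1 H2 : R -> R) :
  0 < c -> c <= 1 -> local_solution p theta c H H1 H2 -> lim0 (fun x => x * H2 x) 0.
Proof.
  intros Hc Hc1 (Hs & Hl & Hl1).
  assert (Hm : forall x y, 0 < x -> x <= y -> y < c -> H2 y <= H2 x).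
  { intros x y Hx Hxy Hy. cut (- H2 x <= - H2 y); [lra|].
    apply (le_of_derive_nonneg_closed (fun z => - H2 z)
             (fun z => (1 - z) * Rpower (H z) (- p))); [exact Hxy| |].
    - intros z Hz. destruct (Hs z ltac:(lra)) as (_ & _ & _ & Hd). derive_as. ring.
    - intros z Hz. apply Rmult_le_pos; [lra|apply Rlt_le, Rpower_pos]. }
  apply (lim0_squeeze _ (fun x => Rabs (H1 (2 * x) - H1 x) + 2 * Rabs (H1 x - H1 (/ 2 * x)))
           _ (c / 2)); [lra| |].
  - intros x Hx. rewrite Rminus_0_r.
    destruct (MVT_is_derive H1 H2 x (2 * x)) as (u & Hu & Eu); [lra| | |].
    { intros z Hz. destruct (Hs z ltac:(lra)) as (_ & _ & Hd & _).
      apply (is_derive_continuity_pt _ _ _ Hd). }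
    { intros z Hz. apply (Hs z ltac:(lra)). }
    destruct (MVT_is_derive H1 H2 (/ 2 * x) x) as (v & Hv & Ev); [lra| | |].
    { intros z Hz. destruct (Hs z ltac:(lra)) as (_ & _ & Hd & _).
      apply (is_derive_continuity_pt _ _ _ Hd). }
    { intros z Hz. apply (Hs z ltac:(lra)). }
    pose proof (Hm x u ltac:(lra) ltac:(lra) ltac:(lra)).
    pose proof (Hm v x ltac:(lra) ltac:(lra) ltac:(lra)).
    pose proof (Rle_abs (H1 x - H1 (/ 2 * x))).
    pose proof (Rle_abs (- (H1 (2 * x) - H1 x))) as Ha. rewrite Rabs_Ropp in Ha.
    pose proof (Rabs_pos (H1 x - H1 (/ 2 * x))).
    pose proof (Rabs_pos (H1 (2 * x) - H1 x)).
    apply Rabs_le. split; nra.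
  - assert (Habs : forall f, lim0 f 0 -> lim0 (fun x => Rabs (f x)) 0).
    { intros f Hf. apply lim0_intro. intros e He.
      destruct (lim0_elim f 0 Hf e He) as (d & Hd & Hx). exists d. split; [exact Hd|].
      intros x Hx0. specialize (Hx x Hx0). rewrite Rminus_0_r in *. now rewrite Rabs_Rabsolu. }
    apply (lim0_eq _ (0 + 2 * 0)); [|ring].
    apply lim0_plus; [|apply lim0_mult; [apply lim0_const|]]; apply Habs;
      (eapply lim0_eq; [apply lim0_minus|]).
    + apply lim0_scale; [lra|exact Hl1].
    + exact Hl1.
    + ring.
    + exact Hl1.
    + apply lim0_scale; [lra|exact Hl1].
    + ring.
Qed.

Lemma local_solution_lim_div (p theta c : R) (H H1 H2 : R -> R) :
  0 < c -> local_solution p theta c H H1 H2 -> lim0 (fun x => H x / x) theta.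
Proof.
  intros Hc (Hs & Hl & Hl1). apply (lim0_div_id H H1 theta c Hc); auto.
  intros x Hx. apply (Hs x Hx).
Qed.

(** Minus the difference quotient of h^(-p): with it the difference of two solutions satisfies a
    linear equation exactly, without linearisation error. The value 0 on the diagonal respects both
    the sign and the upper bound proved below. *)
Definition secant (p h k : R) : R :=
  if Req_EM_T h k then 0 else (Rpower k (- p) - Rpower h (- p)) / (h - k).

Lemma secant_spec (p h k : R) :
  secant p h k * (h - k) = Rpower k (- p) - Rpower h (- p).
Proof.
  unfold secant. destruct (Req_EM_T h k) as [->|Hn]; [ring|field; lra].
Qed.

Lemma secant_nonneg (p h k : R) : 0 <= p -> 0 < h -> 0 < k -> 0 <= secant p h k.
Proof.
  intros Hp Hh Hk. unfold secant. destruct (Req_EM_T h k) as [->|Hn]; [lra|].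
  destruct (Rlt_le_dec h k) as [Hlt|Hle].
  - pose proof (Rpower_opp_antitone p h k Hp Hh ltac:(lra)).
    replace ((Rpower k (- p) - Rpower h (- p)) / (h - k))
      with ((Rpower h (- p) - Rpower k (- p)) / (k - h)) by (field; lra).
    apply Rle_mult_inv_pos; lra.
  - pose proof (Rpower_opp_antitone p k h Hp Hk ltac:(lra)).
    apply Rle_mult_inv_pos; lra.
Qed.

Lemma secant_le (p mu h k : R) :
  0 < p -> 0 < mu -> mu <= h -> mu <= k -> secant p h k <= p * Rpower mu (- p - 1).
Proof.
  intros Hp Hmu Hh Hk.
  assert (Hpos : 0 <= p * Rpower mu (- p - 1)).
  { apply Rmult_le_pos; [lra|apply Rlt_le, Rpower_pos]. }
  destruct (Req_dec h k) as [E|Hn].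
  - unfold secant. destruct (Req_EM_T h k); [exact Hpos|contradiction].
  - pose proof (Rpower_opp_lipschitz p mu h k Hp Hmu Hh Hk) as HL.
    rewrite Rabs_minus_sym, <- secant_spec, Rabs_mult in HL.
    apply Rmult_le_reg_r in HL; [|apply Rabs_pos_lt; lra].
    pose proof (Rle_abs (secant p h k)). lra.
Qed.

Lemma lim0_opp (f : R -> R) (l : R) : lim0 f l -> lim0 (fun x => - f x) (- l).
Proof. apply limit_Ropp. Qed.

Section Comparison.

Variables (p theta c : R) (H H1 H2 K K1 K2 : R -> R).
Hypothesis p_pos : 0 < p.
Hypothesis theta_pos : 0 < theta.
Hypothesis c_pos : 0 < c.
Hypothesis c_le : c <= 1.
Hypothesis H_sol : local_solution p theta c H H1 H2.
Hypothesis K_sol : local_solution p theta c K K1 K2.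

Let a (x : R) : R := (1 - x) * secant p (H x) (K x).

Lemma comparison_der (x : R) : 0 < x < c ->
  is_derive (fun x => H x - K x) x (H1 x - K1 x) /\
  is_derive (fun x => H1 x - K1 x) x (H2 x - K2 x) /\
  is_derive (fun x => H2 x - K2 x) x (a x * (H x - K x)).
Proof.
  intros Hx. destruct H_sol as (Hs & _). destruct K_sol as (Ks & _).
  destruct (Hs x Hx) as (_ & ? & ? & ?). destruct (Ks x Hx) as (_ & ? & ? & ?).
  split; [|split]; derive_as; try reflexivity.
  unfold a. rewrite Rmult_assoc, secant_spec. ring.
Qed.

Lemma comparison_a_nonneg (x : R) : 0 < x < c -> 0 <= a x.
Proof.
  intros Hx. apply Rmult_le_pos; [lra|]. destruct H_sol as (Hs & _). destruct K_sol as (Ks & _).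
  apply secant_nonneg; [lra|apply Hs|apply Ks]; exact Hx.
Qed.

Lemma comparison_lim : lim0 (fun x => H x - K x) 0.
Proof.
  destruct H_sol as (_ & Hl & _). destruct K_sol as (_ & Kl & _).
  apply (lim0_eq _ (0 - 0)); [|ring]. now apply lim0_minus.
Qed.

Lemma comparison_lim1 : lim0 (fun x => H1 x - K1 x) 0.
Proof.
  destruct H_sol as (_ & _ & Hl). destruct K_sol as (_ & _ & Kl).
  apply (lim0_eq _ (theta - theta)); [|ring]. now apply lim0_minus.
Qed.

(** Moving a factor x across the product gives (w/x)(x w''), where each factor tends to 0. *)
Lemma comparison_lim2 : lim0 (fun x => (H x - K x) * (H2 x - K2 x)) 0.
Proof.
  apply (lim0_ext_loc (fun x => (H x / x - K x / x) * (x * H2 x - x * K2 x)) _ _ 1); [lra| |].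
  { intros x Hx. field. lra. }
  apply (lim0_eq _ ((theta - theta) * (0 - 0))); [|ring].
  apply lim0_mult; apply lim0_minus.
  - now apply (local_solution_lim_div p theta c H H1 H2).
  - now apply (local_solution_lim_div p theta c K K1 K2).
  - now apply (local_solution_lim_xH2 p theta c H H1 H2).
  - now apply (local_solution_lim_xH2 p theta c K K1 K2).
Qed.

Lemma comparison_unique :
  (forall x e, 0 < x < c -> 0 < e ->
     exists y, x < y < c /\ (H y - K y) * (H1 y - K1 y) < e) ->
  forall x, 0 < x < c -> H x = K x.
Proof.
  intros Hend x Hx. cut (H x - K x = 0); [lra|].
  apply (linear_zero_of_right_end c a (fun x => H x - K x) (fun x => H1 x - K1 x)
           (fun x => H2 x - K2 x)); auto.
  - intros; now apply comparison_der.
  - intros; now apply comparison_der.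
  - intros; now apply comparison_der.
  - apply comparison_a_nonneg.
  - apply comparison_lim.
  - apply comparison_lim1.
  - apply comparison_lim2.
Qed.

Lemma comparison_sign :
  (forall x, 0 < x < c -> 0 <= H x - K x) \/ (forall x, 0 < x < c -> H x - K x <= 0).
Proof.
  apply (linear_sign c a (fun x => H x - K x) (fun x => H1 x - K1 x)
           (fun x => H2 x - K2 x)); auto.
  - intros; now apply comparison_der.
  - intros; now apply comparison_der.
  - intros; now apply comparison_der.
  - apply comparison_a_nonneg.
  - apply comparison_lim.
  - apply comparison_lim1.
  - apply comparison_lim2.
Qed.

End Comparison.

(** [linear_quotient_lim] requires w >= 0; by [comparison_sign] this holds for H - K or for K - H,
    and exchanging the two solutions changes only the sign of the limit. *)
Lemma comparison_quotient_lim (p theta c : R) (H H1 H2 K K1 K2 : R -> R) :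
  0 < p -> 0 < theta -> 0 < c -> c <= 1 ->
  local_solution p theta c H H1 H2 -> local_solution p theta c K K1 K2 ->
  exists l, lim0 (fun x => (H x - K x) / (x * x)) l.
Proof.
  assert (key : forall H H1 H2 K K1 K2 : R -> R,
    0 < p -> 0 < theta -> 0 < c -> c <= 1 ->
    local_solution p theta c H H1 H2 -> local_solution p theta c K K1 K2 ->
    (forall x, 0 < x < c -> 0 <= H x - K x) ->
    exists l, lim0 (fun x => (H x - K x) / (x * x)) l).
  { clear. intros H H1 H2 K K1 K2 Hp Ht Hc Hc1 HH HK Hw.
    apply (linear_quotient_lim c (fun x => (1 - x) * secant p (H x) (K x))
             (fun x => H x - K x) (fun x => H1 x - K1 x) (fun x => H2 x - K2 x)); auto.
    - intros. apply (comparison_der p theta c H H1 H2 K K1 K2); auto.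
    - intros. apply (comparison_der p theta c H H1 H2 K K1 K2); auto.
    - intros. apply (comparison_der p theta c H H1 H2 K K1 K2); auto.
    - apply (comparison_a_nonneg p theta c H H1 H2 K K1 K2); auto.
    - apply (comparison_lim p theta c H H1 H2 K K1 K2); auto.
    - apply (comparison_lim1 p theta c H H1 H2 K K1 K2); auto. }
  intros Hp Ht Hc Hc1 HH HK.
  destruct (comparison_sign p theta c H H1 H2 K K1 K2) as [Hw|Hw]; auto.
  - eapply key; eauto.
  - destruct (key K K1 K2 H H1 H2) as (l & Hl); auto.
    + intros x Hx. specialize (Hw x Hx). lra.
    + exists (- l). apply (lim0_ext_loc (fun x => - ((K x - H x) / (x * x))) _ _ 1); [lra| |].
      * intros x Hx. field. lra.
      * now apply lim0_opp.
Qed.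

(** Near 0 both solutions exceed theta x / 2, so the coefficient of the linear equation is at most p
    (theta x / 2)^(-p-1), a multiple of x^(b-3) since p = 2 - b. *)
Lemma comparison_equal_of_quotient_lim (p theta c b : R) (H H1 H2 K K1 K2 : R -> R) :
  0 < p -> 0 < theta -> 0 < c -> c <= 1 -> 0 < b -> p = 2 - b ->
  local_solution p theta c H H1 H2 -> local_solution p theta c K K1 K2 ->
  lim0 (fun x => (H x - K x) / (x * x)) 0 ->
  exists c', 0 < c' <= c /\ forall x, 0 < x < c' -> H x = K x.
Proof.
  assert (key : forall H H1 H2 K K1 K2 : R -> R,
    0 < p -> 0 < theta -> 0 < c -> c <= 1 -> 0 < b -> p = 2 - b ->
    local_solution p theta c H H1 H2 -> local_solution p theta c K K1 K2 ->
    lim0 (fun x => (H x - K x) / (x * x)) 0 ->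
    (forall x, 0 < x < c -> 0 <= H x - K x) ->
    exists c', 0 < c' <= c /\ forall x, 0 < x < c' -> H x = K x).
  { clear. intros H H1 H2 K K1 K2 Hp Ht Hc Hc1 Hb Epb HH HK Hq Hw.
    destruct (lim0_eventually_gt _ _ (theta / 2)
                (local_solution_lim_div p theta c H H1 H2 Hc HH)) as (d1 & Hd1 & HH1); [lra|].
    destruct (lim0_eventually_gt _ _ (theta / 2)
                (local_solution_lim_div p theta c K K1 K2 Hc HK)) as (d2 & Hd2 & HK1); [lra|].
    set (c' := Rmin c (Rmin d1 d2)).
    assert (Hc' : 0 < c') by (unfold c'; repeat apply Rmin_glb_lt; lra).
    assert (c' <= c /\ c' <= d1 /\ c' <= d2) as (? & ? & ?).
    { unfold c'. pose proof (Rmin_l c (Rmin d1 d2)). pose proof (Rmin_r c (Rmin d1 d2)).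
      pose proof (Rmin_l d1 d2). pose proof (Rmin_r d1 d2). lra. }
    exists c'. split; [lra|]. intros x Hx. cut (H x - K x = 0); [lra|].
    pose proof (local_solution_restrict p theta c c' H H1 H2 ltac:(lra) HH) as HH'.
    pose proof (local_solution_restrict p theta c c' K K1 K2 ltac:(lra) HK) as HK'.
    apply (linear_zero_of_quotient_lim c' (fun x => (1 - x) * secant p (H x) (K x))
             (fun x => H x - K x) (fun x => H1 x - K1 x) (fun x => H2 x - K2 x)) with
        (C := p * Rpower (theta / 2) (- p - 1)) (b := b); auto.
    - intros. apply (comparison_der p theta c' H H1 H2 K K1 K2); auto.
    - intros. apply (comparison_der p theta c' H H1 H2 K K1 K2); auto.
    - intros. apply (comparison_der p theta c' H H1 H2 K K1 K2); auto.
    - apply (comparison_a_nonneg p theta c' H H1 H2 K K1 K2); auto. lra.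
    - apply (comparison_lim p theta c' H H1 H2 K K1 K2); auto.
    - apply (comparison_lim1 p theta c' H H1 H2 K K1 K2); auto.
    - intros y Hy. apply Hw. lra.
    - intros y Hy.
      assert (Hge : forall G, theta / 2 < G / y -> theta / 2 * y <= G).
      { intros G HG. apply (Rmult_lt_compat_r y) in HG; [|lra].
        unfold Rdiv at 2 in HG. rewrite Rmult_assoc, Rinv_l in HG by lra. lra. }
      pose proof (Hge _ (HH1 y ltac:(lra))). pose proof (Hge _ (HK1 y ltac:(lra))).
      assert (0 < theta / 2 * y) by nra.
      pose proof (secant_le p (theta / 2 * y) (H y) (K y) Hp ltac:(lra) ltac:(lra) ltac:(lra)) as Hs.
      rewrite <- Rpower_mult_distr in Hs by lra.
      assert (0 <= secant p (H y) (K y)).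
      { apply secant_nonneg; lra. }
      replace (b - 3) with (- p - 1) by lra. nra.
    - apply Rmult_le_pos; [lra|apply Rlt_le, Rpower_pos]. }
  intros Hp Ht Hc Hc1 Hb Epb HH HK Hq.
  destruct (comparison_sign p theta c H H1 H2 K K1 K2) as [Hw|Hw]; auto.
  - eapply key; eauto.
  - destruct (key K K1 K2 H H1 H2) as (c' & Hc' & E); auto.
    + apply (lim0_ext_loc (fun x => - ((H x - K x) / (x * x))) _ _ 1); [lra| |].
      * intros x Hx. field. lra.
      * apply (lim0_eq _ (- 0)); [|ring]. now apply lim0_opp.
    + intros x Hx. specialize (Hw x Hx). lra.
    + exists c'. split; [exact Hc'|]. intros x Hx. symmetry. now apply E.
Qed.

(** * Shooting for a regular right-hand side *)

Lemma continuous_Rmax (f g : R -> R) (x : R) :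
  continuous f x -> continuous g x -> continuous (fun y => Rmax (f y) (g y)) x.
Proof.
  intros Hf Hg.
  assert (E : forall a b : R, (a + b + Rabs (a - b)) * / 2 = Rmax a b).
  { intros a b. unfold Rmax. destruct (Rle_dec a b).
    - rewrite Rabs_left1 by lra. field.
    - rewrite Rabs_right by lra. field. }
  apply (continuous_ext (fun y => (f y + g y + Rabs (f y - g y)) * / 2)); [intros y; apply E|].
  apply (continuous_mult (fun y => f y + g y + Rabs (f y - g y)) (fun _ => / 2));
    [|apply continuous_const].
  apply (continuous_plus (fun y => f y + g y) (fun y => Rabs (f y - g y))).
  - now apply (continuous_plus f g).
  - apply (continuous_comp (fun y => f y - g y) Rabs).
    + now apply (continuous_minus f g).
    + apply continuous_Rabs.
Qed.

(** Extends functions known on [0,1] continuously to the whole line. The minimum is rewritten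
    through a maximum so that [continuous_Rmax] is enough. *)
Definition clamp01 (x : R) : R := Rmax 0 (1 - Rmax 0 (1 - x)).

Lemma clamp01_range (x : R) : 0 <= clamp01 x <= 1.
Proof. unfold clamp01, Rmax. repeat destruct Rle_dec; lra. Qed.

Lemma clamp01_id (x : R) : 0 <= x <= 1 -> clamp01 x = x.
Proof. intros H. unfold clamp01, Rmax. repeat destruct Rle_dec; lra. Qed.

Lemma continuous_clamp01 (x : R) : continuous clamp01 x.
Proof.
  apply (continuous_Rmax (fun _ => 0) (fun x => 1 - Rmax 0 (1 - x))).
  - apply continuous_const.
  - apply (continuous_minus (fun _ => 1) (fun x => Rmax 0 (1 - x))).
    + apply continuous_const.
    + apply (continuous_Rmax (fun _ => 0) (fun x => 1 - x)).
      * apply continuous_const.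
      * apply (continuous_minus (fun _ => 1) (fun x => x)).
        -- apply continuous_const.
        -- apply continuous_id.
Qed.

Lemma continuous_uniform_limit (f : R -> R) :
  (forall e, 0 < e -> exists g, (forall x, continuous g x) /\ forall x, Rabs (f x - g x) <= e) ->
  forall x, continuous f x.
Proof.
  intros H x. apply continuity_pt_filterlim. intros e He.
  destruct (H (e / 4)) as (g & Hg & Hfg); [lra|].
  specialize (Hg x). apply continuity_pt_filterlim in Hg.
  destruct (Hg (e / 4)) as (d & Hd & Hx); [lra|].
  exists d. split; [exact Hd|]. intros y Hy. specialize (Hx y Hy).
  simpl in *. unfold Rdist in *.
  pose proof (Hfg x) as Hx'. pose proof (Hfg y) as Hy'.
  apply Rcomplements.Rabs_le_between in Hx'. apply Rcomplements.Rabs_le_between in Hy'.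
  apply Rabs_def2 in Hx. apply Rabs_def1; lra.
Qed.

Lemma geometric_limit (u : nat -> R) (C : R) :
  (forall n, Rabs (u (S n) - u n) <= C / 2 ^ n) ->
  forall n, Rabs (u n - real (Lim_seq u)) <= 2 * C / 2 ^ n.
Proof.
  intros H.
  assert (Hp : forall n, 0 < 2 ^ n) by (intros; apply pow_lt; lra).
  assert (HC : 0 <= C).
  { specialize (H 0%nat). simpl in H. pose proof (Rabs_pos (u 1%nat - u 0%nat)). lra. }
  assert (Hk : forall n k, Rabs (u (n + k)%nat - u n) <= 2 * C / 2 ^ n - 2 * C / 2 ^ (n + k)).
  { intros n k. induction k as [|k IH].
    - rewrite Nat.add_0_r, Rminus_diag, Rabs_R0. lra.
    - rewrite Nat.add_succ_r. specialize (H (n + k)%nat).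
      replace (u (S (n + k)) - u n) with ((u (S (n + k)) - u (n + k)%nat) + (u (n + k)%nat - u n)) by ring.
      eapply Rle_trans; [apply Rabs_triang|].
      replace (2 * C / 2 ^ S (n + k)) with (C / 2 ^ (n + k)).
      2: { simpl. field. apply Rgt_not_eq, Hp. }
      assert (2 * C / 2 ^ (n + k) = 2 * (C / 2 ^ (n + k))) by (unfold Rdiv; ring). lra. }
  assert (Hcv : ex_finite_lim_seq u).
  { apply ex_lim_seq_cauchy_corr. intros e.
    assert (Hl : is_lim_seq (fun n => 2 * C * (/ 2) ^ n) 0).
    { replace (Finite 0) with (Rbar_mult (Finite (2 * C)) (Finite 0)) by (simpl; f_equal; ring).
      apply is_lim_seq_scal_l, is_lim_seq_geom. rewrite Rabs_right; lra. }
    apply is_lim_seq_spec in Hl. destruct (Hl (pos_div_2 e)) as (N & HN).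
    exists N. assert (Hb : forall n, (N <= n)%nat -> Rabs (u n - u N) < e / 2).
    { intros n Hn. replace n with (N + (n - N))%nat by lia.
      eapply Rle_lt_trans; [apply Hk|].
      specialize (HN N (Nat.le_refl _)). simpl in HN. rewrite Rminus_0_r, pow_inv in HN.
      pose proof (Rle_abs (2 * C * / 2 ^ N)).
      assert (0 <= 2 * C / 2 ^ (N + (n - N))) by (apply Rle_mult_inv_pos; [lra|apply Hp]).
      unfold Rdiv in *. lra. }
    intros n k Hn Hk'. pose proof (Hb n Hn) as H1. pose proof (Hb k Hk') as H2.
    apply Rabs_def2 in H1. apply Rabs_def2 in H2. apply Rabs_def1; lra. }
  destruct Hcv as (l & Hl). rewrite (is_lim_seq_unique _ _ Hl). simpl.
  intros n. rewrite Rabs_minus_sym.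
  assert (HL : is_lim_seq (fun k => Rabs (u (k + n)%nat - u n)) (Rabs (l - u n))).
  { apply (is_lim_seq_abs (fun k => u (k + n)%nat - u n) (Finite (l - u n))).
    apply is_lim_seq_minus'; [|apply is_lim_seq_const].
    now apply (is_lim_seq_incr_n u). }
  assert (HR : is_lim_seq (fun _ : nat => 2 * C / 2 ^ n) (2 * C / 2 ^ n)) by apply is_lim_seq_const.
  apply (is_lim_seq_le _ _ _ _ ) with (2 := HL) (3 := HR).
  intros k. rewrite Nat.add_comm. eapply Rle_trans; [apply Hk|].
  assert (0 <= 2 * C / 2 ^ (n + k)) by (apply Rle_mult_inv_pos; [lra|apply Hp]). lra.
Qed.

(** * Primitives, and Picard iteration in an exponentially weighted norm *)

Definition prim (a : R) (g : R -> R) (x : R) : R := RInt g a x.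

Lemma is_derive_prim (a : R) (g : R -> R) (x : R) :
  (forall y, continuous g y) -> is_derive (prim a g) x (g x).
Proof.
  intros Hg. apply (is_derive_RInt g (prim a g) a x); [|apply Hg].
  exists posreal_one. intros y _. apply (RInt_correct g a y).
  apply (@ex_RInt_continuous R_CompleteNormedModule). intros; apply Hg.
Qed.

Lemma prim_point (a : R) (g : R -> R) : prim a g a = 0.
Proof. unfold prim. now rewrite RInt_point. Qed.

Lemma continuous_prim (a : R) (g : R -> R) (x : R) :
  (forall y, continuous g y) -> continuous (prim a g) x.
Proof.
  intros Hg. apply (ex_derive_continuous (prim a g) x). exists (g x). now apply is_derive_prim.
Qed.

(** In the norm weighted by exp(- lam x) each primitive gains a factor 1/lam: adding or subtracting
    the difference of primitives to (C/lam) exp(lam x) leaves a nondecreasing function. *)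
Lemma prim_diff_exp (g h : R -> R) (C lam : R) :
  0 < lam -> 0 <= C -> (forall y, continuous g y) -> (forall y, continuous h y) ->
  (forall y, 0 <= y <= 1 -> Rabs (g y - h y) <= C * exp (lam * y)) ->
  forall x, 0 <= x <= 1 -> Rabs (prim 0 g x - prim 0 h x) <= C / lam * exp (lam * x).
Proof.
  intros Hl HC Hg Hh Hb x Hx.
  assert (He : forall y, is_derive (fun z => C / lam * exp (lam * z)) y (C * exp (lam * y))).
  { intros y. assert (is_derive (fun z => exp (lam * z)) y (lam * exp (lam * y))).
    { apply is_derive_Rcomp; [apply is_derive_exp|]. derive_as. ring. }
    derive_as. field. lra. }
  assert (H0 : 0 <= C / lam) by (apply Rle_mult_inv_pos; lra).
  assert (E0 : C / lam * exp (lam * 0) = C / lam) by (rewrite Rmult_0_r, exp_0; ring).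
  apply Rabs_le. split.
  - cut (C / lam * exp (lam * 0) + (prim 0 g 0 - prim 0 h 0)
         <= C / lam * exp (lam * x) + (prim 0 g x - prim 0 h x)).
    { rewrite !prim_point, E0. lra. }
    apply (le_of_derive_nonneg_closed
      (fun x => C / lam * exp (lam * x) + (prim 0 g x - prim 0 h x))
      (fun x => C * exp (lam * x) + (g x - h x))); [lra| |].
    + intros y Hy. pose proof (He y). pose proof (is_derive_prim 0 g y Hg).
      pose proof (is_derive_prim 0 h y Hh). derive_as. reflexivity.
    + intros y Hy. specialize (Hb y ltac:(lra)). apply Rcomplements.Rabs_le_between in Hb. lra.
  - cut (C / lam * exp (lam * 0) - (prim 0 g 0 - prim 0 h 0)
         <= C / lam * exp (lam * x) - (prim 0 g x - prim 0 h x)).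
    { rewrite !prim_point, E0. lra. }
    apply (le_of_derive_nonneg_closed
      (fun x => C / lam * exp (lam * x) - (prim 0 g x - prim 0 h x))
      (fun x => C * exp (lam * x) - (g x - h x))); [lra| |].
    + intros y Hy. pose proof (He y). pose proof (is_derive_prim 0 g y Hg).
      pose proof (is_derive_prim 0 h y Hh). derive_as. reflexivity.
    + intros y Hy. specialize (Hb y ltac:(lra)). apply Rcomplements.Rabs_le_between in Hb. lra.
Qed.

Section Shooting.

Variables (f : R -> R -> R) (theta M L : R).
Hypothesis f_cont : forall g : R -> R, (forall x, continuous g x) ->
  forall x, continuous (fun y => f y (g y)) x.
Hypothesis f_bound : forall y h, 0 <= y <= 1 -> Rabs (f y h) <= M.
Hypothesis f_lip : forall y h k, 0 <= y <= 1 -> Rabs (f y h - f y k) <= L * Rabs (h - k).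

(* In the norm weighted by [exp (- lam x)] the Picard map contracts by 1/2. *)
Let lam : R := 1 + 2 * L.

Lemma shooting_L_nonneg : 0 <= L.
Proof.
  pose proof (f_lip 0 1 0 ltac:(lra)) as H. rewrite Rminus_0_r, Rabs_R1 in H.
  pose proof (Rabs_pos (f 0 1 - f 0 0)). lra.
Qed.

Lemma shooting_M_nonneg : 0 <= M.
Proof.
  pose proof (f_bound 0 0 ltac:(lra)) as H. pose proof (Rabs_pos (f 0 0)). lra.
Qed.

Definition nemytskii (g : R -> R) (y : R) : R := f y (g y).

(** Integrated form of H''' = f(x, H) with H(0) = 0, H'(0) = theta and H''(0) = s; s is the shooting
    parameter. *)
Definition picard (s : R) (g : R -> R) (x : R) : R :=
  theta * x + s * x * x / 2 + prim 0 (prim 0 (prim 0 (nemytskii g))) x.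

Lemma nemytskii_cont (g : R -> R) :
  (forall x, continuous g x) -> forall x, continuous (nemytskii g) x.
Proof. intros Hg x. now apply f_cont. Qed.

Lemma prim1_cont (g : R -> R) :
  (forall x, continuous g x) -> forall x, continuous (prim 0 (nemytskii g)) x.
Proof. intros Hg x. now apply continuous_prim, nemytskii_cont. Qed.

Lemma prim2_cont (g : R -> R) :
  (forall x, continuous g x) -> forall x, continuous (prim 0 (prim 0 (nemytskii g))) x.
Proof. intros Hg x. now apply continuous_prim, prim1_cont. Qed.

Lemma picard_der (s : R) (g : R -> R) (x : R) :
  (forall x, continuous g x) ->
  is_derive (picard s g) x (theta + s * x + prim 0 (prim 0 (nemytskii g)) x) /\
  is_derive (fun x => theta + s * x + prim 0 (prim 0 (nemytskii g)) x) x
    (s + prim 0 (nemytskii g) x) /\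
  is_derive (fun x => s + prim 0 (nemytskii g) x) x (f x (g x)).
Proof.
  intros Hg.
  pose proof (is_derive_prim 0 _ x (prim2_cont g Hg)).
  pose proof (is_derive_prim 0 _ x (prim1_cont g Hg)).
  pose proof (is_derive_prim 0 _ x (nemytskii_cont g Hg)).
  split; [|split].
  - unfold picard, Rdiv. derive_as. field.
  - derive_as. ring.
  - derive_as. unfold nemytskii. ring.
Qed.

Lemma picard_cont (s : R) (g : R -> R) :
  (forall x, continuous g x) -> forall x, continuous (picard s g) x.
Proof.
  intros Hg x. apply (ex_derive_continuous (picard s g) x).
  eexists. exact (proj1 (picard_der s g x Hg)).
Qed.

Lemma nemytskii_diff (g h : R -> R) (C : R) :
  0 <= C ->
  (forall y, 0 <= y <= 1 -> Rabs (g y - h y) <= C * exp (lam * y)) ->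
  forall y, 0 <= y <= 1 -> Rabs (nemytskii g y - nemytskii h y) <= L * C * exp (lam * y).
Proof.
  intros HC H y Hy. unfold nemytskii. pose proof shooting_L_nonneg.
  eapply Rle_trans; [now apply f_lip|]. rewrite Rmult_assoc.
  apply Rmult_le_compat_l; [assumption|now apply H].
Qed.

(** The superposition costs L and the three primitives gain lam^(-3); since lam = 1 + 2 L, already
    L/lam is at most 1/2. *)
Lemma prim3_diff (g h : R -> R) (C : R) :
  0 <= C -> (forall x, continuous g x) -> (forall x, continuous h x) ->
  (forall y, 0 <= y <= 1 -> Rabs (g y - h y) <= C * exp (lam * y)) ->
  forall x, 0 <= x <= 1 ->
    Rabs (prim 0 (prim 0 (prim 0 (nemytskii g))) x - prim 0 (prim 0 (prim 0 (nemytskii h))) x)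
    <= C / 2 * exp (lam * x).
Proof.
  intros HC Hg Hh H x Hx. pose proof shooting_L_nonneg as HL.
  assert (Hlam : 1 <= lam) by (unfold lam; lra).
  assert (H0 : 0 <= L * C) by (apply Rmult_le_pos; lra).
  assert (H1 : 0 <= L * C / lam) by (apply Rle_mult_inv_pos; lra).
  assert (H2 : 0 <= L * C / lam / lam) by (apply Rle_mult_inv_pos; lra).
  assert (Hd : Rabs (prim 0 (prim 0 (prim 0 (nemytskii g))) x
                     - prim 0 (prim 0 (prim 0 (nemytskii h))) x)
               <= L * C / lam / lam / lam * exp (lam * x)).
  { apply prim_diff_exp; auto using prim2_cont; [lra|].
    apply prim_diff_exp; auto using prim1_cont; [lra|].
    apply prim_diff_exp; auto using nemytskii_cont; [lra|].
    now apply nemytskii_diff. }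
  eapply Rle_trans; [exact Hd|]. apply Rmult_le_compat_r; [apply Rlt_le, exp_pos|].
  assert (Hi : forall z, 0 <= z -> z / lam <= z).
  { intros z Hz. apply (Rmult_le_reg_r lam); [lra|]. unfold Rdiv.
    rewrite Rmult_assoc, Rinv_l by lra. nra. }
  eapply Rle_trans; [apply Hi; assumption|]. eapply Rle_trans; [apply Hi; assumption|].
  apply (Rmult_le_reg_r lam); [lra|]. unfold Rdiv at 1.
  rewrite Rmult_assoc, Rinv_l by lra. unfold lam. nra.
Qed.

Fixpoint iterate (s : R) (n : nat) : R -> R :=
  match n with
  | O => fun x => theta * x + s * x * x / 2
  | S n => picard s (iterate s n)
  end.

Lemma iterate_cont (s : R) (n : nat) (x : R) : continuous (iterate s n) x.
Proof.
  revert x. induction n as [|n IH]; [|now apply picard_cont].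
  intros x. apply (ex_derive_continuous (iterate s 0) x). exists (theta + s * x).
  simpl. unfold Rdiv. derive_as. field.
Qed.

Lemma exp_lam_ge1 (x : R) : 0 <= x -> 1 <= exp (lam * x).
Proof.
  intros Hx. rewrite <- exp_0 at 1. apply exp_le_mono. pose proof shooting_L_nonneg.
  unfold lam. nra.
Qed.

Lemma prim_bound (g : R -> R) (C : R) :
  0 <= C -> (forall y, continuous g y) ->
  (forall y, 0 <= y <= 1 -> Rabs (g y) <= C * exp y) ->
  forall x, 0 <= x <= 1 -> Rabs (prim 0 g x) <= C * exp x.
Proof.
  intros HC Hg Hb x Hx.
  assert (Ez : forall x, prim 0 (fun _ => 0) x = 0).
  { intros z. unfold prim. rewrite RInt_const. apply Rmult_0_r. }
  pose proof (prim_diff_exp g (fun _ => 0) C 1 ltac:(lra) HC Hg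
    (fun y => continuous_const 0 y)) as H.
  specialize (H ltac:(intros y Hy; rewrite Rminus_0_r, Rmult_1_l; now apply Hb) x Hx).
  rewrite Ez, Rminus_0_r, Rmult_1_l in H. now replace (C / 1) with C in H by field.
Qed.

Lemma prim2_bound (g : R -> R) (x : R) :
  (forall x, continuous g x) -> 0 <= x <= 1 ->
  Rabs (prim 0 (prim 0 (nemytskii g)) x) <= M * exp x.
Proof.
  intros Hg. revert x. pose proof shooting_M_nonneg.
  apply prim_bound; auto using prim1_cont.
  apply prim_bound; auto using nemytskii_cont.
  intros y Hy. pose proof (f_bound y (g y) Hy). unfold nemytskii.
  pose proof (exp_ineq1_le y). nra.
Qed.

Lemma iterate_step (s : R) (n : nat) (x : R) : 0 <= x <= 1 ->
  Rabs (iterate s (S n) x - iterate s n x) <= M * exp 1 / 2 ^ n * exp (lam * x).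
Proof.
  pose proof shooting_M_nonneg as HM. pose proof (exp_pos 1) as He1.
  revert x. induction n as [|n IH]; intros x Hx.
  - change (iterate s 1 x - iterate s 0 x)
      with (iterate s 0 x + prim 0 (prim 0 (prim 0 (nemytskii (iterate s 0)))) x - iterate s 0 x).
    replace (iterate s 0 x + prim 0 (prim 0 (prim 0 (nemytskii (iterate s 0)))) x - iterate s 0 x)
      with (prim 0 (prim 0 (prim 0 (nemytskii (iterate s 0)))) x) by ring.
    eapply Rle_trans.
    + apply prim_bound; [exact HM| | |exact Hx].
      * apply prim2_cont. apply iterate_cont.
      * intros y Hy. apply prim2_bound; [apply iterate_cont|exact Hy].
    + simpl. pose proof (exp_lam_ge1 x ltac:(lra)).
      assert (exp x <= exp 1) by (apply exp_le_mono; lra).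
      unfold Rdiv. rewrite Rinv_1, Rmult_1_r, Rmult_assoc.
      apply Rmult_le_compat_l; [exact HM|]. nra.
  - change (iterate s (S (S n)) x) with (picard s (iterate s (S n)) x).
    change (iterate s (S n) x) with (picard s (iterate s n) x) at 1.
    unfold picard at 1 2.
    match goal with |- Rabs (?a + ?b - (?a + ?c)) <= _ =>
      replace (a + b - (a + c)) with (b - c) by ring end.
    eapply Rle_trans.
    + apply prim3_diff; [|apply iterate_cont|apply iterate_cont|exact IH|exact Hx].
      apply Rle_mult_inv_pos; [nra|apply pow_lt; lra].
    + apply Req_le. simpl. field. apply pow_nonzero. lra.
Qed.

(** The iterates are controlled on [0,1] only; composing with [clamp01] makes the convergence
    uniform on the line, so the limit is continuous everywhere and may be fed to [picard] again. *)
Definition shot (s x : R) : R := real (Lim_seq (fun n => iterate s n (clamp01 x))).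

Let B : R := M * exp 1 * exp lam.

Lemma exp_lam_le (x : R) : x <= 1 -> exp (lam * x) <= exp lam.
Proof.
  intros Hx. apply exp_le_mono. pose proof shooting_L_nonneg. unfold lam. nra.
Qed.

Lemma shot_error (s x : R) (n : nat) :
  Rabs (iterate s n (clamp01 x) - shot s x) <= 2 * B / 2 ^ n.
Proof.
  unfold shot. apply (geometric_limit (fun n => iterate s n (clamp01 x)) B).
  clear n. intros n. eapply Rle_trans; [apply iterate_step, clamp01_range|].
  pose proof (exp_lam_le (clamp01 x) (proj2 (clamp01_range x))).
  replace (B / 2 ^ n) with (M * exp 1 / 2 ^ n * exp lam) by (unfold B, Rdiv; ring).
  apply Rmult_le_compat_l; [|assumption].
  apply Rle_mult_inv_pos; [|apply pow_lt; lra].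
  pose proof shooting_M_nonneg. pose proof (exp_pos 1). nra.
Qed.

Lemma pow_half_small (C e : R) : 0 < e -> exists n, C / 2 ^ n < e.
Proof.
  intros He.
  assert (Hl : is_lim_seq (fun n => C * (/ 2) ^ n) 0).
  { replace (Finite 0) with (Rbar_mult (Finite C) (Finite 0)) by (simpl; f_equal; ring).
    apply is_lim_seq_scal_l, is_lim_seq_geom. rewrite Rabs_right; lra. }
  apply is_lim_seq_spec in Hl. destruct (Hl (mkposreal e He)) as (N & HN).
  exists N. specialize (HN N (Nat.le_refl _)). simpl in HN. rewrite Rminus_0_r, pow_inv in HN.
  pose proof (Rle_abs (C * / 2 ^ N)). unfold Rdiv. lra.
Qed.

Lemma shot_cont (s x : R) : continuous (shot s) x.
Proof.
  revert x. apply continuous_uniform_limit. intros e He.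
  destruct (pow_half_small (2 * B) e He) as (n & Hn).
  exists (fun x => iterate s n (clamp01 x)). split.
  - intros x. apply (continuous_comp clamp01 (iterate s n)).
    + apply continuous_clamp01.
    + apply iterate_cont.
  - intros x. rewrite Rabs_minus_sym. pose proof (shot_error s x n). lra.
Qed.

Lemma shot_error_const_nonneg : 0 <= B.
Proof.
  pose proof shooting_M_nonneg. unfold B. pose proof (exp_pos 1). pose proof (exp_pos lam).
  apply Rmult_le_pos; nra.
Qed.

Lemma shot_fixed (s x : R) : 0 <= x <= 1 -> picard s (shot s) x = shot s x.
Proof.
  intros Hx. pose proof shot_error_const_nonneg as HB.
  apply Rminus_diag_uniq. apply Rabs_eq_0. apply Rle_antisym; [|apply Rabs_pos].
  apply Rle_plus_epsilon. intros e He.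
  (* The two errors below add up to (B exp(lam) + B)/2^n, which this constant covers with room to
     spare. *)
  destruct (pow_half_small (4 * B * exp lam + 2 * B) e He) as (n & Hn).
  assert (Hpn : 0 < 2 ^ n) by (apply pow_lt; lra).
  assert (H1 : Rabs (iterate s (S n) x - picard s (shot s) x) <= 2 * B / 2 ^ n / 2 * exp (lam * x)).
  { change (iterate s (S n) x) with (picard s (iterate s n) x). unfold picard.
    match goal with |- Rabs (?a + ?b - (?a + ?c)) <= _ =>
      replace (a + b - (a + c)) with (b - c) by ring end.
    apply prim3_diff; [|apply iterate_cont|apply shot_cont| |exact Hx].
    - apply Rle_mult_inv_pos; [lra|exact Hpn].
    - intros y Hy. pose proof (shot_error s y n) as Hs. rewrite clamp01_id in Hs by exact Hy.
      pose proof (exp_lam_ge1 y ltac:(lra)).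
      assert (0 <= 2 * B / 2 ^ n) by (apply Rle_mult_inv_pos; lra). nra. }
  pose proof (shot_error s x (S n)) as H2. rewrite clamp01_id in H2 by exact Hx.
  pose proof (exp_lam_le x ltac:(lra)) as H3.
  assert (H4 : 0 <= B / 2 ^ n) by (apply Rle_mult_inv_pos; lra).
  replace (2 * B / 2 ^ n / 2 * exp (lam * x)) with (B / 2 ^ n * exp (lam * x)) in H1
    by (field; lra).
  replace (2 * B / 2 ^ S n) with (B / 2 ^ n) in H2 by (simpl; field; lra).
  replace ((4 * B * exp lam + 2 * B) / 2 ^ n)
    with (4 * (B / 2 ^ n * exp lam) + 2 * (B / 2 ^ n)) in Hn by (field; lra).
  assert (B / 2 ^ n * exp (lam * x) <= B / 2 ^ n * exp lam) by (apply Rmult_le_compat_l; lra).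
  assert (0 <= B / 2 ^ n * exp lam) by (apply Rmult_le_pos; [lra|apply Rlt_le, exp_pos]).
  apply Rcomplements.Rabs_le_between in H1. apply Rcomplements.Rabs_le_between in H2.
  apply Rabs_le. lra.
Qed.

(** The constant is uniform in n: the explicit term contributes |s - t| x^2/2 and the contraction
    half of the induction hypothesis, and x^2/2 <= exp(lam x)/2. *)
Lemma iterate_lip (s t : R) (n : nat) (x : R) : 0 <= x <= 1 ->
  Rabs (iterate s n x - iterate t n x) <= Rabs (s - t) * exp (lam * x).
Proof.
  revert x. induction n as [|n IH]; intros x Hx.
  - simpl. replace (theta * x + s * x * x / 2 - (theta * x + t * x * x / 2))
      with ((s - t) * (x * x / 2)) by field.
    rewrite Rabs_mult. apply Rmult_le_compat_l; [apply Rabs_pos|].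
    pose proof (exp_lam_ge1 x ltac:(lra)). rewrite Rabs_right by nra. nra.
  - change (iterate s (S n) x) with (picard s (iterate s n) x).
    change (iterate t (S n) x) with (picard t (iterate t n) x). unfold picard.
    match goal with |- Rabs (?a + s * x * x / 2 + ?b - (?a + t * x * x / 2 + ?c)) <= _ =>
      replace (a + s * x * x / 2 + b - (a + t * x * x / 2 + c))
        with ((s - t) * (x * x / 2) + (b - c)) by field end.
    eapply Rle_trans; [apply Rabs_triang|].
    pose proof (prim3_diff (iterate s n) (iterate t n) (Rabs (s - t)) (Rabs_pos _)
      (iterate_cont s n) (iterate_cont t n) IH x Hx) as H3.
    rewrite Rabs_mult, (Rabs_right (x * x / 2)) by nra.
    pose proof (exp_lam_ge1 x ltac:(lra)). pose proof (Rabs_pos (s - t)).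
    assert (x * x / 2 <= 1 / 2 * exp (lam * x)) by nra.
    assert (Rabs (s - t) * (x * x / 2) <= Rabs (s - t) * (1 / 2 * exp (lam * x))).
    { now apply Rmult_le_compat_l. }
    lra.
Qed.

Lemma shot_lip (s t x : R) : 0 <= x <= 1 ->
  Rabs (shot s x - shot t x) <= Rabs (s - t) * exp (lam * x).
Proof.
  intros Hx. pose proof shot_error_const_nonneg as HB. apply Rle_plus_epsilon. intros e He.
  destruct (pow_half_small (4 * B) e He) as (n & Hn).
  replace (4 * B / 2 ^ n) with (2 * (2 * B / 2 ^ n)) in Hn by (unfold Rdiv; ring).
  pose proof (shot_error s x n) as H1. pose proof (shot_error t x n) as H2.
  rewrite clamp01_id in H1, H2 by exact Hx.
  pose proof (iterate_lip s t n x Hx) as H3.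
  apply Rcomplements.Rabs_le_between in H1. apply Rcomplements.Rabs_le_between in H2.
  apply Rcomplements.Rabs_le_between in H3. apply Rabs_le. lra.
Qed.

Lemma shooting :
  exists H H1 H2 : R -> R,
    (forall x, is_derive H x (H1 x)) /\ (forall x, is_derive H1 x (H2 x)) /\
    (forall x, 0 <= x <= 1 -> is_derive H2 x (f x (H x))) /\
    H 0 = 0 /\ H1 0 = theta /\ H1 1 = 0.
Proof.
  pose proof shooting_L_nonneg as HL. pose proof shooting_M_nonneg as HM.
  assert (Hlam : 1 <= lam) by (unfold lam; lra).
  (* Psi s is the slope at 1 of the solution with H''(0) = s; the condition at 1 asks for a zero. *)
  set (Psi := fun s => theta + s * 1 + prim 0 (prim 0 (nemytskii (shot s))) 1).
  assert (HPsi : continuity Psi).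
  { intros s. apply continuity_pt_filterlim.
    apply (continuous_plus (fun s => theta + s * 1)
             (fun s => prim 0 (prim 0 (nemytskii (shot s))) 1)).
    - apply (ex_derive_continuous (fun s => theta + s * 1)). exists 1. derive_as. ring.
    - apply continuity_pt_filterlim. intros e He.
      assert (HK : 0 < L * exp lam + 1) by (pose proof (exp_pos lam); nra).
      exists (e / (L * exp lam + 1)). split; [now apply Rdiv_lt_0_compat|].
      intros t [_ Ht]. simpl in *. unfold Rdist in *.
      apply (Rmult_lt_compat_r (L * exp lam + 1)) in Ht; [|exact HK].
      unfold Rdiv in Ht. rewrite Rmult_assoc, Rinv_l, Rmult_1_r in Ht by lra.
      pose proof (Rabs_pos (t - s)) as Hp.
      assert (H0 : 0 <= L * Rabs (t - s)) by (apply Rmult_le_pos; lra).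
      assert (Hb : Rabs (prim 0 (prim 0 (nemytskii (shot t))) 1
                         - prim 0 (prim 0 (nemytskii (shot s))) 1)
                   <= L * Rabs (t - s) / lam / lam * exp (lam * 1)).
      { apply prim_diff_exp; [lra|apply Rle_mult_inv_pos; lra|apply prim1_cont, shot_cont
          |apply prim1_cont, shot_cont| |lra].
        apply prim_diff_exp; [lra|exact H0|apply nemytskii_cont, shot_cont
          |apply nemytskii_cont, shot_cont|].
        apply nemytskii_diff; [exact Hp|]. intros y Hy. now apply shot_lip. }
      eapply Rle_lt_trans; [exact Hb|]. rewrite Rmult_1_r.
      assert (Hi : forall z, 0 <= z -> z / lam <= z).
      { intros z Hz. apply (Rmult_le_reg_r lam); [lra|]. unfold Rdiv.
        rewrite Rmult_assoc, Rinv_l by lra. nra. }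
      assert (L * Rabs (t - s) / lam / lam <= L * Rabs (t - s)).
      { eapply Rle_trans; [apply Hi, Rle_mult_inv_pos; lra|]. now apply Hi. }
      pose proof (exp_pos lam).
      assert (L * Rabs (t - s) / lam / lam * exp lam <= L * Rabs (t - s) * exp lam).
      { apply Rmult_le_compat_r; lra. }
      nra. }
  assert (Hbnd : forall s, Rabs (prim 0 (prim 0 (nemytskii (shot s))) 1) <= 3 * M).
  { intros s. eapply Rle_trans; [apply prim2_bound; [apply shot_cont|lra]|].
    pose proof exp_le_3. nra. }
  (* Psi s differs from theta + s by at most 3 M, the 3 bounding exp 1, so Psi changes sign between
     these two values. *)
  destruct (IVT_gen Psi (- theta - 3 * M) (- theta + 3 * M) 0 HPsi) as (s & _ & Es).
  { pose proof (Hbnd (- theta - 3 * M)) as Ha. pose proof (Hbnd (- theta + 3 * M)) as Hb.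
    apply Rcomplements.Rabs_le_between in Ha. apply Rcomplements.Rabs_le_between in Hb.
    rewrite Rmin_left, Rmax_right; unfold Psi; lra. }
  exists (picard s (shot s)).
  exists (fun x => theta + s * x + prim 0 (prim 0 (nemytskii (shot s))) x).
  exists (fun x => s + prim 0 (nemytskii (shot s)) x).
  split; [|split; [|split; [|split; [|split]]]].
  - intros x. exact (proj1 (picard_der s (shot s) x (shot_cont s))).
  - intros x. exact (proj1 (proj2 (picard_der s (shot s) x (shot_cont s)))).
  - intros x Hx. rewrite shot_fixed by exact Hx.
    exact (proj2 (proj2 (picard_der s (shot s) x (shot_cont s)))).
  - unfold picard. rewrite prim_point. field.
  - rewrite prim_point. ring.
  - exact Es.
Qed.

End Shooting.

(** * The regularised film equation *)

Lemma abs_le_of_derive_right (h dh : R -> R) (eta x : R) :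
  0 <= x <= 1 ->
  (forall y, x <= y <= 1 -> is_derive h y (dh y)) ->
  (forall y, x <= y <= 1 -> Rabs (dh y) <= eta) ->
  h 1 = 0 -> Rabs (h x) <= eta.
Proof.
  intros Hx Hd Hb H1.
  assert (He : 0 <= eta).
  { specialize (Hb x ltac:(lra)). pose proof (Rabs_pos (dh x)). lra. }
  assert (Hu : h x + eta * x <= h 1 + eta * 1).
  { apply (le_of_derive_nonneg_closed (fun y => h y + eta * y) (fun y => dh y + eta)); [lra| |].
    - intros y Hy. pose proof (Hd y Hy). derive_as. ring.
    - intros y Hy. specialize (Hb y ltac:(lra)). apply Rcomplements.Rabs_le_between in Hb. lra. }
  assert (Hv : eta * x - h x <= eta * 1 - h 1).
  { apply (le_of_derive_nonneg_closed (fun y => eta * y - h y) (fun y => eta - dh y)); [lra| |].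
    - intros y Hy. pose proof (Hd y Hy). derive_as. ring.
    - intros y Hy. specialize (Hb y ltac:(lra)). apply Rcomplements.Rabs_le_between in Hb. lra. }
  apply Rabs_le. nra.
Qed.

(** Taylor's formula at 1 by three integrations from 1, each over a length at most 1 and so
    preserving eta; the linear term is absent because [g1] vanishes at 1. *)
Lemma quadratic_of_small_third_derivative (g g1 g2 g3 : R -> R) (eta a : R) :
  0 <= a ->
  (forall y, a <= y <= 1 -> is_derive g y (g1 y)) ->
  (forall y, a <= y <= 1 -> is_derive g1 y (g2 y)) ->
  (forall y, a <= y <= 1 -> is_derive g2 y (g3 y)) ->
  (forall y, a <= y <= 1 -> Rabs (g3 y) <= eta) ->
  g1 1 = 0 ->
  forall x, a <= x <= 1 -> Rabs (g x - g 1 - g2 1 * ((x - 1) * (x - 1) / 2)) <= eta.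
Proof.
  intros Ha H0 H1 H2 H3 E1.
  assert (B2 : forall x, a <= x <= 1 -> Rabs (g2 x - g2 1) <= eta).
  { intros x Hx. apply (abs_le_of_derive_right (fun x => g2 x - g2 1) g3); [lra| | |ring].
    - intros y Hy. pose proof (H2 y ltac:(lra)). derive_as. ring.
    - intros y Hy. apply H3. lra. }
  assert (B1 : forall x, a <= x <= 1 -> Rabs (g1 x - g2 1 * (x - 1)) <= eta).
  { intros x Hx. apply (abs_le_of_derive_right (fun x => g1 x - g2 1 * (x - 1))
                          (fun x => g2 x - g2 1)); [lra| | |rewrite E1; ring].
    - intros y Hy. pose proof (H1 y ltac:(lra)). derive_as. ring.
    - intros y Hy. apply B2. lra. }
  intros x Hx.
  apply (abs_le_of_derive_right (fun x => g x - g 1 - g2 1 * ((x - 1) * (x - 1) / 2))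
           (fun x => g1 x - g2 1 * (x - 1))); [lra| | |field].
  - intros y Hy. pose proof (H0 y ltac:(lra)). unfold Rdiv. derive_as. field.
  - intros y Hy. apply B1. lra.
Qed.

Section Existence.

Variables (beta p theta : R).
Hypothesis beta_pos : 0 < beta.
Hypothesis beta_le : beta <= 1.
Hypothesis p_def : p = 2 - beta.
Hypothesis theta_pos : 0 < theta.

(* Since regularised solutions satisfy [H x >= theta x / 2], the cutoff is inactive for
   [x >= e]. *)
Definition film_rhs (e y h : R) : R :=
  - (1 - y) * Rpower (Rmax h (theta / 2 * Rmax y e)) (- p).

Lemma film_rhs_arg_pos (e y h : R) : 0 < e -> 0 < theta / 2 * e <= Rmax h (theta / 2 * Rmax y e).
Proof.
  intros He. pose proof (Rmax_r h (theta / 2 * Rmax y e)). pose proof (Rmax_r y e).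
  split; nra.
Qed.

Lemma film_rhs_cont (e : R) (g : R -> R) : 0 < e ->
  (forall x, continuous g x) -> forall x, continuous (fun y => film_rhs e y (g y)) x.
Proof.
  intros He Hg x. unfold film_rhs.
  apply (continuous_mult (fun y => - (1 - y))
           (fun y => Rpower (Rmax (g y) (theta / 2 * Rmax y e)) (- p))).
  - apply (ex_derive_continuous (fun y => - (1 - y))). exists 1. derive_as. ring.
  - apply (continuous_comp (fun y => Rmax (g y) (theta / 2 * Rmax y e))
             (fun h => Rpower h (- p))).
    + apply continuous_Rmax; [apply Hg|].
      apply (continuous_mult (fun _ => theta / 2) (fun y => Rmax y e)).
      * apply continuous_const.
      * apply (continuous_Rmax (fun y => y) (fun _ => e));
          [apply continuous_id|apply continuous_const].
    + apply (ex_derive_continuous (fun h => Rpower h (- p))). eexists.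
      apply is_derive_Rpower. pose proof (film_rhs_arg_pos e x (g x) He). lra.
Qed.

Lemma film_rhs_bound_gen (e mu y h : R) : 0 < mu -> mu <= theta / 2 * Rmax y e -> 0 <= y <= 1 ->
  - Rpower mu (- p) <= film_rhs e y h <= 0.
Proof.
  intros Hmu Hle Hy. unfold film_rhs.
  pose proof (Rmax_r h (theta / 2 * Rmax y e)).
  pose proof (Rpower_opp_antitone p mu (Rmax h (theta / 2 * Rmax y e)) ltac:(lra) Hmu ltac:(lra)).
  pose proof (Rpower_pos (Rmax h (theta / 2 * Rmax y e)) (- p)). nra.
Qed.

Lemma film_rhs_bound (e y h : R) : 0 < e -> 0 <= y <= 1 ->
  Rabs (film_rhs e y h) <= Rpower (theta / 2 * e) (- p).
Proof.
  intros He Hy. pose proof (Rmax_r y e).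
  pose proof (film_rhs_bound_gen e (theta / 2 * e) y h ltac:(nra) ltac:(nra) Hy).
  apply Rabs_le. pose proof (Rpower_pos (theta / 2 * e) (- p)). lra.
Qed.

(** Unlike [film_rhs_bound], which serves the shooting, this bound is uniform in e and gives the
    estimates that survive the limit. *)
Lemma film_rhs_bound_y (e y h : R) : 0 < y <= 1 ->
  - (Rpower (theta / 2) (- p) * Rpower y (beta - 2)) <= film_rhs e y h <= 0.
Proof.
  intros Hy. pose proof (Rmax_l y e).
  replace (Rpower (theta / 2) (- p) * Rpower y (beta - 2)) with (Rpower (theta / 2 * y) (- p)).
  - apply film_rhs_bound_gen; [nra|nra|lra].
  - rewrite <- Rpower_mult_distr by lra. f_equal. f_equal. lra.
Qed.

Lemma Rmax_dist (a b c : R) : Rabs (Rmax a c - Rmax b c) <= Rabs (a - b).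
Proof.
  unfold Rmax, Rabs. repeat destruct Rle_dec; repeat destruct Rcase_abs; lra.
Qed.

Lemma film_rhs_lip (e y h k : R) : 0 < e -> 0 <= y <= 1 ->
  Rabs (film_rhs e y h - film_rhs e y k)
  <= p * Rpower (theta / 2 * e) (- p - 1) * Rabs (h - k).
Proof.
  intros He Hy. unfold film_rhs.
  pose proof (film_rhs_arg_pos e y h He) as Hh. pose proof (film_rhs_arg_pos e y k He) as Hk.
  set (u := theta / 2 * Rmax y e) in *.
  rewrite <- Rmult_minus_distr_l, Rabs_mult, Rabs_Ropp, (Rabs_right (1 - y)) by lra.
  pose proof (Rpower_opp_lipschitz p (theta / 2 * e) (Rmax h u) (Rmax k u)
                ltac:(lra) ltac:(lra) ltac:(lra) ltac:(lra)) as HL.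
  pose proof (Rmax_dist h k u). pose proof (Rpower_pos (theta / 2 * e) (- p - 1)) as Hpp.
  assert (0 <= p * Rpower (theta / 2 * e) (- p - 1)) by nra.
  pose proof (Rabs_pos (Rpower (Rmax h u) (- p) - Rpower (Rmax k u) (- p))).
  assert (p * Rpower (theta / 2 * e) (- p - 1) * Rabs (Rmax h u - Rmax k u)
          <= p * Rpower (theta / 2 * e) (- p - 1) * Rabs (h - k)).
  { now apply Rmult_le_compat_l. }
  nra.
Qed.

(** The cutoff preserves the monotonicity in h on which the energy argument rests. *)
Lemma film_rhs_mono (e y h k : R) : 0 < e -> 0 <= y <= 1 ->
  0 <= (h - k) * (film_rhs e y h - film_rhs e y k).
Proof.
  intros He Hy. unfold film_rhs.
  pose proof (film_rhs_arg_pos e y h He) as Hh. pose proof (film_rhs_arg_pos e y k He) as Hk.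
  set (u := theta / 2 * Rmax y e) in *.
  assert (key : forall h k, 0 < theta / 2 * e <= Rmax h u -> 0 < theta / 2 * e <= Rmax k u ->
     h <= k -> 0 <= (1 - y) * (Rpower (Rmax h u) (- p) - Rpower (Rmax k u) (- p))).
  { clear h k Hh Hk. intros h k Hh Hk Hhk. apply Rmult_le_pos; [lra|].
    pose proof (Rpower_opp_antitone p (Rmax h u) (Rmax k u) ltac:(lra) ltac:(lra)
      ltac:(apply Rle_max_compat_r; lra)). lra. }
  destruct (Rle_dec h k) as [Hle|Hn].
  - pose proof (key h k Hh Hk Hle). nra.
  - pose proof (key k h Hk Hh ltac:(lra)). nra.
Qed.

(** * Bounds for the regularised solutions, uniform in the cutoff *)

Definition regularised (e : R) (H H1 H2 : R -> R) : Prop :=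
  (forall x, is_derive H x (H1 x)) /\ (forall x, is_derive H1 x (H2 x)) /\
  (forall x, 0 <= x <= 1 -> is_derive H2 x (film_rhs e x (H x))) /\
  H 0 = 0 /\ H1 0 = theta /\ H1 1 = 0.

(** The solution and its derivatives are packed into a triple so that one use of the axiom of choice
    selects a whole sequence. *)
Lemma regularised_exists (e : R) : 0 < e ->
  exists H : (R -> R) * (R -> R) * (R -> R), regularised e (fst (fst H)) (snd (fst H)) (snd H).
Proof.
  intros He.
  destruct (shooting (film_rhs e) theta (Rpower (theta / 2 * e) (- p))
             (p * Rpower (theta / 2 * e) (- p - 1))) as (H & H1 & H2 & Hs).
  - intros g Hg. now apply film_rhs_cont.
  - intros y h Hy. now apply film_rhs_bound.
  - intros y h k Hy. now apply film_rhs_lip.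
  - now exists (H, H1, H2).
Qed.

(** Makes the second derivative of kappa x^(beta/2) equal to -(theta/2)^(-p) x^(beta/2-2). The
    exponent beta would fail for beta = 1, where integrating x^(beta-2) twice gives a logarithm;
    half the exponent absorbs it. *)
Definition kappa : R := Rpower (theta / 2) (- p) / (beta / 2 * (1 - beta / 2)).

Lemma kappa_pos : 0 < kappa.
Proof.
  unfold kappa. apply Rdiv_lt_0_compat; [apply Rpower_pos|nra].
Qed.

Section Regularised.

Variables (e : R) (H H1 H2 : R -> R).
Hypothesis e_pos : 0 < e.
Hypothesis H_reg : regularised e H H1 H2.

Lemma reg_H2_mono (x y : R) : 0 <= x -> x <= y -> y <= 1 -> H2 y <= H2 x.
Proof.
  destruct H_reg as (_ & _ & Hd & _). intros Hx Hxy Hy. cut (- H2 x <= - H2 y); [lra|].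
  apply (le_of_derive_nonneg_closed (fun z => - H2 z) (fun z => - film_rhs e z (H z)));
    [exact Hxy| |].
  - intros z Hz. pose proof (Hd z ltac:(lra)). derive_as. ring.
  - intros z Hz. pose proof (film_rhs_bound_y e z (H z) ltac:(lra)). lra.
Qed.

(** H' is concave, so it lies above its chord from (0, theta) to (1, 0). *)
Lemma reg_H1_lower (x : R) : 0 <= x <= 1 -> theta * (1 - x) <= H1 x.
Proof.
  intros Hx. destruct H_reg as (_ & Hd & _ & _ & E0 & E1).
  pose proof (concave_chord H1 H2 0 1 ltac:(lra)) as Hc.
  assert ((1 - x) * H1 0 + (x - 0) * H1 1 <= (1 - 0) * H1 x); [|rewrite E0, E1 in *; lra].
  apply Hc; [| | |exact Hx].
  - intros; eapply is_derive_continuity_pt, Hd.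
  - intros; apply Hd.
  - intros; apply reg_H2_mono; lra.
Qed.

(** A bound on increments rather than on H', because it passes to a pointwise limit of the
    solutions. *)
Lemma reg_increment_lower (x y : R) :
  0 <= x -> x <= y -> y <= 1 -> theta * (1 - y) * (y - x) <= H y - H x.
Proof.
  intros Hx Hxy Hy. destruct H_reg as (Hd & _).
  cut (H x - theta * (1 - y) * x <= H y - theta * (1 - y) * y); [lra|].
  apply (le_of_derive_nonneg_closed (fun z => H z - theta * (1 - y) * z)
           (fun z => H1 z - theta * (1 - y))); [exact Hxy| |].
  - intros z Hz. pose proof (Hd z). derive_as. ring.
  - intros z Hz. pose proof (reg_H1_lower z ltac:(lra)). nra.
Qed.

(** Integrating theta (1 - x) gives theta (x - x^2/2), at least theta x / 2 on [0,1]. *)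
Lemma reg_H_lower (x : R) : 0 <= x <= 1 -> theta / 2 * x <= H x.
Proof.
  intros Hx. destruct H_reg as (Hd & _ & _ & E0 & _).
  cut (H 0 - theta * (0 - 0 * 0 / 2) <= H x - theta * (x - x * x / 2)); [|].
  { rewrite E0. intros Hc. assert (0 <= theta * (x - x * x)) by (apply Rmult_le_pos; nra). lra. }
  apply (le_of_derive_nonneg_closed (fun z => H z - theta * (z - z * z / 2))
           (fun z => H1 z - theta * (1 - z))); [lra| |].
  - intros z Hz. pose proof (Hd z). unfold Rdiv. derive_as. field.
  - intros z Hz. pose proof (reg_H1_lower z ltac:(lra)). lra.
Qed.

(* [kappa * x^(beta/2) - H1 x] is concave: its second derivative is at most
   [x^(beta/2-2)] times [- kappa (beta/2) (1 - beta/2) + (theta/2)^(-p)] = 0. *)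
Lemma reg_H1_upper (x : R) : 0 < x <= 1 -> H1 x <= theta + kappa * Rpower x (beta / 2).
Proof.
  intros Hx. destruct H_reg as (_ & Hd1 & Hd2 & _ & E0 & E1).
  pose proof kappa_pos as Hk.
  set (g := fun z => kappa * Rpower z (beta / 2) - H1 z).
  set (dg := fun z => kappa * (beta / 2 * Rpower z (beta / 2 - 1)) - H2 z).
  assert (Hg : forall z, 0 < z -> is_derive g z (dg z)).
  { intros z Hz. pose proof (is_derive_Rpower (beta / 2) z Hz). pose proof (Hd1 z).
    unfold g, dg. derive_as. ring. }
  assert (Hm : forall y z, 0 < y -> y <= z -> z <= 1 -> dg z <= dg y).
  { intros y z Hy Hyz Hz. cut (- dg y <= - dg z); [lra|].
    apply (le_of_derive_nonneg_closed (fun t => - dg t)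
      (fun t => film_rhs e t (H t)
        + kappa * (beta / 2 * (1 - beta / 2)) * Rpower t (beta / 2 - 2))); [exact Hyz| |].
    - intros t Ht. pose proof (is_derive_Rpower (beta / 2 - 1) t ltac:(lra)) as Hr.
      replace (beta / 2 - 1 - 1) with (beta / 2 - 2) in Hr by ring.
      pose proof (Hd2 t ltac:(lra)). unfold dg. derive_as. ring.
    - intros t Ht. pose proof (film_rhs_bound_y e t (H t) ltac:(lra)) as Hb.
      assert (Ek : kappa * (beta / 2 * (1 - beta / 2)) = Rpower (theta / 2) (- p)).
      { unfold kappa. field. lra. }
      rewrite Ek.
      assert (Rpower t (beta - 2) <= Rpower t (beta / 2 - 2)).
      { replace (beta - 2) with (- (2 - beta)) by ring.
        replace (beta / 2 - 2) with (- (2 - beta / 2)) by ring. rewrite !Rpower_Ropp.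
        apply Rinv_le_contravar; [apply Rpower_pos|]. unfold Rpower. apply exp_le_mono.
        assert (ln t <= 0) by (rewrite <- ln_1; apply Rcomplements.ln_le; lra). nra. }
      pose proof (Rpower_pos (theta / 2) (- p)). nra. }
  (* [Rpower 0] takes the value 1, so g is discontinuous at 0 and its limit there is kappa 0 -
     theta. The chord is therefore taken on [a,1], and a tends to 0. *)
  assert (Hchord : (1 - x) * (kappa * 0 - theta) + (x - 0) * g 1 <= (1 - 0) * g x).
  { apply (lim0_le (fun a => (1 - x) * g a + (x - a) * g 1) (fun a => (1 - a) * g x) _ _ x);
      [lra| | |].
    - intros a Ha. apply (concave_chord g dg a 1); [lra| | | |lra].
      + intros z Hz. eapply is_derive_continuity_pt, Hg. lra.
      + intros z Hz. apply Hg. lra.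
      + intros y z Hy Hyz Hz. apply Hm; lra.
    - apply lim0_plus; apply lim0_mult.
      + apply lim0_const.
      + apply lim0_minus.
        * apply lim0_mult; [apply lim0_const|apply lim0_Rpower; lra].
        * rewrite <- E0. apply continuity_pt_lim0. eapply is_derive_continuity_pt, Hd1.
      + apply lim0_minus; [apply lim0_const|apply lim0_id].
      + apply lim0_const.
    - apply lim0_mult; [|apply lim0_const].
      apply lim0_minus; [apply lim0_const|apply lim0_id]. }
  unfold g in Hchord. rewrite E1 in Hchord.
  assert (E : Rpower 1 (beta / 2) = 1) by (unfold Rpower; rewrite ln_1, Rmult_0_r; apply exp_0).
  rewrite E in Hchord. assert (0 <= x * theta) by nra. assert (0 <= x * kappa) by nra. lra.
Qed.

Lemma reg_increment_upper (x y : R) :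
  0 <= x -> x <= y -> 0 < y <= 1 -> H y - H x <= (theta + kappa * Rpower y (beta / 2)) * (y - x).
Proof.
  intros Hx Hxy Hy. destruct H_reg as (Hd & _). set (C := theta + kappa * Rpower y (beta / 2)).
  cut (C * x - H x <= C * y - H y); [lra|].
  apply (le_of_derive_nonneg_closed (fun z => C * z - H z) (fun z => C - H1 z)); [exact Hxy| |].
  - intros z Hz. pose proof (Hd z). derive_as. ring.
  - intros z Hz. pose proof (reg_H1_upper z ltac:(lra)) as Hu.
    assert (Rpower z (beta / 2) <= Rpower y (beta / 2)) by (apply Rle_Rpower_l; lra).
    pose proof kappa_pos. unfold C. nra.
Qed.

Lemma reg_H_upper (x : R) : 0 <= x <= 1 -> H x <= (theta + kappa) * x.
Proof.
  intros Hx. destruct (Req_dec x 0) as [->|Hn].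
  - destruct H_reg as (_ & _ & _ & E0 & _). lra.
  - pose proof (reg_increment_upper 0 x ltac:(lra) ltac:(lra) ltac:(lra)) as Hu.
    destruct H_reg as (_ & _ & _ & E0 & _). rewrite E0 in Hu.
    assert (Rpower x (beta / 2) <= 1).
    { assert (E : Rpower 1 (beta / 2) = 1) by (unfold Rpower; rewrite ln_1, Rmult_0_r; apply exp_0).
      rewrite <- E. apply Rle_Rpower_l; lra. }
    pose proof kappa_pos.
    assert (0 <= kappa * (1 - Rpower x (beta / 2)) * x).
    { apply Rmult_le_pos; [apply Rmult_le_pos|]; lra. }
    lra.
Qed.

End Regularised.

(** * Removing the cutoff *)

Definition cauchy_const : R := 2 * ((theta + kappa) * Rpower (theta / 2) (- p) / beta).

Lemma cauchy_const_pos : 0 < cauchy_const.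
Proof.
  unfold cauchy_const. pose proof kappa_pos. pose proof (Rpower_pos (theta / 2) (- p)).
  apply Rmult_lt_0_compat; [lra|]. apply Rdiv_lt_0_compat; [nra|lra].
Qed.

(** Up to d the cutoffs differ and the energy w w'' - w'^2/2 may decrease, but |w w'''| <= A
    x^(beta-1) limits the loss to E = A d^beta / beta. Beyond d both right-hand sides are the same
    function, nondecreasing in h, and the energy increases. Hence (w w')' >= -E; as w'(1) = 0, this
    gives w w' <= E and then w^2 <= 2 E x, whence the 2 in [cauchy_const]. *)
Lemma regularised_cauchy (e d : R) (H H1 H2 K K1 K2 : R -> R) :
  0 < e -> e <= d -> d <= 1 -> regularised e H H1 H2 -> regularised d K K1 K2 ->
  forall x, 0 <= x <= 1 -> (H x - K x) * (H x - K x) <= cauchy_const * Rpower d beta.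
Proof.
  intros He Hed Hd1 HH HK.
  pose proof HH as (Hd & HdH1 & HdH2 & EH0 & EH1 & EH2).
  pose proof HK as (Kd & KdK1 & KdK2 & EK0 & EK1 & EK2).
  set (w := fun x => H x - K x). set (w1 := fun x => H1 x - K1 x).
  set (w2 := fun x => H2 x - K2 x).
  set (w3 := fun x => film_rhs e x (H x) - film_rhs d x (K x)).
  assert (Dw : forall x, is_derive w x (w1 x)).
  { intros x. pose proof (Hd x). pose proof (Kd x). unfold w, w1. derive_as. ring. }
  assert (Dw1 : forall x, is_derive w1 x (w2 x)).
  { intros x. pose proof (HdH1 x). pose proof (KdK1 x). unfold w1, w2. derive_as. ring. }
  assert (Dw2 : forall x, 0 <= x <= 1 -> is_derive w2 x (w3 x)).
  { intros x Hx. pose proof (HdH2 x Hx). pose proof (KdK2 x Hx). unfold w2, w3. derive_as. ring. }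
  set (A := (theta + kappa) * Rpower (theta / 2) (- p)).
  pose proof kappa_pos as Hk. pose proof (Rpower_pos (theta / 2) (- p)) as HR.
  assert (HA : 0 < A) by (unfold A; nra).
  set (phi := fun x => w x * w2 x - w1 x * w1 x * / 2).
  assert (Dphi : forall x, 0 <= x <= 1 -> is_derive phi x (w x * w3 x)).
  { intros x Hx. pose proof (Dw x). pose proof (Dw1 x). pose proof (Dw2 x Hx).
    unfold phi. derive_as. field. }
  assert (Hsmall : forall x, 0 < x <= d -> - (A / beta * Rpower x beta) <= phi x).
  { intros x Hx. cut (0 <= phi x + A / beta * Rpower x beta); [lra|].
    apply (lim0_le_of_derive_nonneg_at (fun x => phi x + A / beta * Rpower x beta)
             (fun x => w x * w3 x + A * Rpower x (beta - 1)) 0 x); [lra| | |].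
    - intros y Hy. pose proof (Dphi y ltac:(lra)).
      pose proof (is_derive_Rpower beta y ltac:(lra)). derive_as. field. lra.
    - intros y Hy.
      pose proof (film_rhs_bound_y e y (H y) ltac:(lra)) as B1.
      pose proof (film_rhs_bound_y d y (K y) ltac:(lra)) as B2.
      pose proof (reg_H_lower e H H1 H2 HH y ltac:(lra)).
      pose proof (reg_H_lower d K K1 K2 HK y ltac:(lra)).
      pose proof (reg_H_upper e H H1 H2 HH y ltac:(lra)).
      pose proof (reg_H_upper d K K1 K2 HK y ltac:(lra)).
      assert (E : Rpower y (beta - 1) = y * Rpower y (beta - 2)).
      { rewrite <- (Rpower_1 y) at 2 by lra. rewrite <- Rpower_plus. f_equal. ring. }
      rewrite E. unfold A.
      set (T := Rpower (theta / 2) (- p) * Rpower y (beta - 2)) in *.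
      replace ((theta + kappa) * Rpower (theta / 2) (- p) * (y * Rpower y (beta - 2)))
        with ((theta + kappa) * y * T) by (unfold T; ring).
      assert (0 < theta / 2 * y) by nra.
      assert (Hw : Rabs (w y) <= (theta + kappa) * y) by (apply Rabs_le; unfold w; lra).
      assert (Hw3 : Rabs (w3 y) <= T) by (apply Rabs_le; unfold w3; lra).
      assert (Hp : Rabs (w y * w3 y) <= (theta + kappa) * y * T).
      { rewrite Rabs_mult. apply Rmult_le_compat; auto using Rabs_pos. }
      apply Rcomplements.Rabs_le_between in Hp. lra.
    - apply (lim0_eq _ (phi 0 + A / beta * 0)).
      + apply lim0_plus.
        * apply continuity_pt_lim0. eapply is_derive_continuity_pt, Dphi. lra.
        * apply lim0_mult; [apply lim0_const|now apply lim0_Rpower].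
      + unfold phi, w, w1. rewrite EH0, EK0, EH1, EK1. ring. }
  set (E := A / beta * Rpower d beta).
  assert (HE : 0 <= E).
  { unfold E. pose proof (Rpower_pos d beta). apply Rmult_le_pos; [|lra].
    apply Rle_mult_inv_pos; lra. }
  assert (Hphi : forall x, 0 < x <= 1 -> - E <= phi x).
  { intros x Hx. destruct (Rle_dec x d) as [Hle|Hn].
    - pose proof (Hsmall x ltac:(lra)). unfold E.
      assert (Rpower x beta <= Rpower d beta) by (apply Rle_Rpower_l; lra).
      assert (0 < A / beta) by (apply Rdiv_lt_0_compat; lra). nra.
    - pose proof (Hsmall d ltac:(lra)) as Hs. fold E in Hs.
      cut (phi d <= phi x); [lra|].
      apply (le_of_derive_nonneg_closed phi (fun x => w x * w3 x)); [lra| |].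
      + intros y Hy. apply Dphi. lra.
      + intros y Hy. unfold w, w3.
        replace (film_rhs d y (K y)) with (film_rhs e y (K y)).
        * apply film_rhs_mono; lra.
        * unfold film_rhs. rewrite !(Rmax_left y) by lra. reflexivity. }
  assert (Hpsi : forall x, 0 <= x <= 1 -> w x * w1 x <= E).
  { intros x Hx.
    assert (Hle : w x * w1 x + E * x <= w 1 * w1 1 + E * 1).
    { apply (le_of_derive_nonneg_closed (fun x => w x * w1 x + E * x)
               (fun x => w1 x * w1 x + w x * w2 x + E)); [lra| |].
      - intros y Hy. pose proof (Dw y). pose proof (Dw1 y). derive_as. ring.
      - intros y Hy. pose proof (Hphi y ltac:(lra)) as Hp. unfold phi in Hp. nra. }
    replace (w1 1) with 0 in Hle by (unfold w1; lra). nra. }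
  intros x Hx.
  assert (Hle : 2 * E * 0 - w 0 * w 0 <= 2 * E * x - w x * w x).
  { apply (le_of_derive_nonneg_closed (fun x => 2 * E * x - w x * w x)
             (fun x => 2 * E - 2 * (w x * w1 x))); [lra| |].
    - intros y Hy. pose proof (Dw y). derive_as. ring.
    - intros y Hy. pose proof (Hpsi y ltac:(lra)). lra. }
  assert (Hw0 : w 0 = 0) by (unfold w; lra). rewrite Hw0 in Hle.
  assert (EC : cauchy_const * Rpower d beta = 2 * E) by (unfold cauchy_const, E, A; field; lra).
  rewrite EC. change (H x - K x) with (w x). nra.
Qed.

(** Only the solutions themselves are shown to converge; the derivatives are recovered afterwards.
    On [a,1] subtract a triple primitive based at 1 of the limiting right-hand side: the regularised
    solutions minus it have a small third derivative, so they are almost quadratic with a small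
    slope defect at 1, and in the limit the difference is exactly a constant plus a multiple of (x -
    1)^2. *)
Lemma film_limit :
  exists H : R -> R,
    (forall x, 0 <= x <= 1 -> theta / 2 * x <= H x) /\
    (forall x y, 0 <= x -> x <= y -> 0 < y <= 1 ->
       theta * (1 - y) * (y - x) <= H y - H x
       <= (theta + kappa * Rpower y (beta / 2)) * (y - x)) /\
    H 0 = 0 /\
    forall a, 0 < a < 1 -> exists Q Q1 Q2 : R -> R,
      (forall x, is_derive Q x (Q1 x)) /\ (forall x, is_derive Q1 x (Q2 x)) /\
      (forall x, a <= x <= 1 -> is_derive Q2 x (- (1 - x) * Rpower (H x) (- p))) /\
      Q1 1 = 0 /\ forall x, a <= x <= 1 -> H x = Q x.
Proof.
  set (eps := fun n : nat => / (INR n + 1)).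
  assert (Heps : forall n, 0 < eps n <= 1).
  { intros n. pose proof (pos_INR n). unfold eps. split; [apply Rinv_0_lt_compat; lra|].
    rewrite <- Rinv_1. apply Rinv_le_contravar; lra. }
  assert (Hdec : forall n k, (n <= k)%nat -> eps k <= eps n).
  { intros n k Hnk. apply le_INR in Hnk. pose proof (pos_INR n). unfold eps.
    apply Rinv_le_contravar; lra. }
  assert (Hsmall : forall d, 0 < d -> exists N, forall n, (N <= n)%nat -> eps n < d).
  { intros d Hd. destruct (archimed_cor1 d Hd) as (N & HN & HN0). exists N. intros n Hn.
    apply le_INR in Hn. eapply Rle_lt_trans; [|exact HN]. unfold eps.
    apply lt_INR in HN0. simpl in HN0. apply Rinv_le_contravar; lra. }
  destruct (functional_choice _ (fun n => regularised_exists (eps n) (proj1 (Heps n))))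
    as (S & HS).
  set (Hn := fun n => fst (fst (S n))). set (H1n := fun n => snd (fst (S n))).
  set (H2n := fun n => snd (S n)).
  assert (Hreg : forall n, regularised (eps n) (Hn n) (H1n n) (H2n n)) by exact HS.
  clearbody Hn H1n H2n. clear S HS.
  set (err := fun n => sqrt (cauchy_const * Rpower (eps n) beta)).
  assert (Herr0 : forall n, 0 <= err n) by (intros; apply sqrt_pos).
  assert (Hcauchy : forall n k x, (n <= k)%nat -> 0 <= x <= 1 -> Rabs (Hn k x - Hn n x) <= err n).
  { intros n k x Hnk Hx. unfold err. rewrite <- sqrt_Rsqr_abs. apply sqrt_le_1_alt.
    apply (regularised_cauchy (eps k) (eps n) (Hn k) (H1n k) (H2n k) (Hn n) (H1n n) (H2n n));
      auto; apply Heps. }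
  assert (Herr : forall d, 0 < d -> exists N, forall n, (N <= n)%nat -> err n < d).
  { intros d Hd. pose proof cauchy_const_pos as HC.
    destruct (lim0_eventually_lt _ _ (d * d / cauchy_const) (lim0_Rpower beta beta_pos))
      as (r & Hr & Hlt).
    { apply Rdiv_lt_0_compat; nra. }
    destruct (Hsmall r Hr) as (N & HN). exists N. intros n Hnn.
    specialize (Hlt (eps n) (conj (proj1 (Heps n)) (HN n Hnn))).
    unfold err. rewrite <- (sqrt_Rsqr d) by lra. apply sqrt_lt_1_alt.
    split; [apply Rmult_le_pos; [lra|apply Rlt_le, Rpower_pos]|].
    apply (Rmult_lt_compat_l cauchy_const) in Hlt; [|exact HC].
    unfold Rsqr. replace (cauchy_const * (d * d / cauchy_const)) with (d * d) in Hlt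
      by (field; lra). exact Hlt. }
  set (H := fun x => real (Lim_seq (fun n => Hn n x))).
  assert (Hcv : forall x, 0 <= x <= 1 -> is_lim_seq (fun n => Hn n x) (H x)).
  { intros x Hx. unfold H. apply Lim_seq_correct', ex_lim_seq_cauchy_corr.
    intros d. destruct (Herr (d / 2)) as (N & HN).
    { pose proof (cond_pos d). lra. }
    exists N. intros n k Hnn Hk. pose proof (Hcauchy N n x Hnn Hx) as B1.
    pose proof (Hcauchy N k x Hk Hx) as B2. specialize (HN N (Nat.le_refl _)).
    apply Rcomplements.Rabs_le_between in B1. apply Rcomplements.Rabs_le_between in B2.
    apply Rabs_def1; lra. }
  assert (Hle : forall n x, 0 <= x <= 1 -> Rabs (Hn n x - H x) <= err n).
  { intros n x Hx. rewrite Rabs_minus_sym.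
    assert (HL : is_lim_seq (fun k => Rabs (Hn (k + n)%nat x - Hn n x)) (Rabs (H x - Hn n x))).
    { apply (is_lim_seq_abs (fun k => Hn (k + n)%nat x - Hn n x) (Finite (H x - Hn n x))).
      apply is_lim_seq_minus'; [|apply is_lim_seq_const].
      apply (is_lim_seq_incr_n (fun k => Hn k x)). now apply Hcv. }
    apply (is_lim_seq_le _ _ _ _) with (2 := HL) (3 := is_lim_seq_const (err n)).
    intros k. apply Hcauchy; [lia|exact Hx]. }
  clearbody H.
  assert (Hlow : forall x, 0 <= x <= 1 -> theta / 2 * x <= H x).
  { intros x Hx.
    apply (is_lim_seq_le _ _ _ _) with (2 := is_lim_seq_const (theta / 2 * x)) (3 := Hcv x Hx).
    intros n. apply (reg_H_lower (eps n) (Hn n) (H1n n) (H2n n)); auto. }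
  exists H. split; [exact Hlow|split; [|split]].
  - intros x y Hx Hxy Hy.
    assert (HL : is_lim_seq (fun n => Hn n y - Hn n x) (H y - H x)).
    { apply is_lim_seq_minus'; apply Hcv; lra. }
    split.
    + apply (is_lim_seq_le _ _ _ _)
        with (2 := is_lim_seq_const (theta * (1 - y) * (y - x))) (3 := HL).
      intros n. apply (reg_increment_lower (eps n) (Hn n) (H1n n) (H2n n)); auto; lra.
    + apply (is_lim_seq_le _ _ _ _)
        with (2 := HL) (3 := is_lim_seq_const ((theta + kappa * Rpower y (beta / 2)) * (y - x))).
      intros n. apply (reg_increment_upper (eps n) (Hn n) (H1n n) (H2n n)); auto; lra.
  - assert (HL : is_lim_seq (fun n => Hn n 0) (H 0)) by (apply Hcv; lra).
    assert (HL0 : is_lim_seq (fun n => Hn n 0) 0).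
    { apply (is_lim_seq_ext (fun _ => 0)); [|apply is_lim_seq_const].
      intros n. destruct (Hreg n) as (_ & _ & _ & E & _). now rewrite E. }
    apply is_lim_seq_unique in HL. apply is_lim_seq_unique in HL0.
    rewrite HL in HL0. exact (f_equal real HL0).
  - intros a Ha.
    assert (Hcl : forall x, continuous (fun x => H (clamp01 x)) x).
    { apply continuous_uniform_limit. intros d Hd. destruct (Herr d Hd) as (N & HN).
      exists (fun x => Hn N (clamp01 x)). split.
      - intros x. apply (continuous_comp clamp01 (Hn N)); [apply continuous_clamp01|].
        apply (ex_derive_continuous (Hn N)). eexists. apply (proj1 (Hreg N)).
      - intros x. rewrite Rabs_minus_sym. specialize (HN N (Nat.le_refl _)).
        pose proof (Hle N (clamp01 x) (clamp01_range x)). lra. }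
    (* On [a,1] this is the uncut right-hand side; the cutoff at a and [clamp01] extend it
       continuously to the line, so that its primitives are differentiable everywhere. *)
    set (F := fun y => film_rhs a y (H (clamp01 y))).
    assert (HF : forall x, continuous F x).
    { intros x. apply (film_rhs_cont a (fun x => H (clamp01 x))); [lra|exact Hcl]. }
    set (P3 := prim 1 F). set (P2 := prim 1 P3). set (P1 := prim 1 P2).
    assert (D3 : forall x, is_derive P3 x (F x)) by (intros; now apply is_derive_prim).
    assert (C3 : forall x, continuous P3 x) by (intros; now apply continuous_prim).
    assert (D2 : forall x, is_derive P2 x (P3 x)) by (intros; now apply is_derive_prim).
    assert (C2 : forall x, continuous P2 x) by (intros; now apply continuous_prim).
    assert (D1 : forall x, is_derive P1 x (P2 x)) by (intros; now apply is_derive_prim).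
    assert (E1 : P1 1 = 0) by apply prim_point.
    assert (E2 : P2 1 = 0) by apply prim_point.
    assert (E3 : P3 1 = 0) by apply prim_point.
    clearbody P1 P2 P3.
    set (k := fun x => (x - 1) * (x - 1) / 2).
    set (La := p * Rpower (theta / 2 * a) (- p - 1)).
    assert (HLa : 0 <= La).
    { unfold La. pose proof (Rpower_pos (theta / 2 * a) (- p - 1)). apply Rmult_le_pos; lra. }
    set (D := fun x => H x - P1 x - H 1).
    assert (Happ : forall d, 0 < d -> exists c, forall x, a <= x <= 1 -> Rabs (D x - c * k x) <= d).
    { intros d Hd. destruct (Herr (d / (La + 2))) as (N1 & HN1).
      { apply Rdiv_lt_0_compat; lra. }
      (* From N2 on the cutoff lies below a, so on [a,1] the regularised right-hand side is that of
         [film_rhs a]. *)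
      destruct (Hsmall a ltac:(lra)) as (N2 & HN2).
      set (n := Nat.max N1 N2).
      specialize (HN1 n ltac:(unfold n; lia)). specialize (HN2 n ltac:(unfold n; lia)).
      exists (H2n n 1 - P3 1). intros x Hx.
      destruct (Hreg n) as (Dn & Dn1 & Dn2 & _ & _ & En1).
      assert (Hq : Rabs ((Hn n x - P1 x) - (Hn n 1 - P1 1) - (H2n n 1 - P3 1) * k x) <= La * err n).
      { apply (quadratic_of_small_third_derivative (fun x => Hn n x - P1 x)
                 (fun x => H1n n x - P2 x) (fun x => H2n n x - P3 x)
                 (fun x => film_rhs a x (Hn n x) - film_rhs a x (H x)) (La * err n) a);
          [lra| | | | |lra|exact Hx].
        - intros y Hy. pose proof (Dn y). pose proof (D1 y). derive_as. reflexivity.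
        - intros y Hy. pose proof (Dn1 y). pose proof (D2 y). derive_as. reflexivity.
        - intros y Hy. pose proof (Dn2 y ltac:(lra)) as Hy2. pose proof (D3 y) as Hy3.
          derive_as. unfold F. rewrite clamp01_id by lra. f_equal.
          unfold film_rhs. now rewrite !(Rmax_left y) by lra.
        - intros y Hy. eapply Rle_trans; [apply film_rhs_lip; lra|]. fold La.
          apply Rmult_le_compat_l; [exact HLa|]. apply Hle. lra. }
      pose proof (Hle n x ltac:(lra)) as Bx. pose proof (Hle n 1 ltac:(lra)) as B1.
      assert (Hd2 : err n * (La + 2) <= d).
      { apply (Rmult_lt_compat_r (La + 2)) in HN1; [|lra].
        unfold Rdiv in HN1. rewrite Rmult_assoc, Rinv_l in HN1 by lra. lra. }
      unfold D. apply Rcomplements.Rabs_le_between in Bx.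
      apply Rcomplements.Rabs_le_between in B1. apply Rcomplements.Rabs_le_between in Hq.
      apply Rabs_le. lra. }
    assert (Hk : forall x, a <= x <= 1 -> 0 <= k x <= 1) by (intros x Hx; unfold k; nra).
    assert (Hka : 0 < k a) by (unfold k; nra).
    (* The coefficients c of the approximations are not known to converge; comparing x with the
       fixed point a, where k a > 0, eliminates them. *)
    assert (Hprop : forall x, a <= x <= 1 -> D x = D a / k a * k x).
    { intros x Hx. cut (D x * k a - D a * k x = 0).
      { intros E. apply (Rmult_eq_reg_r (k a)); [|lra].
        replace (D a / k a * k x * k a) with (D a * k x) by (field; lra). lra. }
      apply Rabs_eq_0. apply Rle_antisym; [|apply Rabs_pos].
      apply Rle_plus_epsilon. intros d Hd.
      destruct (Happ (d / 2)) as (c & Hc); [lra|].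
      pose proof (Hc x Hx) as Bx. pose proof (Hc a ltac:(lra)) as Ba.
      replace (D x * k a - D a * k x)
        with ((D x - c * k x) * k a - (D a - c * k a) * k x) by ring.
      eapply Rle_trans; [apply Rabs_triang|]. rewrite Rabs_Ropp, !Rabs_mult.
      pose proof (Hk x Hx). pose proof (Hk a ltac:(lra)).
      rewrite (Rabs_right (k a)), (Rabs_right (k x)) by lra.
      pose proof (Rabs_pos (D x - c * k x)). pose proof (Rabs_pos (D a - c * k a)). nra. }
    set (q := D a / k a) in *. clearbody q.
    exists (fun x => H 1 + q * k x + P1 x).
    exists (fun x => q * (x - 1) + P2 x).
    exists (fun x => q + P3 x).
    split; [|split; [|split; [|split]]].
    + intros x. pose proof (D1 x). unfold k, Rdiv. derive_as. field.
    + intros x. pose proof (D2 x). derive_as. ring.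
    + intros x Hx. pose proof (D3 x) as Hx3. derive_as. unfold F, film_rhs.
      rewrite clamp01_id, (Rmax_left x) by lra.
      rewrite Rmax_left; [ring|]. apply Hlow. lra.
    + rewrite E2. ring.
    + intros x Hx. pose proof (Hprop x Hx) as E. rewrite <- E. unfold D. ring.
Qed.

End Existence.

(** * Existence and uniqueness of the solution *)

Lemma locally_open_itv (a b x : R) (P : R -> Prop) :
  a < x < b -> (forall y, a < y < b -> P y) -> locally x P.
Proof.
  intros Hx HP. assert (Hd : 0 < Rmin (x - a) (b - x)) by (apply Rmin_glb_lt; lra).
  exists (mkposreal _ Hd). intros y Hy. apply HP.
  pose proof (Rmin_l (x - a) (b - x)). pose proof (Rmin_r (x - a) (b - x)).
  change (Rabs (y - x) < Rmin (x - a) (b - x)) in Hy. apply Rabs_def2 in Hy. lra.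
Qed.

Lemma is_derive_ext_itv (f g : R -> R) (a b x l : R) :
  a < x < b -> (forall y, a < y < b -> f y = g y) -> is_derive f x l -> is_derive g x l.
Proof.
  intros Hx E Hf. apply (is_derive_ext_loc f g); [|exact Hf].
  now apply (locally_open_itv a b).
Qed.

Lemma continuous_ext_itv (f g : R -> R) (a b x : R) :
  a < x < b -> (forall y, a < y < b -> f y = g y) -> continuous f x -> continuous g x.
Proof.
  intros Hx E Hf. apply (continuous_ext_loc _ f); [|exact Hf].
  apply (locally_open_itv a b); [exact Hx|]. intros y Hy. now apply E.
Qed.

(** Translates explicit derivatives into the total [Derive_n] of the statement, keeping the
    differentiability that the equalities alone would lose. *)
Lemma Derive_n_of_chain (H H1 H2 H3 : R -> R) (a b : R) :
  (forall x, a < x < b -> is_derive H x (H1 x)) ->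
  (forall x, a < x < b -> is_derive H1 x (H2 x)) ->
  (forall x, a < x < b -> is_derive H2 x (H3 x)) ->
  forall x, a < x < b ->
    Derive_n H 1 x = H1 x /\ Derive_n H 2 x = H2 x /\ Derive_n H 3 x = H3 x /\
    is_derive (Derive_n H 1) x (H2 x) /\ is_derive (Derive_n H 2) x (H3 x).
Proof.
  intros D1 D2 D3.
  assert (E1 : forall x, a < x < b -> Derive_n H 1 x = H1 x).
  { intros x Hx. simpl. apply is_derive_unique. now apply D1. }
  assert (D2' : forall x, a < x < b -> is_derive (Derive_n H 1) x (H2 x)).
  { intros x Hx. apply (is_derive_ext_itv H1 _ a b); [exact Hx| |now apply D2].
    intros y Hy. symmetry. now apply E1. }
  assert (E2 : forall x, a < x < b -> Derive_n H 2 x = H2 x).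
  { intros x Hx. apply (is_derive_unique (Derive_n H 1)). now apply D2'. }
  assert (D3' : forall x, a < x < b -> is_derive (Derive_n H 2) x (H3 x)).
  { intros x Hx. apply (is_derive_ext_itv H2 _ a b); [exact Hx| |now apply D3].
    intros y Hy. symmetry. now apply E2. }
  intros x Hx. split; [now apply E1|split; [now apply E2|split; [|split]]].
  - apply (is_derive_unique (Derive_n H 2)). now apply D3'.
  - now apply D2'.
  - now apply D3'.
Qed.

Lemma D_in_interior (f df : R -> R) (x : R) :
  0 < x < 1 -> D_in f df unit_itv x -> is_derive f x (df x).
Proof.
  intros Hx HD. apply is_derive_Reals. intros e He.
  destruct (HD e He) as (d & Hd & Hlim). simpl in Hlim. unfold Rdist in Hlim.
  assert (Hm : 0 < Rmin d (Rmin x (1 - x))) by (repeat apply Rmin_glb_lt; lra).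
  exists (mkposreal _ Hm). simpl. intros h Hh0 Hh.
  pose proof (Rmin_l d (Rmin x (1 - x))). pose proof (Rmin_r d (Rmin x (1 - x))).
  pose proof (Rmin_l x (1 - x)). pose proof (Rmin_r x (1 - x)).
  pose proof (Rabs_def2 _ _ Hh).
  specialize (Hlim (x + h)). replace (x + h - x) with h in Hlim by ring.
  apply Hlim. split; [|lra]. split; [unfold unit_itv; lra|lra].
Qed.

Lemma is_derive_D_in (f df : R -> R) (D : R -> Prop) (x : R) :
  is_derive f x (df x) -> D_in f df D x.
Proof.
  intros Hd e He. apply is_derive_Reals in Hd. destruct (Hd e He) as (d & Hlim).
  exists d. split; [apply cond_pos|]. intros y ((_ & Hne) & Hy). simpl in *. unfold Rdist in *.
  specialize (Hlim (y - x) ltac:(lra) Hy). now replace (x + (y - x)) with y in Hlim by ring.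
Qed.

(** Nothing is known of H to the right of 1, so H itself need not be differentiable there in the
    two-sided sense. Q is a function differentiable at 1 that agrees with H on [a,1] and supplies
    the one-sided derivative. *)
Lemma film_solution_intro (n p theta a : R) (H H1 H2 Q Q1 : R -> R) :
  p = n - 1 -> a < 1 ->
  (forall x, 0 < x < 1 -> 0 < H x /\ is_derive H x (H1 x) /\ is_derive H1 x (H2 x) /\
     is_derive H2 x (- (1 - x) * Rpower (H x) (- p))) ->
  H 0 = 0 -> lim0 (fun x => H x / x) theta -> lim0 H1 theta ->
  is_derive Q 1 0 -> Q1 1 = 0 -> continuous Q1 1 ->
  (forall x, a <= x <= 1 -> H x = Q x) ->
  (forall x, a < x < 1 -> H1 x = Q1 x) ->
  film_solution n theta H.
Proof.
  intros Ep Ha Hs E0 Hq Hl1 DQ EQ CQ HQ HQ1.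
  set (H3 := fun x => - (1 - x) * Rpower (H x) (- p)).
  assert (D1 : forall x, 0 < x < 1 -> is_derive H x (H1 x)) by (intros; now apply Hs).
  assert (D2 : forall x, 0 < x < 1 -> is_derive H1 x (H2 x)) by (intros; now apply Hs).
  assert (D3 : forall x, 0 < x < 1 -> is_derive H2 x (H3 x)) by (intros; now apply Hs).
  pose proof (Derive_n_of_chain H H1 H2 H3 0 1 D1 D2 D3) as Hchain.
  set (dH := fun x => if Rle_dec x 0 then theta else if Rle_dec 1 x then 0 else H1 x).
  assert (dH_in : forall x, 0 < x < 1 -> dH x = H1 x).
  { intros x Hx. unfold dH. destruct (Rle_dec x 0); [lra|]. destruct (Rle_dec 1 x); [lra|easy]. }
  assert (dH0 : dH 0 = theta).
  { unfold dH. destruct (Rle_dec 0 0); [easy|lra]. }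
  assert (dH1 : dH 1 = 0).
  { unfold dH. destruct (Rle_dec 1 0); [lra|]. destruct (Rle_dec 1 1); [easy|lra]. }
  exists dH. split; [split|split; [|split; [|split; [|split; [|split]]]]]; auto.
  - intros x Hx. unfold unit_itv in Hx. destruct (Req_dec x 0) as [->|Hx0].
    + intros e He. destruct (lim0_elim _ _ Hq e He) as (d & Hd & Hlim).
      exists d. split; [exact Hd|]. intros y ((Hy & Hne) & Hyd). simpl in *.
      unfold Rdist in *. unfold unit_itv in Hy. rewrite dH0, E0, !Rminus_0_r in *.
      rewrite Rabs_right in Hyd by lra. apply Hlim. lra.
    + destruct (Req_dec x 1) as [->|Hx1].
      * apply is_derive_Reals in DQ. intros e He. destruct (DQ e He) as (d & Hlim).
        exists (Rmin d (1 - a)). split; [apply Rmin_glb_lt; [apply cond_pos|lra]|].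
        intros y ((Hy & Hne) & Hyd). simpl in *. unfold Rdist in *. unfold unit_itv in Hy.
        pose proof (Rmin_l d (1 - a)). pose proof (Rmin_r d (1 - a)).
        specialize (Hlim (y - 1) ltac:(lra) ltac:(lra)).
        replace (1 + (y - 1)) with y in Hlim by ring.
        apply Rabs_def2 in Hyd. rewrite dH1, !HQ by lra. exact Hlim.
      * apply is_derive_D_in. rewrite dH_in by lra. apply D1. lra.
  - intros x Hx. unfold unit_itv in Hx. destruct (Req_dec x 0) as [->|Hx0].
    + intros e He. destruct (lim0_elim _ _ Hl1 e He) as (d & Hd & Hlim).
      exists (Rmin d 1). split; [apply Rmin_glb_lt; lra|].
      intros y ((Hy & Hne) & Hyd). simpl in *. unfold Rdist in *. unfold unit_itv in Hy.
      pose proof (Rmin_l d 1). pose proof (Rmin_r d 1).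
      rewrite Rminus_0_r, Rabs_right in Hyd by lra.
      rewrite dH0, dH_in by lra. apply Hlim. lra.
    + destruct (Req_dec x 1) as [->|Hx1].
      * apply continuity_pt_filterlim in CQ. intros e He. destruct (CQ e He) as (d & Hd & Hlim).
        exists (Rmin d (Rmin 1 (1 - a))). split; [repeat apply Rmin_glb_lt; lra|].
        intros y ((Hy & Hne) & Hyd). simpl in *. unfold Rdist in *. unfold unit_itv in Hy.
        pose proof (Rmin_l d (Rmin 1 (1 - a))). pose proof (Rmin_r d (Rmin 1 (1 - a))).
        pose proof (Rmin_l 1 (1 - a)). pose proof (Rmin_r 1 (1 - a)).
        specialize (Hlim y). pose proof (Rabs_def2 _ _ Hyd).
        rewrite dH1, dH_in, HQ1 by lra. rewrite EQ in Hlim. apply Hlim.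
        split; [split; [exact I|exact Hne]|lra].
      * assert (Hc : continuous dH x).
        { apply (continuous_ext_itv H1 dH 0 1); [lra| |].
          - intros y Hy. symmetry. now apply dH_in.
          - apply (ex_derive_continuous H1). exists (H2 x). apply D2. lra. }
        apply continuity_pt_filterlim in Hc. intros e He. destruct (Hc e He) as (d & Hd & Hlim).
        exists d. split; [exact Hd|]. intros y ((Hy & Hne) & Hyd). apply Hlim.
        split; [split; [exact I|exact Hne]|exact Hyd].
  - intros k x Hk Hx. destruct (Hchain x Hx) as (_ & _ & _ & C1 & C2).
    assert (C3 : continuous (Derive_n H 3) x).
    { apply (continuous_ext_itv H3 _ 0 1); [exact Hx| |].
      - intros y Hy. symmetry. now apply Hchain.
      - apply (continuous_mult (fun x => - (1 - x)) (fun x => Rpower (H x) (- p))).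
        + apply (ex_derive_continuous (fun x => - (1 - x))). exists 1. derive_as. ring.
        + apply (continuous_comp H (fun h => Rpower h (- p))).
          * apply (ex_derive_continuous H). exists (H1 x). now apply D1.
          * apply (ex_derive_continuous (fun h => Rpower h (- p))).
            eexists. apply is_derive_Rpower. now apply Hs. }
    assert (Hcase : (k = 0 \/ k = 1 \/ k = 2 \/ k = 3)%nat) by lia.
    destruct Hcase as [->|[->|[->| ->]]].
    + split; [exact I|]. apply (ex_derive_continuous H). exists (H1 x). now apply D1.
    + split; [exists (H1 x); now apply D1|].
      apply (ex_derive_continuous (Derive_n H 1)). now exists (H2 x).
    + split; [now exists (H2 x)|].
      apply (ex_derive_continuous (Derive_n H 2)). now exists (H3 x).
    + split; [now exists (H3 x)|exact C3].
  - intros x Hx. now apply Hs.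
  - intros x Hx. destruct (Hchain x Hx) as (_ & _ & E3 & _). rewrite E3. unfold H3.
    rewrite <- Ep, Rpower_Ropp. pose proof (Rpower_pos (H x) p). field. lra.
Qed.

Lemma film_solution_exists (n theta beta : R) :
  0 < beta -> beta <= 1 -> n = 3 - beta -> 0 < theta ->
  exists H, film_solution n theta H.
Proof.
  intros Hb Hb1 En Ht.
  destruct (film_limit beta (2 - beta) theta Hb Hb1 eq_refl Ht) as (H & Hlow & Hinc & E0 & Hloc).
  set (kap := kappa beta (2 - beta) theta) in *.
  set (H3 := fun x => - (1 - x) * Rpower (H x) (- (2 - beta))).
  assert (HDer : forall x, 0 < x < 1 -> is_derive H x (Derive_n H 1 x) /\
     is_derive (Derive_n H 1) x (Derive_n H 2 x) /\ is_derive (Derive_n H 2) x (H3 x)).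
  { intros x Hx. destruct (Hloc (x / 2) ltac:(lra)) as (Q & Q1 & Q2 & DQ & DQ1 & DQ2 & _ & EQ).
    assert (D1 : forall y, x / 2 < y < 1 -> is_derive H y (Q1 y)).
    { intros y Hy. apply (is_derive_ext_itv Q H (x / 2) 1); [exact Hy| |apply DQ].
      intros z Hz. symmetry. apply EQ. lra. }
    destruct (Derive_n_of_chain H Q1 Q2 H3 (x / 2) 1 D1) with (x := x)
      as (F1 & F2 & F3 & F4 & F5); [intros; apply DQ1|intros; apply DQ2; lra|lra|].
    rewrite F1, F2. split; [apply D1; lra|split; [exact F4|exact F5]]. }
  pose proof (kappa_pos beta (2 - beta) theta Hb Hb1) as Hkap. fold kap in Hkap.
  (* The bounds on increments become bounds on H', which yield its continuity at 0. *)
  assert (HD1 : forall x, 0 < x < 1 / 2 ->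
     theta * (1 - 2 * x) <= Derive_n H 1 x <= theta + kap * Rpower (2 * x) (beta / 2)).
  { intros x Hx.
    destruct (HDer x ltac:(lra)) as (HD & _).
    assert (Hfl : forall e, 0 < e ->
      theta * (1 - 2 * x) - e <= Derive_n H 1 x <= theta + kap * Rpower (2 * x) (beta / 2) + e).
    { intros e He. apply is_derive_Reals in HD. destruct (HD e He) as (d & Hlim).
      (* The increment is kept below x so that x + h <= 2x, which is where the 2x in the bounds
         comes from. *)
      set (h := Rmin (d / 2) x). pose proof (cond_pos d).
      assert (Hh : 0 < h) by (apply Rmin_glb_lt; lra).
      pose proof (Rmin_l (d / 2) x) as M1. pose proof (Rmin_r (d / 2) x) as M2.
      fold h in M1, M2.
      specialize (Hlim h ltac:(lra) ltac:(rewrite Rabs_right; lra)).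
      destruct (Hinc x (x + h) ltac:(lra) ltac:(lra) ltac:(lra)) as (I1 & I2).
      replace (x + h - x) with h in I1, I2 by ring.
      assert (J1 : theta * (1 - (x + h)) <= (H (x + h) - H x) / h).
      { apply (Rmult_le_reg_r h); [exact Hh|]. unfold Rdiv.
        rewrite (Rmult_assoc _ (/ h)), Rinv_l, Rmult_1_r by lra. exact I1. }
      assert (J2 : (H (x + h) - H x) / h <= theta + kap * Rpower (x + h) (beta / 2)).
      { apply (Rmult_le_reg_r h); [exact Hh|]. unfold Rdiv at 1.
        rewrite (Rmult_assoc _ (/ h)), Rinv_l, Rmult_1_r by lra. exact I2. }
      assert (Rpower (x + h) (beta / 2) <= Rpower (2 * x) (beta / 2)).
      { apply Rle_Rpower_l; lra. }
      apply Rabs_def2 in Hlim. nra. }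
    split; apply Rle_plus_epsilon; intros e He; specialize (Hfl e He); lra. }
  destruct (Hloc (1 / 2) ltac:(lra)) as (Q & Q1 & Q2 & DQ & DQ1 & DQ2 & EQ1 & EQ).
  exists H. apply (film_solution_intro n (2 - beta) theta (1 / 2) H (Derive_n H 1) (Derive_n H 2) Q Q1).
  - lra.
  - lra.
  - intros x Hx. split; [|exact (HDer x Hx)].
    specialize (Hlow x ltac:(lra)). nra.
  - exact E0.
  - apply (lim0_squeeze _ (fun x => theta * x + kap * Rpower x (beta / 2)) _ 1); [lra| |].
    + intros x Hx. destruct (Hinc 0 x ltac:(lra) ltac:(lra) ltac:(lra)) as (I1 & I2).
      rewrite E0, !Rminus_0_r in I1, I2. pose proof (Rpower_pos x (beta / 2)).
      assert (J1 : theta * (1 - x) <= H x / x).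
      { apply (Rmult_le_reg_r x); [lra|]. unfold Rdiv.
        rewrite (Rmult_assoc _ (/ x)), Rinv_l, Rmult_1_r by lra. exact I1. }
      assert (J2 : H x / x <= theta + kap * Rpower x (beta / 2)).
      { apply (Rmult_le_reg_r x); [lra|]. unfold Rdiv at 1.
        rewrite (Rmult_assoc _ (/ x)), Rinv_l, Rmult_1_r by lra. exact I2. }
      apply Rabs_le. nra.
    + apply (lim0_eq _ (theta * 0 + kap * 0)); [|ring].
      apply lim0_plus; (apply lim0_mult; [apply lim0_const|]); [apply lim0_id|].
      apply lim0_Rpower. lra.
  - apply (lim0_squeeze _ (fun x => 2 * theta * x + kap * Rpower (2 * x) (beta / 2)) _ (1 / 2));
      [lra| |].
    + intros x Hx. specialize (HD1 x Hx). pose proof (Rpower_pos (2 * x) (beta / 2)).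
      apply Rabs_le. nra.
    + apply (lim0_eq _ (2 * theta * 0 + kap * 0)); [|ring].
      apply lim0_plus; (apply lim0_mult; [apply lim0_const|]); [apply lim0_id|].
      apply (lim0_scale (fun y => Rpower y (beta / 2))); [lra|]. apply lim0_Rpower. lra.
  - rewrite <- EQ1. apply DQ.
  - exact EQ1.
  - apply (ex_derive_continuous Q1). exists (Q2 1). apply DQ1.
  - exact EQ.
  - intros x Hx. apply is_derive_unique.
    apply (is_derive_ext_itv Q H (1 / 2) 1); [exact Hx| |apply DQ].
    intros z Hz. symmetry. apply EQ. lra.
Qed.

Lemma film_solution_local (n theta : R) (H : R -> R) :
  film_solution n theta H -> local_solution (n - 1) theta 1 H (Derive_n H 1) (Derive_n H 2).
Proof.
  intros (dH & (HD & HC) & HC3 & Hpos & Hode & E0 & Eth & E1).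
  assert (EdH : forall x, 0 < x < 1 -> Derive_n H 1 x = dH x).
  { intros x Hx. apply is_derive_unique. apply D_in_interior; [exact Hx|].
    apply HD. unfold unit_itv; lra. }
  assert (Hq : lim0 (fun x => H x / x) theta).
  { apply lim0_intro. intros e He. destruct (HD 0 ltac:(unfold unit_itv; lra) e He) as (d & Hd & Hl).
    exists (Rmin d 1). split; [apply Rmin_glb_lt; lra|]. intros x Hx.
    pose proof (Rmin_l d 1). pose proof (Rmin_r d 1).
    specialize (Hl x). simpl in Hl. unfold Rdist in Hl.
    rewrite E0, Eth, !Rminus_0_r in Hl. apply Hl.
    split; [split; [unfold unit_itv; lra|lra]|rewrite Rabs_right; lra]. }
  split; [|split].
  - intros x Hx. split; [now apply Hpos|split; [|split]].
    + destruct (HC3 1%nat x ltac:(lia) Hx) as (Hex & _).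
      apply (Derive_correct H x Hex).
    + destruct (HC3 2%nat x ltac:(lia) Hx) as (Hex & _).
      apply (Derive_correct (Derive_n H 1) x Hex).
    + destruct (HC3 3%nat x ltac:(lia) Hx) as (Hex & _).
      eapply is_derive_eq; [apply (Derive_correct (Derive_n H 2) x Hex)|].
      change (Derive (Derive_n H 2) x) with (Derive_n H 3 x).
      pose proof (Hode x Hx) as Ho. rewrite Rpower_Ropp. pose proof (Rpower_pos (H x) (n - 1)).
      replace (- (1 - x)) with (-1 + x) by ring. rewrite <- Ho. field. lra.
  - apply (lim0_ext_loc (fun x => x * (H x / x)) _ _ 1); [lra|intros x Hx; field; lra|].
    apply (lim0_eq _ (0 * theta)); [|ring]. apply lim0_mult; [apply lim0_id|exact Hq].
  - apply (lim0_ext_loc dH _ _ 1); [lra|intros x Hx; symmetry; now apply EdH|].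
    apply lim0_intro. intros e He. destruct (HC 0 ltac:(unfold unit_itv; lra) e He) as (d & Hd & Hl).
    exists (Rmin d 1). split; [apply Rmin_glb_lt; lra|]. intros x Hx.
    pose proof (Rmin_l d 1). pose proof (Rmin_r d 1).
    rewrite <- Eth. apply (Hl x). simpl. unfold Rdist. rewrite Rminus_0_r.
    split; [split; [unfold unit_itv; lra|lra]|rewrite Rabs_right; lra].
Qed.

Lemma film_solution_right_end (n theta : R) (H : R -> R) :
  film_solution n theta H ->
  forall e, 0 < e -> exists z, 0 < z < 1 /\
    forall y, z < y < 1 -> Rabs (H y - H 1) < e /\ Rabs (Derive_n H 1 y) < e.
Proof.
  intros (dH & (HD & HC) & HC3 & Hpos & Hode & E0 & Eth & E1) e He.
  destruct (HC 1 ltac:(unfold unit_itv; lra) e He) as (d & Hd & Hl).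
  destruct (HD 1 ltac:(unfold unit_itv; lra) e He) as (d' & Hd' & Hl').
  set (m := Rmin (1 / 2) (Rmin d d')).
  assert (0 < m) by (unfold m; repeat apply Rmin_glb_lt; lra).
  assert (m <= 1 / 2 /\ m <= d /\ m <= d') as (? & ? & ?).
  { unfold m. pose proof (Rmin_l (1 / 2) (Rmin d d')). pose proof (Rmin_r (1 / 2) (Rmin d d')).
    pose proof (Rmin_l d d'). pose proof (Rmin_r d d'). lra. }
  exists (1 - m). split; [lra|]. intros y Hy.
  assert (Hy1 : Rabs (y - 1) < m) by (apply Rabs_def1; lra).
  split.
  - specialize (Hl' y). simpl in Hl'. unfold Rdist in Hl'. rewrite E1, Rminus_0_r in Hl'.
    assert (Hb : Rabs ((H y - H 1) / (y - 1)) < e).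
    { apply Hl'. split; [split; [unfold unit_itv; lra|lra]|lra]. }
    replace (H y - H 1) with ((H y - H 1) / (y - 1) * (y - 1)) by (field; lra).
    rewrite Rabs_mult. pose proof (Rabs_pos ((H y - H 1) / (y - 1))).
    pose proof (Rabs_pos (y - 1)). nra.
  - specialize (Hl y). simpl in Hl. unfold Rdist in Hl. rewrite E1, Rminus_0_r in Hl.
    replace (Derive_n H 1 y) with (dH y).
    + apply Hl. split; [split; [unfold unit_itv; lra|lra]|lra].
    + symmetry. apply is_derive_unique, D_in_interior; [lra|]. apply HD. unfold unit_itv; lra.
Qed.

Lemma film_solution_unique (n theta : R) (H K : R -> R) :
  1 < n -> 0 < theta -> film_solution n theta H -> film_solution n theta K ->
  forall x, unit_itv x -> H x = K x.
Proof.
  intros Hn Ht HH HK.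
  assert (Hin : forall x, 0 < x < 1 -> H x = K x).
  { apply (comparison_unique (n - 1) theta 1 H (Derive_n H 1) (Derive_n H 2)
             K (Derive_n K 1) (Derive_n K 2)); try lra; try now apply film_solution_local.
    (* Near 1 the difference of the solutions stays below M and that of their slopes below 2 d; d is
       chosen so that the product is below e. *)
    intros x e Hx He. set (M := Rabs (H 1 - K 1) + 2).
    assert (HM : 2 <= M) by (unfold M; pose proof (Rabs_pos (H 1 - K 1)); lra).
    set (d := Rmin 1 (e / (2 * M))).
    assert (Hd : 0 < d).
    { unfold d. apply Rmin_glb_lt; [lra|]. apply Rdiv_lt_0_compat; lra. }
    destruct (film_solution_right_end n theta H HH d Hd) as (z1 & Hz1 & B1).
    destruct (film_solution_right_end n theta K HK d Hd) as (z2 & Hz2 & B2).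
    set (z := Rmax x (Rmax z1 z2)).
    assert (Hz : x <= z /\ z1 <= z /\ z2 <= z /\ z < 1).
    { unfold z. pose proof (Rmax_l x (Rmax z1 z2)). pose proof (Rmax_r x (Rmax z1 z2)).
      pose proof (Rmax_l z1 z2). pose proof (Rmax_r z1 z2).
      repeat split; try lra. repeat apply Rmax_lub_lt; lra. }
    exists ((z + 1) / 2). set (y := (z + 1) / 2). assert (Hy : z < y < 1) by (unfold y; lra).
    split; [lra|].
    destruct (B1 y ltac:(lra)) as (B1a & B1b). destruct (B2 y ltac:(lra)) as (B2a & B2b).
    assert (Hd1 : d <= 1) by apply Rmin_l.
    assert (Hd2 : d * (2 * M) <= e).
    { pose proof (Rmin_r 1 (e / (2 * M))) as Hr. fold d in Hr.
      apply (Rmult_le_compat_r (2 * M)) in Hr; [|lra].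
      unfold Rdiv in Hr. rewrite Rmult_assoc, Rinv_l in Hr by lra. lra. }
    assert (Ha : Rabs (H y - K y) < M + 0).
    { unfold M. replace (H y - K y) with ((H y - H 1) - (K y - K 1) + (H 1 - K 1)) by ring.
      pose proof (Rabs_triang ((H y - H 1) - (K y - K 1)) (H 1 - K 1)).
      pose proof (Rabs_triang (H y - H 1) (- (K y - K 1))) as Ht2. rewrite Rabs_Ropp in Ht2.
      unfold Rminus at 1 in Ht2. unfold Rminus in *. lra. }
    assert (Hb : Rabs (Derive_n H 1 y - Derive_n K 1 y) < 2 * d).
    { apply Rabs_def2 in B1b. apply Rabs_def2 in B2b. apply Rabs_def1; lra. }
    eapply Rle_lt_trans; [apply Rle_abs|]. rewrite Rabs_mult.
    pose proof (Rabs_pos (H y - K y)). pose proof (Rabs_pos (Derive_n H 1 y - Derive_n K 1 y)).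
    nra. }
  intros x Hx. unfold unit_itv in Hx. destruct (Req_dec x 0) as [->|Hx0].
  - destruct HH as (? & _ & _ & _ & _ & E & _). destruct HK as (? & _ & _ & _ & _ & E' & _).
    now rewrite E, E'.
  - destruct (Req_dec x 1) as [->|Hx1]; [|apply Hin; lra].
    apply Rminus_diag_uniq, Rabs_eq_0. apply Rle_antisym; [|apply Rabs_pos].
    apply Rle_plus_epsilon. intros e He.
    destruct (film_solution_right_end n theta H HH (e / 2) ltac:(lra)) as (z1 & Hz1 & B1).
    destruct (film_solution_right_end n theta K HK (e / 2) ltac:(lra)) as (z2 & Hz2 & B2).
    set (z := Rmax z1 z2).
    assert (Hz : z1 <= z /\ z2 <= z /\ z < 1).
    { unfold z. pose proof (Rmax_l z1 z2). pose proof (Rmax_r z1 z2).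
      repeat split; try lra. apply Rmax_lub_lt; lra. }
    destruct (B1 ((z + 1) / 2) ltac:(lra)) as (C1 & _).
    destruct (B2 ((z + 1) / 2) ltac:(lra)) as (C2 & _).
    rewrite Hin in C1 by lra. apply Rabs_def2 in C1. apply Rabs_def2 in C2.
    apply Rabs_le. lra.
Qed.

(** * Polynomials in ln x *)

(** Polynomials are coefficient lists, constant term first. Trailing zeros are allowed, so the
    length only bounds the degree. *)
Fixpoint padd (P Q : list R) : list R :=
  match P, Q with
  | [], _ => Q
  | _, [] => P
  | a :: P, b :: Q => (a + b) :: padd P Q
  end.

Definition pscal (c : R) (P : list R) : list R := map (Rmult c) P.

Fixpoint pmul (P Q : list R) : list R :=
  match P with
  | [] => []
  | a :: P => padd (pscal a Q) (0 :: pmul P Q)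
  end.

(** Uses (a + x P)' = P + x P'. The inner case on the empty list keeps the derivative of a constant
    empty instead of [0], so that the length drops by exactly one. *)
Fixpoint pderiv (P : list R) : list R :=
  match P with
  | [] => []
  | a :: P => match P with [] => [] | _ => padd P (0 :: pderiv P) end
  end.

Fixpoint peval (P : list R) (x : R) : R :=
  match P with
  | [] => 0
  | a :: P => a + x * peval P x
  end.

Fixpoint pnorm (rho : R) (P : list R) : R :=
  match P with
  | [] => 0
  | a :: P => Rabs a + rho * pnorm rho P
  end.

Lemma peval_padd (P Q : list R) (x : R) : peval (padd P Q) x = peval P x + peval Q x.
Proof.
  revert Q. induction P as [|a P IH]; intros [|b Q]; simpl; try ring. rewrite IH. ring.
Qed.

Lemma peval_pscal (c : R) (P : list R) (x : R) : peval (pscal c P) x = c * peval P x.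
Proof. induction P as [|a P IH]; simpl; [ring|]. rewrite IH. ring. Qed.

Lemma peval_pmul (P Q : list R) (x : R) : peval (pmul P Q) x = peval P x * peval Q x.
Proof.
  induction P as [|a P IH]; [simpl; ring|].
  cbn [pmul]. rewrite peval_padd, peval_pscal. cbn [peval]. rewrite IH. ring.
Qed.

Lemma is_derive_peval (P : list R) (x : R) : is_derive (peval P) x (peval (pderiv P) x).
Proof.
  induction P as [|a P IH]; [apply is_derive_Rconst|].
  eapply is_derive_eq; [apply (is_derive_Rplus (fun _ => a) (fun x => x * peval P x))|].
  - apply is_derive_Rconst.
  - apply (is_derive_Rmult (fun x => x) (peval P)); [apply is_derive_Rid|exact IH].
  - destruct P as [|b P]; [simpl; ring|].
    cbn [pderiv]. rewrite peval_padd. cbn [peval pderiv]. ring.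
Qed.

(** Lists represent polynomials non-uniquely, so identities hold only after evaluation;
    differentiating the evaluated identity carries them over to [pderiv]. *)
Lemma peval_pderiv_lin (P Q T : list R) (a b : R) :
  (forall x, peval P x = a * peval Q x + b * peval T x) ->
  forall x, peval (pderiv P) x = a * peval (pderiv Q) x + b * peval (pderiv T) x.
Proof.
  intros E x. rewrite <- (is_derive_unique _ _ _ (is_derive_peval P x)).
  apply is_derive_unique.
  apply (is_derive_ext (fun x => a * peval Q x + b * peval T x)); [intros; symmetry; apply E|].
  pose proof (is_derive_peval Q x). pose proof (is_derive_peval T x). derive_as. ring.
Qed.

Lemma pnorm_nonneg (rho : R) (P : list R) : 0 <= rho -> 0 <= pnorm rho P.
Proof.
  intros Hr. induction P as [|a P IH]; simpl; [lra|]. pose proof (Rabs_pos a). nra.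
Qed.

Lemma pnorm_padd (rho : R) (P Q : list R) :
  0 <= rho -> pnorm rho (padd P Q) <= pnorm rho P + pnorm rho Q.
Proof.
  intros Hr. revert Q. induction P as [|a P IH]; intros [|b Q]; simpl; try lra.
  pose proof (Rabs_triang a b). specialize (IH Q). nra.
Qed.

Lemma pnorm_pscal (rho c : R) (P : list R) : pnorm rho (pscal c P) = Rabs c * pnorm rho P.
Proof.
  induction P as [|a P IH]; simpl; [ring|]. rewrite IH, Rabs_mult. ring.
Qed.

Lemma pnorm_pmul (rho : R) (P Q : list R) :
  0 <= rho -> pnorm rho (pmul P Q) <= pnorm rho P * pnorm rho Q.
Proof.
  intros Hr. induction P as [|a P IH]; [simpl; lra|].
  cbn [pmul]. eapply Rle_trans; [now apply pnorm_padd|].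
  rewrite pnorm_pscal. cbn [pnorm]. rewrite Rabs_R0. nra.
Qed.

Lemma length_padd (P Q : list R) : length (padd P Q) = Nat.max (length P) (length Q).
Proof.
  revert Q. induction P as [|a P IH]; intros [|b Q]; simpl; auto.
Qed.

Lemma length_pscal (c : R) (P : list R) : length (pscal c P) = length P.
Proof. apply length_map. Qed.

Lemma length_pmul (P Q : list R) :
  (length (pmul P Q) <= length P + Nat.max (length Q) 1 - 1)%nat.
Proof.
  induction P as [|a P IH]; [simpl; lia|].
  cbn [pmul]. rewrite length_padd, length_pscal. cbn [length].
  destruct (length P) eqn:E.
  - destruct P; [simpl; lia|discriminate].
  - lia.
Qed.

Lemma length_pderiv (P : list R) : length (pderiv P) = (length P - 1)%nat.
Proof.
  induction P as [|a P IH]; [reflexivity|]. destruct P as [|b P]; [reflexivity|].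
  cbn [pderiv]. rewrite length_padd. cbn [length]. cbn [pderiv length] in IH. rewrite IH. lia.
Qed.

Lemma pnorm_pderiv (rho : R) (P : list R) :
  0 <= rho -> rho * pnorm rho (pderiv P) <= INR (length P - 1) * pnorm rho P.
Proof.
  intros Hr. induction P as [|a P IH]; [simpl; lra|].
  destruct P as [|b P]; [simpl; lra|].
  change (pderiv (a :: b :: P)) with (padd (b :: P) (0 :: pderiv (b :: P))).
  set (P' := b :: P) in *.
  pose proof (pnorm_padd rho P' (0 :: pderiv P') Hr) as Ha.
  change (pnorm rho (0 :: pderiv P')) with (Rabs 0 + rho * pnorm rho (pderiv P')) in Ha.
  rewrite Rabs_R0, Rplus_0_l in Ha.
  change (pnorm rho (a :: P')) with (Rabs a + rho * pnorm rho P').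
  replace (length (a :: P') - 1)%nat with (S (length P' - 1)) by (unfold P'; cbn [length]; lia).
  rewrite S_INR. pose proof (pos_INR (length P' - 1)). pose proof (Rabs_pos a).
  clearbody P'.
  assert (rho * pnorm rho (padd P' (0 :: pderiv P'))
          <= rho * (pnorm rho P' + rho * pnorm rho (pderiv P'))) by (apply Rmult_le_compat_l; lra).
  assert (rho * (rho * pnorm rho (pderiv P')) <= rho * (INR (length P' - 1) * pnorm rho P'))
    by (apply Rmult_le_compat_l; lra).
  assert (0 <= (INR (length P' - 1) + 1) * Rabs a) by (apply Rmult_le_pos; lra).
  lra.
Qed.

(* Inverts [P |-> c P + P'] through the Neumann series of [1 + c^-1 d/dx],
   which terminates after [length P] steps. *)
Fixpoint pinv_iter (c : R) (n : nat) (P : list R) : list R :=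
  match n with
  | O => []
  | S n => pscal (/ c) (padd P (pscal (-1) (pinv_iter c n (pderiv P))))
  end.

Definition pinv (c : R) (P : list R) : list R := pinv_iter c (length P) P.

Lemma pinv_spec (c : R) (P : list R) : c <> 0 ->
  forall x, c * peval (pinv c P) x + peval (pderiv (pinv c P)) x = peval P x.
Proof.
  intros Hc. unfold pinv.
  assert (H : forall n P, (length P <= n)%nat -> forall x,
    c * peval (pinv_iter c n P) x + peval (pderiv (pinv_iter c n P)) x = peval P x).
  { clear P. induction n as [|n IH]; intros P Hn x.
    - destruct P; [simpl; ring|simpl in Hn; lia].
    - cbn [pinv_iter]. set (Q := pinv_iter c n (pderiv P)).
      rewrite (peval_pderiv_lin _ P Q (/ c) (- / c)).
      + rewrite peval_pscal, peval_padd, peval_pscal.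
        pose proof (IH (pderiv P) ltac:(rewrite length_pderiv; lia) x) as E. fold Q in E.
        rewrite <- E. field. exact Hc.
      + intros y. rewrite peval_pscal, peval_padd, peval_pscal. ring. }
  apply H. lia.
Qed.

Lemma length_pinv (c : R) (P : list R) : (length (pinv c P) <= length P)%nat.
Proof.
  unfold pinv. generalize (length P) at 1 as n. intros n. revert P.
  induction n as [|n IH]; intros P; [simpl; lia|].
  cbn [pinv_iter]. rewrite length_pscal, length_padd, length_pscal.
  pose proof (IH (pderiv P)) as H. rewrite length_pderiv in H. lia.
Qed.

(** The condition on the degree makes differentiation divided by c a contraction by 1/2, so the
    Neumann series adds at most a factor 2 to 1/|c|. *)
Lemma pnorm_pinv (rho c : R) (P : list R) :
  0 < rho -> c <> 0 -> INR (length P - 1) <= rho * Rabs c / 2 ->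
  pnorm rho (pinv c P) <= 2 / Rabs c * pnorm rho P.
Proof.
  intros Hr Hc. unfold pinv. generalize (length P) at 2 as n. intros n. revert P.
  pose proof (Rabs_pos_lt c Hc) as Hac.
  induction n as [|n IH]; intros P HP.
  - simpl. apply Rmult_le_pos; [|now apply pnorm_nonneg, Rlt_le]. apply Rle_mult_inv_pos; lra.
  - cbn [pinv_iter]. rewrite pnorm_pscal, Rabs_inv.
    set (Q := pinv_iter c n (pderiv P)) in *.
    pose proof (pnorm_padd rho P (pscal (-1) Q) ltac:(lra)) as H1.
    rewrite pnorm_pscal, (Rabs_left (-1)) in H1 by lra.
    replace (- (-1)) with 1 in H1 by ring. rewrite Rmult_1_l in H1.
    pose proof (pnorm_pderiv rho P ltac:(lra)) as H2.
    pose proof (pnorm_nonneg rho P ltac:(lra)) as H0.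
    assert (H3 : pnorm rho Q <= 2 / Rabs c * pnorm rho (pderiv P)).
    { apply IH. rewrite length_pderiv. eapply Rle_trans; [|exact HP]. apply le_INR. lia. }
    assert (H4 : pnorm rho (pderiv P) <= Rabs c / 2 * pnorm rho P).
    { apply (Rmult_le_reg_l rho); [exact Hr|]. eapply Rle_trans; [exact H2|].
      assert (INR (length P - 1) * pnorm rho P <= rho * Rabs c / 2 * pnorm rho P)
        by (apply Rmult_le_compat_r; lra). lra. }
    assert (H5 : 2 / Rabs c * pnorm rho (pderiv P) <= pnorm rho P).
    { assert (E : 2 / Rabs c * (Rabs c / 2 * pnorm rho P) = pnorm rho P) by (field; lra).
      rewrite <- E. apply Rmult_le_compat_l; [apply Rle_mult_inv_pos; lra|exact H4]. }
    replace (2 / Rabs c * pnorm rho P) with (/ Rabs c * (2 * pnorm rho P)) by (field; lra).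
    apply Rmult_le_compat_l; [apply Rlt_le, Rinv_0_lt_compat; lra|lra].
Qed.

(** Each power of x is paid for by m powers of y, through y^m |x| <= rho s^m; the condition on the
    length ensures that y^k contains enough of them. *)
Lemma peval_pow_bound (m k : nat) (rho s y x : R) (P : list R) :
  0 <= rho -> 0 <= y <= s -> y ^ m * Rabs x <= rho * s ^ m ->
  (length P * m <= k + m)%nat ->
  y ^ k * Rabs (peval P x) <= s ^ k * pnorm rho P.
Proof.
  intros Hr Hy Hx. revert k. induction P as [|a P IH]; intros k Hk.
  - simpl. rewrite Rabs_R0. lra.
  - cbn [peval pnorm].
    assert (Hyk : 0 <= y ^ k <= s ^ k).
    { split; [apply pow_le; lra|apply pow_incr; lra]. }
    assert (H0 : y ^ k * Rabs (a + x * peval P x)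
                 <= y ^ k * Rabs a + y ^ k * Rabs x * Rabs (peval P x)).
    { rewrite Rmult_assoc, <- Rmult_plus_distr_l, <- Rabs_mult.
      apply Rmult_le_compat_l; [lra|apply Rabs_triang]. }
    assert (H1 : y ^ k * Rabs a <= s ^ k * Rabs a) by (apply Rmult_le_compat_r; [apply Rabs_pos|lra]).
    assert (H2 : y ^ k * Rabs x * Rabs (peval P x) <= s ^ k * (rho * pnorm rho P)).
    { destruct P as [|b P]; [simpl; rewrite Rabs_R0; lra|].
      set (P' := b :: P) in *.
      assert (Hkm : (m <= k)%nat) by (unfold P' in Hk; simpl in Hk; lia).
      replace k with ((k - m) + m)%nat by lia. rewrite !pow_add.
      specialize (IH (k - m)%nat ltac:(cbn [length] in Hk; lia)).
      replace (y ^ (k - m) * y ^ m * Rabs x * Rabs (peval P' x))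
        with ((y ^ (k - m) * Rabs (peval P' x)) * (y ^ m * Rabs x)) by ring.
      replace (s ^ (k - m) * s ^ m * (rho * pnorm rho P'))
        with ((s ^ (k - m) * pnorm rho P') * (rho * s ^ m)) by ring.
      apply Rmult_le_compat; auto.
      - apply Rmult_le_pos; [apply pow_le; lra|apply Rabs_pos].
      - apply Rmult_le_pos; [apply pow_le; lra|apply Rabs_pos]. }
    rewrite Rmult_plus_distr_l. lra.
Qed.

(** * The coefficients of the expansion *)

Fixpoint sum1 (h : nat -> R) (n : nat) : R :=
  match n with O => 0 | S n => sum1 h n + h (S n) end.

Fixpoint sum0 (h : nat -> R) (n : nat) : R :=
  match n with O => 0 | S n => sum0 h n + h n end.

Fixpoint psum1 (P : nat -> list R) (n : nat) : list R :=
  match n with O => [] | S n => padd (psum1 P n) (P (S n)) end.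

Lemma sum1_ext (h k : nat -> R) (n : nat) :
  (forall j, (1 <= j <= n)%nat -> h j = k j) -> sum1 h n = sum1 k n.
Proof.
  induction n as [|n IH]; intros E; [reflexivity|]. simpl.
  rewrite IH, E; [reflexivity|lia|intros; apply E; lia].
Qed.

Lemma sum1_le (h k : nat -> R) (n : nat) :
  (forall j, (1 <= j <= n)%nat -> h j <= k j) -> sum1 h n <= sum1 k n.
Proof.
  induction n as [|n IH]; intros E; simpl; [lra|].
  pose proof (E (S n) ltac:(lia)). pose proof (IH ltac:(intros; apply E; lia)). lra.
Qed.

Lemma sum1_plus (h k : nat -> R) (n : nat) : sum1 (fun j => h j + k j) n = sum1 h n + sum1 k n.
Proof. induction n as [|n IH]; simpl; [ring|rewrite IH; ring]. Qed.

Lemma sum1_scal (c : R) (h : nat -> R) (n : nat) : sum1 (fun j => c * h j) n = c * sum1 h n.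
Proof. induction n as [|n IH]; simpl; [ring|rewrite IH; ring]. Qed.

Lemma sum0_mono (h : nat -> R) (n k : nat) :
  (forall j, 0 <= h j) -> (n <= k)%nat -> sum0 h n <= sum0 h k.
Proof. intros Hh H. induction H as [|k _ IH]; simpl; [lra|]. pose proof (Hh k). lra. Qed.

Lemma sum0_sum1 (h : nat -> R) (n : nat) : sum0 h (S n) = h 0%nat + sum1 h n.
Proof.
  induction n as [|n IH]; [simpl; ring|].
  change (sum0 h (S (S n))) with (sum0 h (S n) + h (S n)). rewrite IH. simpl. ring.
Qed.

(** Exchange of summation over the triangle 1 <= j <= k <= n. *)
Lemma sum1_convolution (a b : nat -> R) (n : nat) :
  sum1 (fun k => sum1 (fun j => a j * b (k - j)%nat) k) n
  = sum1 (fun j => a j * sum0 b (S n - j)) n.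
Proof.
  induction n as [|n IH]; [reflexivity|].
  change (sum1 (fun k => sum1 (fun j => a j * b (k - j)%nat) k) (S n))
    with (sum1 (fun k => sum1 (fun j => a j * b (k - j)%nat) k) n
          + (sum1 (fun j => a j * b (S n - j)%nat) n + a (S n) * b (S n - S n)%nat)).
  rewrite IH.
  change (sum1 (fun j => a j * sum0 b (S (S n) - j)) (S n))
    with (sum1 (fun j => a j * sum0 b (S (S n) - j)) n + a (S n) * sum0 b (S (S n) - S n)).
  replace (S (S n) - S n)%nat with 1%nat by lia. replace (S n - S n)%nat with 0%nat by lia.
  rewrite <- Rplus_assoc, <- sum1_plus. f_equal; [|simpl; ring].
  apply sum1_ext. intros j Hj. replace (S (S n) - j)%nat with (S (S n - j)) by lia. simpl. ring.
Qed.

Lemma peval_psum1 (P : nat -> list R) (n : nat) (x : R) :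
  peval (psum1 P n) x = sum1 (fun j => peval (P j) x) n.
Proof. induction n as [|n IH]; simpl; [reflexivity|]. now rewrite peval_padd, IH. Qed.

Lemma pnorm_psum1 (rho : R) (P : nat -> list R) (n : nat) : 0 <= rho ->
  pnorm rho (psum1 P n) <= sum1 (fun j => pnorm rho (P j)) n.
Proof.
  intros Hr. induction n as [|n IH]; simpl; [lra|].
  eapply Rle_trans; [now apply pnorm_padd|]. lra.
Qed.

Lemma length_psum1 (P : nat -> list R) (n d : nat) :
  (forall j, (1 <= j <= n)%nat -> (length (P j) <= d)%nat) -> (length (psum1 P n) <= d)%nat.
Proof.
  induction n as [|n IH]; intros H; simpl; [lia|]. rewrite length_padd.
  pose proof (H (S n) ltac:(lia)). pose proof (IH ltac:(intros; apply H; lia)). lia.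
Qed.

Lemma psum1_ext (P Q : nat -> list R) (n : nat) :
  (forall j, (1 <= j <= n)%nat -> P j = Q j) -> psum1 P n = psum1 Q n.
Proof.
  induction n as [|n IH]; intros E; [reflexivity|]. simpl.
  rewrite IH, E; [reflexivity|lia|intros; apply E; lia].
Qed.

Section Recursion.

Variables (m : nat) (p kap b : R).
Hypothesis m_pos : (1 <= m)%nat.
Hypothesis p_range : 0 <= p <= 2.
Hypothesis kap_nonneg : 0 <= kap.

Definition bet : R := / INR m.
(** Chosen for [pnorm_pinv] at c = k/m - 1 with k > m: the requirement k/m <= rho c / 2 reads k <=
    (m + 1)(k - m), with equality at k = m + 1. *)
Definition rho : R := 2 * (INR m + 1).

(* Coefficient of x^(k bet) of the right-hand side [- kap y (1 - x) F], where
   y = x^bet and F = (1 + u)^(-p). *)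
Definition rhs_coef (F : nat -> list R) (k : nat) : list R :=
  pscal (- kap) (padd (F (k - 1)%nat)
    (if (m <? k)%nat then pscal (-1) (F (k - 1 - m)%nat) else [])).

(* At the resonance [k = m] the operator (D + 1) D (D - 1) annihilates the
   constant [b], which is the free parameter, and maps [ln x] to [2]. *)
Definition u_coef (F : nat -> list R) (k : nat) : list R :=
  if (k =? 0)%nat then [] else
  if (k =? m)%nat then [b; hd 0 (rhs_coef F k) / 2] else
  pinv (INR k * bet + 1) (pinv (INR k * bet) (pinv (INR k * bet - 1) (rhs_coef F k))).

(* Recursion for the coefficients of F, from (1 + u) E F = - p F E u with the
   weight derivation E = y d/dy at fixed ln x. *)
Definition F_step (F : nat -> list R) (k : nat) : list R :=
  pscal (- / INR k)
    (psum1 (fun j => pscal (p * INR j + INR (k - j)) (pmul (u_coef F j) (F (k - j)%nat))) k).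

(** Course-of-values recursion: the entry k of F depends on all earlier ones, also through the
    coefficients of u up to k, which themselves read F only below k. [F_table n] is meaningful up to
    n. *)
Fixpoint F_table (n : nat) : nat -> list R :=
  match n with
  | O => fun _ => [1]
  | S n' => fun k => if (k <=? n')%nat then F_table n' k else F_step (F_table n') k
  end.

Definition F_coef (k : nat) : list R := F_table k k.

Lemma F_table_stable (n k : nat) : (k <= n)%nat -> F_table n k = F_coef k.
Proof.
  intros H. induction H as [|n Hkn IH]; [reflexivity|].
  cbn [F_table]. rewrite (proj2 (Nat.leb_le k n) Hkn). exact IH.
Qed.

Lemma u_coef_ext (F G : nat -> list R) (k : nat) :
  (forall i, (i < k)%nat -> F i = G i) -> u_coef F k = u_coef G k.
Proof.
  intros E. unfold u_coef. destruct (Nat.eqb_spec k 0) as [->|Hk]; [reflexivity|].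
  assert (ER : rhs_coef F k = rhs_coef G k).
  { unfold rhs_coef. rewrite E by lia. destruct (Nat.ltb_spec m k); [|reflexivity].
    now rewrite E by lia. }
  now rewrite ER.
Qed.

Lemma F_coef_0 : F_coef 0 = [1].
Proof. reflexivity. Qed.

Lemma F_coef_S (k : nat) : F_coef (S k) = F_step F_coef (S k).
Proof.
  unfold F_coef at 1. cbn [F_table]. rewrite (proj2 (Nat.leb_gt (S k) k)) by lia.
  unfold F_step. f_equal. apply psum1_ext. intros j Hj. f_equal. f_equal.
  - apply u_coef_ext. intros i Hi. apply F_table_stable. lia.
  - apply F_table_stable. lia.
Qed.

Definition U_coef (k : nat) : list R := u_coef F_coef k.

Lemma U_coef_0 : U_coef 0 = [].
Proof. reflexivity. Qed.

Lemma INR_m_ge1 : 1 <= INR m.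
Proof. apply (le_INR 1). exact m_pos. Qed.

Lemma bet_pos : 0 < bet.
Proof. pose proof INR_m_ge1. unfold bet. apply Rinv_0_lt_compat. lra. Qed.

Lemma bet_le1 : bet <= 1.
Proof.
  pose proof INR_m_ge1. unfold bet. rewrite <- Rinv_1. apply Rinv_le_contravar; lra.
Qed.

Lemma m_bet : INR m * bet = 1.
Proof. pose proof INR_m_ge1. unfold bet. field. lra. Qed.

Lemma rho_ge4 : 4 <= rho.
Proof. pose proof INR_m_ge1. unfold rho. lra. Qed.

Lemma length_rhs_coef (F : nat -> list R) (k : nat) :
  (1 <= k)%nat -> (forall i, (i < k)%nat -> (length (F i) * m <= i + m)%nat) ->
  (length (rhs_coef F k) * m <= (k - 1) + m)%nat.
Proof.
  intros Hk H. unfold rhs_coef. rewrite length_pscal, length_padd.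
  pose proof (H (k - 1)%nat ltac:(lia)).
  destruct (Nat.ltb_spec m k).
  - rewrite length_pscal. pose proof (H (k - 1 - m)%nat ltac:(lia)).
    destruct (Nat.max_spec (length (F (k - 1)%nat)) (length (F (k - 1 - m)%nat)))
      as [(_ & ->)|(_ & ->)]; lia.
  - rewrite Nat.max_0_r. lia.
Qed.

Lemma length_u_coef (F : nat -> list R) (k : nat) :
  (forall i, (i < k)%nat -> (length (F i) * m <= i + m)%nat) ->
  (length (u_coef F k) * m <= k + m)%nat.
Proof.
  intros H. unfold u_coef. destruct (Nat.eqb_spec k 0) as [->|Hk]; [simpl; lia|].
  destruct (Nat.eqb_spec k m) as [->|Hkm]; [simpl; lia|].
  pose proof (length_rhs_coef F k ltac:(lia) H) as HR.
  pose proof (length_pinv (INR k * bet - 1) (rhs_coef F k)) as L1.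
  pose proof (length_pinv (INR k * bet) (pinv (INR k * bet - 1) (rhs_coef F k))) as L2.
  pose proof (length_pinv (INR k * bet + 1)
                (pinv (INR k * bet) (pinv (INR k * bet - 1) (rhs_coef F k)))) as L3.
  nia.
Qed.

(** The degree is at most k/m, a bound that is additive under products and holds for the
    coefficients of u as well. *)
Lemma length_F_coef (k : nat) : (length (F_coef k) * m <= k + m)%nat.
Proof.
  induction k as [k IH] using lt_wf_ind. destruct k as [|k]; [simpl; lia|].
  rewrite F_coef_S. unfold F_step. rewrite length_pscal.
  (* [length_psum1] wants a bound on the length itself; the rounded-down quotient provides it
     without loss. *)
  set (d := ((S k + m) / m)%nat).
  assert (Hd : forall l, (l * m <= S k + m)%nat -> (l <= d)%nat).
  { intros l Hl. apply Nat.div_le_lower_bound; lia. }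
  assert (Hd2 : (d * m <= S k + m)%nat).
  { unfold d. pose proof (Nat.Div0.mul_div_le (S k + m) m). lia. }
  eapply Nat.le_trans; [|exact Hd2]. apply Nat.mul_le_mono_r.
  apply length_psum1. intros j Hj. apply Hd. rewrite length_pscal.
  pose proof (length_pmul (u_coef F_coef j) (F_coef (S k - j))) as HM.
  pose proof (length_u_coef F_coef j ltac:(intros; apply IH; lia)) as HU.
  pose proof (IH (S k - j)%nat ltac:(lia)) as HF.
  destruct (Nat.max_spec (length (F_coef (S k - j))) 1) as [(_ & E)|(_ & E)]; rewrite E in HM; nia.
Qed.

Lemma length_U (k : nat) : (length (U_coef k) * m <= k + m)%nat.
Proof. apply length_u_coef. intros. apply length_F_coef. Qed.

Lemma pnorm_rhs_coef (F : nat -> list R) (k : nat) :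
  pnorm rho (rhs_coef F k)
  <= kap * (pnorm rho (F (k - 1)%nat) + if (m <? k)%nat then pnorm rho (F (k - 1 - m)%nat) else 0).
Proof.
  pose proof rho_ge4. unfold rhs_coef. rewrite pnorm_pscal, Rabs_Ropp, Rabs_right by lra.
  apply Rmult_le_compat_l; [exact kap_nonneg|].
  eapply Rle_trans; [apply pnorm_padd; lra|]. apply Rplus_le_compat_l.
  destruct (m <? k)%nat; [|simpl; lra]. rewrite pnorm_pscal, Rabs_left; lra.
Qed.

(** 8 m^3 comes from three inversions at a cost of 2 m each, rho from the coefficient of ln x at the
    resonance. *)
Definition u_const : R := kap * (8 * INR m ^ 3 + rho).

Lemma u_const_nonneg : 0 <= u_const.
Proof.
  pose proof rho_ge4. pose proof INR_m_ge1. unfold u_const.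
  apply Rmult_le_pos; [lra|]. assert (0 <= INR m ^ 3) by (apply pow_le; lra). lra.
Qed.

(** As |c| >= 1/m, one inversion costs at most 2 m. The first alternative bounds the degree, at most
    k/m, in terms of c; the second is used below the resonance, where the polynomials are
    constants. *)
Lemma pnorm_pinv_weight (c : R) (k : nat) (P : list R) :
  (length P * m <= k + m)%nat -> bet <= Rabs c ->
  INR k * bet <= rho * Rabs c / 2 \/ (length P <= 1)%nat ->
  pnorm rho (pinv c P) <= 2 * INR m * pnorm rho P.
Proof.
  intros HP Hc Hk. pose proof rho_ge4. pose proof bet_pos. pose proof INR_m_ge1.
  assert (c <> 0) by (intros ->; rewrite Rabs_R0 in Hc; lra).
  eapply Rle_trans; [apply pnorm_pinv; [lra|assumption|]|].
  - destruct Hk as [Hk|Hk].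
    + eapply Rle_trans; [|exact Hk].
      assert (HI : ((length P - 1) * m <= k)%nat) by nia.
      apply le_INR in HI. rewrite mult_INR in HI.
      apply (Rmult_le_compat_r bet) in HI; [|lra].
      rewrite Rmult_assoc, m_bet in HI. lra.
    + replace (length P - 1)%nat with 0%nat by lia. simpl.
      apply Rle_mult_inv_pos; [apply Rmult_le_pos|]; lra.
  - apply Rmult_le_compat_r; [apply pnorm_nonneg; lra|].
    replace (INR m) with (/ bet) by (unfold bet; field; lra).
    unfold Rdiv. apply Rmult_le_compat_l; [lra|]. apply Rinv_le_contravar; lra.
Qed.

Lemma pnorm_U (k : nat) : (1 <= k)%nat ->
  pnorm rho (U_coef k)
  <= u_const * (pnorm rho (F_coef (k - 1)%nat)
                + if (m <? k)%nat then pnorm rho (F_coef (k - 1 - m)%nat) else 0)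
     + (if (k =? m)%nat then Rabs b else 0).
Proof.
  intros Hk. pose proof rho_ge4 as Hr. pose proof bet_pos as Hb. pose proof INR_m_ge1 as Hm.
  set (A := pnorm rho (F_coef (k - 1)%nat)
             + if (m <? k)%nat then pnorm rho (F_coef (k - 1 - m)%nat) else 0).
  assert (HA : 0 <= A).
  { unfold A. pose proof (pnorm_nonneg rho (F_coef (k - 1)) ltac:(lra)).
    pose proof (pnorm_nonneg rho (F_coef (k - 1 - m)) ltac:(lra)). destruct (m <? k)%nat; lra. }
  pose proof (pnorm_rhs_coef F_coef k) as HR. fold A in HR.
  unfold U_coef, u_coef. destruct (Nat.eqb_spec k 0) as [E|_]; [lia|].
  destruct (Nat.eqb_spec k m) as [E|Hkm].
  - cbn [pnorm]. set (r := rhs_coef F_coef k) in *.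
    assert (Hhd : Rabs (hd 0 r) <= pnorm rho r).
    { destruct r as [|a r]; simpl; [rewrite Rabs_R0; lra|].
      pose proof (pnorm_nonneg rho r ltac:(lra)). nra. }
    unfold Rdiv. rewrite Rabs_mult, (Rabs_right (/ 2)) by lra.
    pose proof (pnorm_nonneg rho r ltac:(lra)).
    assert (0 <= INR m ^ 3) by (apply pow_le; lra).
    assert (0 <= kap * A) by (apply Rmult_le_pos; lra).
    assert (rho * (Rabs (hd 0 r) * / 2) <= rho * (kap * A)).
    { apply Rmult_le_compat_l; [lra|]. lra. }
    assert (0 <= 8 * INR m ^ 3 * (kap * A)) by (apply Rmult_le_pos; lra).
    unfold u_const. lra.
  - set (r := rhs_coef F_coef k) in *. rewrite Rplus_0_r.
    set (P1 := pinv (INR k * bet - 1) r). set (P2 := pinv (INR k * bet) P1).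
    assert (Lr : (length r * m <= (k - 1) + m)%nat).
    { apply length_rhs_coef; [exact Hk|]. intros; apply length_F_coef. }
    pose proof (length_pinv (INR k * bet - 1) r) as L1. fold P1 in L1.
    pose proof (length_pinv (INR k * bet) P1) as L2. fold P2 in L2.
    assert (Hk1 : 1 <= INR k) by (apply (le_INR 1); exact Hk).
    assert (Hkb : bet <= INR k * bet) by nra.
    assert (N1 : pnorm rho P1 <= 2 * INR m * pnorm rho r).
    { apply (pnorm_pinv_weight _ k); [lia| |].
      - destruct (Nat.lt_ge_cases k m) as [Hlt|Hge].
        + apply (le_INR (k + 1)) in Hlt || apply le_INR in Hlt.
          rewrite ?S_INR, ?plus_INR in Hlt. simpl in Hlt.
          pose proof m_bet. rewrite Rabs_left1; nra.
        + assert (Hge' : (m + 1 <= k)%nat) by lia. apply le_INR in Hge'.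
          rewrite plus_INR in Hge'. simpl in Hge'. pose proof m_bet.
          rewrite Rabs_right; nra.
      - destruct (Nat.lt_ge_cases k m) as [Hlt|Hge].
        + right. nia.
        + left. assert (Hge' : (m + 1 <= k)%nat) by lia. apply le_INR in Hge'.
          rewrite plus_INR in Hge'. simpl in Hge'. pose proof m_bet as Hmb.
          rewrite Rabs_right by nra. unfold rho.
          apply (Rmult_le_reg_r (INR m)); [lra|].
          replace (INR k * bet * INR m) with (INR k * (INR m * bet)) by ring.
          replace (2 * (INR m + 1) * (INR k * bet - 1) / 2 * INR m)
            with ((INR m + 1) * (INR k * (INR m * bet) - INR m)) by field.
          rewrite Hmb. nra. }
    assert (N2 : pnorm rho P2 <= 2 * INR m * pnorm rho P1).
    { apply (pnorm_pinv_weight _ k); [nia| |left]; rewrite Rabs_right by lra; [lra|]. nra. }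
    assert (N3 : pnorm rho (pinv (INR k * bet + 1) P2) <= 2 * INR m * pnorm rho P2).
    { apply (pnorm_pinv_weight _ k); [nia| |left]; rewrite Rabs_right by lra; [lra|]. nra. }
    assert (M2 : 2 * INR m * pnorm rho P1 <= 2 * INR m * (2 * INR m * pnorm rho r)).
    { apply Rmult_le_compat_l; lra. }
    assert (M3 : 2 * INR m * pnorm rho P2 <= 2 * INR m * (2 * INR m * (2 * INR m * pnorm rho r))).
    { apply Rmult_le_compat_l; lra. }
    assert (M4 : 8 * INR m ^ 3 * pnorm rho r <= 8 * INR m ^ 3 * (kap * A)).
    { apply Rmult_le_compat_l; [|exact HR]. assert (0 <= INR m ^ 3) by (apply pow_le; lra). lra. }
    assert (0 <= rho * (kap * A)) by (apply Rmult_le_pos; [lra|apply Rmult_le_pos; lra]).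
    unfold u_const. fold P2. fold P1 in N3. simpl pow in M4 |- *. lra.
Qed.

(** Since p <= 2, the weights p j + (k + 1 - j) are at most 2 (k + 1), which cancels the division by
    k + 1. *)
Lemma pnorm_F_coef_S (k : nat) :
  pnorm rho (F_coef (S k))
  <= 2 * sum1 (fun j => pnorm rho (U_coef j) * pnorm rho (F_coef (S k - j))) (S k).
Proof.
  pose proof rho_ge4 as Hr. rewrite F_coef_S. unfold F_step.
  assert (HSk : 0 < INR (S k)) by (apply lt_0_INR; lia).
  rewrite pnorm_pscal, Rabs_Ropp, Rabs_right by (apply Rle_ge, Rlt_le, Rinv_0_lt_compat; lra).
  apply (Rmult_le_reg_l (INR (S k))); [exact HSk|].
  rewrite <- Rmult_assoc, Rinv_r, Rmult_1_l by lra.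
  eapply Rle_trans; [apply pnorm_psum1; lra|]. rewrite <- Rmult_assoc, <- sum1_scal.
  apply sum1_le. intros j Hj. rewrite pnorm_pscal.
  pose proof (pos_INR j). pose proof (pos_INR (S k - j)).
  rewrite Rabs_right by nra.
  pose proof (pnorm_pmul rho (u_coef F_coef j) (F_coef (S k - j)) ltac:(lra)) as HM.
  fold (U_coef j) in *.
  pose proof (pnorm_nonneg rho (U_coef j) ltac:(lra)).
  pose proof (pnorm_nonneg rho (F_coef (S k - j)) ltac:(lra)).
  pose proof (pnorm_nonneg rho (pmul (U_coef j) (F_coef (S k - j))) ltac:(lra)).
  assert (HI : INR (S k) = INR j + INR (S k - j)) by (rewrite <- plus_INR; f_equal; lia).
  apply Rmult_le_compat; [nra|assumption|nra|exact HM].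
Qed.

(** The constants close a bootstrap: if the F-terms sum to at most 2, the U-terms sum to at most s
    (4 u_const + |b|) <= 1/4, and the recursion for F returns 1 + 2 (1/4) 2 = 2. *)
Definition small_radius (s : R) : Prop := 0 < s <= 1 /\ s * (4 * u_const + Rabs b) <= 1 / 4.

Lemma small_radius_exists : exists s, small_radius s.
Proof.
  pose proof u_const_nonneg. pose proof (Rabs_pos b).
  set (K := 4 * (4 * u_const + Rabs b) + 1). exists (/ K).
  assert (HK : 1 <= K) by (unfold K; lra).
  assert (Hi : 0 < / K) by (apply Rinv_0_lt_compat; lra).
  assert (Hi2 : / K * K = 1) by (apply Rinv_l; lra).
  split; [split; nra|]. unfold K in Hi2 at 2. lra.
Qed.

(** * Majorant bounds for the coefficients *)

Section Bounds.

Variable s : R.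
Hypothesis s_small : small_radius s.

Let f (k : nat) : R := pnorm rho (F_coef k) * s ^ k.
Let g (k : nat) : R := pnorm rho (U_coef k) * s ^ k.

Lemma F_term_nonneg (k : nat) : 0 <= f k.
Proof.
  pose proof rho_ge4. destruct s_small as ((? & _) & _).
  apply Rmult_le_pos; [apply pnorm_nonneg; lra|apply pow_le; lra].
Qed.

Lemma U_term_nonneg (k : nat) : 0 <= g k.
Proof.
  pose proof rho_ge4. destruct s_small as ((? & _) & _).
  apply Rmult_le_pos; [apply pnorm_nonneg; lra|apply pow_le; lra].
Qed.

Lemma sum1_shift (n : nat) : sum1 (fun k => pnorm rho (F_coef (k - 1)%nat) * s ^ k) n = s * sum0 f n.
Proof.
  induction n as [|n IH]; simpl; [ring|]. rewrite IH, Nat.sub_0_r. unfold f. ring.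
Qed.

Lemma sum1_shift_m (n : nat) :
  sum1 (fun k => (if (m <? k)%nat then pnorm rho (F_coef (k - 1 - m)%nat) else 0) * s ^ k) n
  = s ^ S m * sum0 f (n - m).
Proof.
  induction n as [|n IH]; [simpl; ring|]. cbn [sum1]. rewrite IH.
  destruct (Nat.ltb_spec m (S n)) as [Hlt|Hge].
  - replace (S n - m)%nat with (S (n - m)) by lia. cbn [sum0]. unfold f.
    replace (S n - 1 - m)%nat with (n - m)%nat by lia.
    replace (s ^ S n) with (s ^ S m * s ^ (n - m)) by (rewrite <- pow_add; f_equal; lia). ring.
  - replace (S n - m)%nat with 0%nat by lia. replace (n - m)%nat with 0%nat by lia. simpl. ring.
Qed.

Lemma sum1_resonant (n : nat) :
  sum1 (fun k => (if (k =? m)%nat then Rabs b else 0) * s ^ k) n <= s * Rabs b.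
Proof.
  destruct s_small as ((Hs & Hs1) & _). pose proof (Rabs_pos b).
  assert (E : sum1 (fun k => (if (k =? m)%nat then Rabs b else 0) * s ^ k) n
              = if (m <=? n)%nat then Rabs b * s ^ m else 0).
  { induction n as [|n IH].
    - simpl. destruct (Nat.leb_spec m 0); [lia|reflexivity].
    - cbn [sum1]. rewrite IH. destruct (Nat.eqb_spec (S n) m) as [E|E].
      + rewrite <- E. rewrite (proj2 (Nat.leb_gt (S n) n)), (proj2 (Nat.leb_le (S n) (S n))) by lia.
        ring.
      + destruct (Nat.leb_spec m n), (Nat.leb_spec m (S n)); try lia; ring. }
  rewrite E. assert (s ^ m <= s).
  { replace m with (S (m - 1)) by lia. simpl.
    assert (s ^ (m - 1) <= 1) by (rewrite <- (pow1 (m - 1)); apply pow_incr; lra).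
    assert (0 <= s ^ (m - 1)) by (apply pow_le; lra). nra. }
  destruct (m <=? n)%nat; nra.
Qed.

(** The shifts by 1 and by m + 1 cost s and s^(m+1), the resonant term s^m; as s <= 1, each is at
    most s. *)
Lemma sum1_U_term (n : nat) : sum1 g n <= s * (2 * u_const * sum0 f n + Rabs b).
Proof.
  destruct s_small as ((Hs & Hs1) & _). pose proof u_const_nonneg as Hu.
  assert (H1 : sum1 g n <= sum1 (fun k =>
     u_const * (pnorm rho (F_coef (k - 1)%nat) * s ^ k)
     + u_const * ((if (m <? k)%nat then pnorm rho (F_coef (k - 1 - m)%nat) else 0) * s ^ k)
     + (if (k =? m)%nat then Rabs b else 0) * s ^ k) n).
  { apply sum1_le. intros j Hj. unfold g. pose proof (pnorm_U j ltac:(lia)) as HU.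
    assert (0 <= s ^ j) by (apply pow_le; lra).
    apply (Rmult_le_compat_r (s ^ j)) in HU; [|assumption]. lra. }
  rewrite !sum1_plus, !sum1_scal, sum1_shift, sum1_shift_m in H1.
  pose proof (sum1_resonant n) as H2.
  assert (H3 : sum0 f (n - m) <= sum0 f n) by (apply sum0_mono; [apply F_term_nonneg|lia]).
  assert (H4 : 0 <= sum0 f (n - m)) by (apply (sum0_mono f 0); [apply F_term_nonneg|lia]).
  assert (H5 : s ^ S m <= s).
  { simpl. assert (s ^ m <= 1) by (rewrite <- (pow1 m); apply pow_incr; lra).
    assert (0 <= s ^ m) by (apply pow_le; lra). nra. }
  assert (H6 : 0 <= s ^ S m) by (apply pow_le; lra).
  assert (s ^ S m * sum0 f (n - m) <= s * sum0 f n) by (apply Rmult_le_compat; lra).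
  assert (u_const * (s ^ S m * sum0 f (n - m)) <= u_const * (s * sum0 f n))
    by (apply Rmult_le_compat_l; lra).
  lra.
Qed.

(** Induction on n: the U-terms up to weight n involve F-terms of weight below n only, so the bound
    for n gives the one for n + 1. Being uniform in n, it proves convergence. *)
Lemma sum0_F_term_le (n : nat) : sum0 f n <= 2.
Proof.
  destruct s_small as ((Hs & Hs1) & Hb). pose proof u_const_nonneg as Hu.
  induction n as [|n IH]; [simpl; lra|].
  rewrite sum0_sum1.
  assert (Hf0 : f 0 = 1) by (unfold f; rewrite F_coef_0; simpl; rewrite Rabs_R1; ring).
  rewrite Hf0.
  assert (H1 : sum1 f n <= 2 * sum1 (fun k => sum1 (fun j => g j * f (k - j)%nat) k) n).
  { rewrite <- sum1_scal. apply sum1_le. intros k Hk. destruct k as [|k]; [lia|].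
    unfold f at 1. pose proof (pnorm_F_coef_S k) as HF.
    assert (Hp : 0 <= s ^ S k) by (apply pow_le; lra).
    apply (Rmult_le_compat_r (s ^ S k)) in HF; [|exact Hp].
    eapply Rle_trans; [exact HF|]. apply Req_le. rewrite Rmult_assoc. f_equal.
    rewrite Rmult_comm, <- sum1_scal. apply sum1_ext. intros j Hj. unfold g, f.
    replace (s ^ S k) with (s ^ j * s ^ (S k - j)) by (rewrite <- pow_add; f_equal; lia). ring. }
  rewrite sum1_convolution in H1.
  assert (H2 : sum1 (fun j => g j * sum0 f (S n - j)) n <= sum1 (fun j => 2 * g j) n).
  { apply sum1_le. intros j Hj. pose proof (U_term_nonneg j).
    assert (sum0 f (S n - j) <= sum0 f n) by (apply sum0_mono; [apply F_term_nonneg|lia]). nra. }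
  rewrite sum1_scal in H2. pose proof (sum1_U_term n) as H3.
  assert (u_const * sum0 f n <= u_const * 2) by (apply Rmult_le_compat_l; lra).
  assert (s * (2 * u_const * sum0 f n + Rabs b) <= s * (4 * u_const + Rabs b))
    by (apply Rmult_le_compat_l; lra).
  lra.
Qed.

Lemma sum1_U_term_le (n : nat) : sum1 g n <= 1 / 4.
Proof.
  destruct s_small as ((Hs & Hs1) & Hb). pose proof u_const_nonneg as Hu.
  pose proof (sum1_U_term n) as H3. pose proof (sum0_F_term_le n).
  assert (u_const * sum0 f n <= u_const * 2) by (apply Rmult_le_compat_l; lra).
  assert (s * (2 * u_const * sum0 f n + Rabs b) <= s * (4 * u_const + Rabs b))
    by (apply Rmult_le_compat_l; lra).
  lra.
Qed.

End Bounds.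

End Recursion.

(** * Termwise differentiation *)

Lemma ex_series_dominated (a M : nat -> R) :
  (forall k, Rabs (a k) <= M k) -> ex_series M -> ex_series a.
Proof. intros H HM. exact (@ex_series_le R_AbsRing R_CompleteNormedModule a M H HM). Qed.

Lemma Series_abs_le (a M : nat -> R) :
  (forall k, Rabs (a k) <= M k) -> ex_series M -> Rabs (Series a) <= Series M.
Proof.
  intros H HM. eapply Rle_trans.
  - apply Series_Rabs. apply (ex_series_dominated _ M); [|exact HM].
    intros k. now rewrite Rabs_Rabsolu.
  - apply Series_le; [|exact HM]. intros k. split; [apply Rabs_pos|apply H].
Qed.

Lemma Series_nonneg (a : nat -> R) : (forall k, 0 <= a k) -> ex_series a -> 0 <= Series a.
Proof.
  intros Ha Hex. rewrite <- (Rmult_0_l (Series a)), <- Series_scal_l.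
  apply Series_le; [|exact Hex]. intros k. specialize (Ha k). lra.
Qed.

Lemma Series_tail_le (a M : nat -> R) (n : nat) :
  (forall k, Rabs (a k) <= M k) -> ex_series M ->
  Rabs (Series a - sum_f_R0 a n) <= Series M - sum_f_R0 M n.
Proof.
  intros H HM.
  rewrite (Series_incr_n a (S n)), (Series_incr_n M (S n)); try lia; auto.
  2: { now apply (ex_series_dominated _ M). }
  simpl pred.
  match goal with |- Rabs (?x + ?y - ?x) <= ?u + ?v - ?u =>
    replace (x + y - x) with y by ring; replace (u + v - u) with v by ring end.
  apply Series_abs_le; [intros; apply H|].
  now apply (ex_series_incr_n M (S n)).
Qed.

Lemma Series_cv (a : nat -> R) : ex_series a -> Un_cv (sum_f_R0 a) (Series a).
Proof. intros H. apply is_series_Reals. now apply Series_correct. Qed.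

Lemma sum_f_R0_derivable (t d : nat -> R -> R) (x : R) (n : nat) :
  (forall k, is_derive (t k) x (d k x)) ->
  is_derive (fun y => sum_f_R0 (fun k => t k y) n) x (sum_f_R0 (fun k => d k x) n).
Proof.
  intros H. induction n as [|n IH]; [apply H|]. simpl. now apply is_derive_Rplus.
Qed.

(** One majorant serves the terms and their derivatives. The functions e make each d k continuous,
    so that the uniform limit of the derived partial sums is continuous too. *)
Lemma is_derive_Series (t d e : nat -> R -> R) (M : nat -> R) (T : R) :
  ex_series M ->
  (forall k x, x < T -> is_derive (t k) x (d k x)) ->
  (forall k x, x < T -> is_derive (d k) x (e k x)) ->
  (forall k x, x < T -> Rabs (t k x) <= M k) ->
  (forall k x, x < T -> Rabs (d k x) <= M k) ->
  forall x, x < T ->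
    is_derive (fun y => Series (fun k => t k y)) x (Series (fun k => d k x)).
Proof.
  intros HM Ht Hd Bt Bd x Hx. apply is_derive_Reals.
  assert (Hr : 0 < T - x) by lra. set (r := mkposreal _ Hr).
  assert (HB : forall y, Boule x r y -> y < T).
  { intros y Hy. unfold Boule in Hy. simpl in Hy. apply Rabs_def2 in Hy. lra. }
  assert (Hu : CVU (fun n y => sum_f_R0 (fun k => d k y) n) (fun y => Series (fun k => d k y)) x r).
  { intros eps Heps. destruct (Series_cv M HM eps Heps) as (N & HN).
    exists N. intros n y Hn Hy. eapply Rle_lt_trans; [apply (Series_tail_le _ M)|].
    - intros k. apply Bd. now apply HB.
    - exact HM.
    - specialize (HN n Hn). unfold Rdist in HN. rewrite Rabs_minus_sym in HN.
      eapply Rle_lt_trans; [apply Rle_abs|exact HN]. }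
  apply (Ranalysis5.derivable_pt_lim_CVU
           (fun n y => sum_f_R0 (fun k => t k y) n) (fun n y => sum_f_R0 (fun k => d k y) n)
           (fun y => Series (fun k => t k y)) (fun y => Series (fun k => d k y)) x x r).
  - unfold Boule. rewrite Rminus_diag, Rabs_R0. apply cond_pos.
  - intros y n Hy. apply is_derive_Reals. apply sum_f_R0_derivable.
    intros k. apply Ht. now apply HB.
  - intros y Hy. apply Series_cv. apply (ex_series_dominated _ M); [|exact HM].
    intros k. apply Bt. now apply HB.
  - exact Hu.
  - intros y Hy. apply (CVU_continuity _ _ _ _ Hu); [|exact Hy].
    intros n z Hz. eapply is_derive_continuity_pt, (sum_f_R0_derivable d e).
    intros k. apply Hd. now apply HB.
Qed.

Lemma sum1_sum_f_R0 (h : nat -> R) (n : nat) : sum_f_R0 h n = h 0%nat + sum1 h n.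
Proof. induction n as [|n IH]; simpl; [ring|]. rewrite IH. ring. Qed.

Lemma ex_series_of_bounded (a : nat -> R) (B : R) :
  (forall k, 0 <= a k) -> (forall n, sum_f_R0 a n <= B) ->
  ex_series a /\ Series a <= B.
Proof.
  intros Ha HB.
  assert (Hinc : forall n, sum_n a n <= sum_n a (S n)).
  { intros n. rewrite sum_Sn. unfold plus; simpl. specialize (Ha (S n)). lra. }
  assert (HB' : forall n, sum_n a n <= B) by (intros n; rewrite sum_n_Reals; apply HB).
  destruct (ex_finite_lim_seq_incr (sum_n a) B Hinc HB') as (l & Hl).
  assert (Hs : is_series a l) by exact Hl.
  split; [now exists l|]. rewrite (is_series_unique _ _ Hs).
  apply (is_lim_seq_le _ _ (Finite l) (Finite B) HB' Hl (is_lim_seq_const B)).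
Qed.

Lemma exp_pow_nat (x : R) (n : nat) : exp x ^ n = exp (INR n * x).
Proof.
  induction n as [|n IH]; [simpl; now rewrite Rmult_0_l, exp_0|].
  rewrite S_INR, <- tech_pow_Rmult, IH, <- exp_plus. f_equal. ring.
Qed.

Lemma exp_decay (beta e : R) (N : nat) : 0 < beta <= 1 -> (1 <= N)%nat -> 0 < e ->
  exists T, T < 0 /\ forall t, t < T -> exp (beta * t) * (1 + Rabs t) ^ N < e.
Proof.
  intros Hb HN He.
  assert (HN1 : 1 <= INR N) by (apply (le_INR 1); exact HN).
  (* With this K, the inequality 1 + z <= exp z at z = |t|/K bounds (1 + |t|)^N by K^N exp(beta |t|
     / 2), which leaves half of the exponential decay. *)
  set (K := 2 * INR N / beta).
  assert (HK : 1 <= K).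
  { unfold K. apply (Rmult_le_reg_r beta); [lra|]. unfold Rdiv.
    rewrite Rmult_assoc, Rinv_l by lra. lra. }
  assert (HKN : 0 < K ^ N) by (apply pow_lt; lra).
  set (z := 2 * K ^ N / (beta * e)).
  assert (Hz : 0 < z) by (apply Rdiv_lt_0_compat; nra).
  exists (- z). split; [lra|]. intros t Ht.
  rewrite Rabs_left by lra.
  assert (H1 : 1 + - t <= K * exp (- t / K)).
  { pose proof (exp_ineq1_le (- t / K)) as Hexp.
    assert (K * (1 + - t / K) = K + - t) by (field; lra).
    assert (K * (1 + - t / K) <= K * exp (- t / K)) by (apply Rmult_le_compat_l; lra). lra. }
  assert (H2 : (1 + - t) ^ N <= K ^ N * exp (- (beta * t) / 2)).
  { eapply Rle_trans; [apply pow_incr; split; [lra|exact H1]|].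
    rewrite Rpow_mult_distr. apply Rmult_le_compat_l; [lra|].
    rewrite exp_pow_nat. apply Req_le. f_equal. unfold K. field. lra. }
  assert (H3 : exp (beta * t) * (1 + - t) ^ N <= K ^ N * exp (beta * t / 2)).
  { eapply Rle_trans; [apply Rmult_le_compat_l; [apply Rlt_le, exp_pos|exact H2]|].
    apply Req_le. replace (beta * t / 2) with (beta * t + - (beta * t) / 2) by field.
    rewrite exp_plus. ring. }
  eapply Rle_lt_trans; [exact H3|].
  assert (H4 : exp (beta * t / 2) * (1 + - (beta * t / 2)) <= 1).
  { pose proof (exp_ineq1_le (- (beta * t / 2))) as Hexp.
    pose proof (exp_pos (beta * t / 2)).
    assert (E : exp (beta * t / 2) * exp (- (beta * t / 2)) = 1).
    { rewrite <- exp_plus, Rplus_opp_r. apply exp_0. }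
    rewrite <- E at 2. apply Rmult_le_compat_l; lra. }
  pose proof (exp_pos (beta * t / 2)) as Hp.
  assert (H5 : K ^ N < e * (1 + - (beta * t / 2))).
  { assert (beta * e * z = 2 * K ^ N) by (unfold z; field; lra).
    assert (beta * e * z < beta * e * - t) by (apply Rmult_lt_compat_l; nra). nra. }
  apply (Rmult_lt_compat_r (exp (beta * t / 2))) in H5; [|exact Hp].
  assert (e * (exp (beta * t / 2) * (1 + - (beta * t / 2))) <= e * 1)
    by (apply Rmult_le_compat_l; lra).
  lra.
Qed.

(** * Summing the expansion *)

Definition yexp (m : nat) (t : R) : R := exp (bet m * t).

(** A common majorant in t = ln x: it dominates x^beta, and its m-th power dominates x |ln x|, so
    its smallness controls every term of the expansion. *)
Definition sig_log (m : nat) (t : R) : R := yexp m t * (1 + Rabs t).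

Definition vterm (m : nat) (P : nat -> list R) (k : nat) (t : R) : R :=
  yexp m t ^ k * peval (P k) t.

Definition vsum (m : nat) (P : nat -> list R) (t : R) : R := Series (fun k => vterm m P k t).

Definition Dcoef (m : nat) (P : nat -> list R) (k : nat) : list R :=
  padd (pscal (INR k * bet m) (P k)) (pderiv (P k)).

Definition graded (m : nat) (P : nat -> list R) : Prop :=
  forall k, (length (P k) * m <= k + m)%nat.

Lemma yexp_pow_m (m : nat) (t : R) : (1 <= m)%nat -> yexp m t ^ m = exp t.
Proof.
  intros Hm. unfold yexp. rewrite exp_pow_nat. f_equal.
  rewrite <- Rmult_assoc, m_bet by exact Hm. ring.
Qed.

Lemma yexp_pos (m : nat) (t : R) : 0 < yexp m t.
Proof. apply exp_pos. Qed.

Lemma yexp_le_sig_log (m : nat) (t : R) : yexp m t <= sig_log m t.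
Proof. unfold sig_log. pose proof (yexp_pos m t). pose proof (Rabs_pos t). nra. Qed.

Lemma yexp_pow_m_sigma (m : nat) (t : R) : (1 <= m)%nat ->
  yexp m t ^ m * Rabs t <= rho m * sig_log m t ^ m.
Proof.
  intros Hm. pose proof (rho_ge4 m Hm). unfold sig_log. rewrite Rpow_mult_distr.
  pose proof (pow_lt (yexp m t) m (yexp_pos m t)) as Hy.
  assert (H1 : Rabs t <= (1 + Rabs t) ^ m).
  { replace m with (S (m - 1)) by lia. simpl. pose proof (Rabs_pos t).
    assert (1 <= (1 + Rabs t) ^ (m - 1)) by (apply pow_R1_Rle; lra). nra. }
  pose proof (Rabs_pos t).
  assert (yexp m t ^ m * Rabs t <= yexp m t ^ m * (1 + Rabs t) ^ m)
    by (apply Rmult_le_compat_l; lra).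
  assert (0 <= yexp m t ^ m * (1 + Rabs t) ^ m) by (apply Rmult_le_pos; lra). nra.
Qed.

Lemma vterm_bound (m : nat) (P : nat -> list R) (k : nat) (t : R) :
  (1 <= m)%nat -> graded m P ->
  Rabs (vterm m P k t) <= sig_log m t ^ k * pnorm (rho m) (P k).
Proof.
  intros Hm HP. unfold vterm. pose proof (rho_ge4 m Hm).
  rewrite Rabs_mult, (Rabs_right (yexp m t ^ k)).
  2: { apply Rle_ge, pow_le, Rlt_le, yexp_pos. }
  apply (peval_pow_bound m); [lra| | |apply HP].
  - split; [apply Rlt_le, yexp_pos|apply yexp_le_sig_log].
  - now apply yexp_pow_m_sigma.
Qed.

Lemma is_derive_vterm (m : nat) (P : nat -> list R) (k : nat) (t : R) :
  is_derive (vterm m P k) t (vterm m (Dcoef m P) k t).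
Proof.
  assert (Hy : is_derive (fun t => yexp m t ^ k) t (INR k * bet m * yexp m t ^ k)).
  { apply (is_derive_ext (fun t => exp (INR k * (bet m * t)))).
    { intros u. unfold yexp. now rewrite exp_pow_nat. }
    eapply is_derive_eq.
    - apply (is_derive_Rcomp exp (fun t => INR k * (bet m * t))); [apply is_derive_exp|].
      derive_as. reflexivity.
    - unfold yexp. rewrite exp_pow_nat. ring. }
  eapply is_derive_eq.
  - apply (is_derive_Rmult (fun t => yexp m t ^ k) (peval (P k))); [exact Hy|].
    apply is_derive_peval.
  - unfold vterm, Dcoef. rewrite peval_padd, peval_pscal. ring.
Qed.

Lemma graded_Dcoef (m : nat) (P : nat -> list R) : graded m P -> graded m (Dcoef m P).
Proof.
  intros HP k. unfold Dcoef. rewrite length_padd, length_pscal, length_pderiv.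
  specialize (HP k). rewrite Nat.max_l by lia. exact HP.
Qed.

Lemma pnorm_Dcoef (m : nat) (P : nat -> list R) (k : nat) : (1 <= m)%nat -> graded m P ->
  pnorm (rho m) (Dcoef m P k) <= 2 * INR k * pnorm (rho m) (P k).
Proof.
  intros Hm HP. pose proof (rho_ge4 m Hm) as Hr. pose proof (bet_pos m Hm). pose proof (bet_le1 m Hm).
  pose proof (pos_INR k) as Hk. pose proof (pnorm_nonneg (rho m) (P k) ltac:(lra)) as Hn.
  unfold Dcoef. eapply Rle_trans; [apply pnorm_padd; lra|].
  rewrite pnorm_pscal, Rabs_right by nra.
  pose proof (pnorm_pderiv (rho m) (P k) ltac:(lra)) as H1.
  pose proof (pnorm_nonneg (rho m) (pderiv (P k)) ltac:(lra)) as H2.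
  assert (H3 : INR (length (P k) - 1) <= INR k) by (apply le_INR; specialize (HP k); nia).
  assert (INR k * bet m * pnorm (rho m) (P k) <= INR k * pnorm (rho m) (P k))
    by (apply Rmult_le_compat_r; nra).
  assert (INR (length (P k) - 1) * pnorm (rho m) (P k) <= INR k * pnorm (rho m) (P k))
    by (apply Rmult_le_compat_r; lra).
  nra.
Qed.

Lemma INR_le_pow2 (k : nat) : INR k <= 2 ^ k.
Proof.
  induction k as [|k IH]; [simpl; lra|]. rewrite S_INR. simpl.
  assert (1 <= 2 ^ k) by (apply pow_R1_Rle; lra). lra.
Qed.

Section Sum.

Variables (m : nat) (p kap b s : R).
Hypothesis m_pos : (1 <= m)%nat.
Hypothesis p_range : 0 <= p <= 2.
Hypothesis kap_nonneg : 0 <= kap.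
Hypothesis s_small : small_radius m kap b s.

Let Uc : nat -> list R := U_coef m p kap b.
Let Fc : nat -> list R := F_coef m p kap b.
Let g (k : nat) : R := pnorm (rho m) (Uc k) * s ^ k.
Let f (k : nat) : R := pnorm (rho m) (Fc k) * s ^ k.

(** The factor 8 of room pays for the derivatives of the series and later puts x^beta strictly
    inside a disk of convergence. *)
Definition in_domain (t : R) : Prop := sig_log m t <= s / 8.

Lemma U_terms_summable : ex_series g /\ Series g <= 1 / 4.
Proof.
  apply ex_series_of_bounded.
  - intros k. now apply (U_term_nonneg m p kap b).
  - intros n. rewrite sum1_sum_f_R0. unfold g at 1. unfold Uc. rewrite U_coef_0. cbn [pnorm].
    rewrite Rmult_0_l, Rplus_0_l. now apply sum1_U_term_le.
Qed.

Lemma F_terms_summable : ex_series f /\ Series f <= 2.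
Proof.
  apply ex_series_of_bounded.
  - intros k. now apply (F_term_nonneg m p kap b).
  - intros n. rewrite sum1_sum_f_R0.
    pose proof (sum0_F_term_le m p kap b m_pos p_range kap_nonneg s s_small (S n)) as H.
    rewrite sum0_sum1 in H. exact H.
Qed.

(* The factor 8^k absorbs the polynomial growth (2k)^j, j <= 3, caused by up to three
   applications of D. *)
Definition dominated (P : nat -> list R) : Prop :=
  graded m P /\ forall k, pnorm (rho m) (P k) * (s / 8) ^ k <= 8 * g k.

Lemma dominated_iter (P : nat -> list R) (j : nat) : (j <= 3)%nat -> graded m P ->
  (forall k, pnorm (rho m) (P k) <= (2 * INR k) ^ j * pnorm (rho m) (Uc k)) -> dominated P.
Proof.
  intros Hj HG HP. split; [exact HG|]. intros k.
  destruct s_small as ((Hs & _) & _). pose proof (rho_ge4 m m_pos) as Hr.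
  pose proof (pnorm_nonneg (rho m) (Uc k) ltac:(lra)) as H0.
  assert (Hpk : (2 * INR k) ^ j <= 8 * 8 ^ k).
  { pose proof (INR_le_pow2 k) as H2. pose proof (pos_INR k).
    assert (H1 : 1 <= 2 * 2 ^ k) by (pose proof (pow_R1_Rle 2 k ltac:(lra)); lra).
    apply Rle_trans with ((2 * 2 ^ k) ^ j); [apply pow_incr; lra|].
    apply Rle_trans with ((2 * 2 ^ k) ^ 3); [apply Rle_pow; [exact H1|exact Hj]|].
    apply Req_le. rewrite Rpow_mult_distr, <- pow_mult, Nat.mul_comm, pow_mult.
    replace (2 ^ 3) with 8 by ring. reflexivity. }
  assert (Hs8 : 0 < (s / 8) ^ k) by (apply pow_lt; lra).
  specialize (HP k).
  assert (pnorm (rho m) (P k) <= 8 * 8 ^ k * pnorm (rho m) (Uc k)).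
  { eapply Rle_trans; [exact HP|]. now apply Rmult_le_compat_r. }
  apply Rle_trans with (8 * 8 ^ k * pnorm (rho m) (Uc k) * (s / 8) ^ k).
  - apply Rmult_le_compat_r; lra.
  - apply Req_le. unfold g. replace (s ^ k) with (8 ^ k * (s / 8) ^ k); [ring|].
    rewrite <- Rpow_mult_distr. f_equal. field.
Qed.

Definition DU1 : nat -> list R := Dcoef m Uc.
Definition DU2 : nat -> list R := Dcoef m DU1.
Definition DU3 : nat -> list R := Dcoef m DU2.

Lemma graded_U : graded m Uc.
Proof. intros k. now apply length_U. Qed.

Lemma dominated_U : dominated Uc.
Proof.
  apply (dominated_iter _ 0); [lia|apply graded_U|]. intros k. rewrite pow_O. lra.
Qed.

Lemma dominated_D1 : dominated DU1.
Proof.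
  apply (dominated_iter _ 1); [lia|apply graded_Dcoef, graded_U|].
  intros k. rewrite pow_1. apply pnorm_Dcoef; [exact m_pos|apply graded_U].
Qed.

Lemma pnorm_D2 (k : nat) : pnorm (rho m) (DU2 k) <= (2 * INR k) ^ 2 * pnorm (rho m) (Uc k).
Proof.
  eapply Rle_trans; [apply pnorm_Dcoef; [exact m_pos|apply graded_Dcoef, graded_U]|].
  pose proof (pnorm_Dcoef m Uc k m_pos graded_U). pose proof (pos_INR k).
  replace ((2 * INR k) ^ 2 * pnorm (rho m) (Uc k))
    with (2 * INR k * (2 * INR k * pnorm (rho m) (Uc k))) by ring.
  apply Rmult_le_compat_l; [lra|assumption].
Qed.

Lemma dominated_D2 : dominated DU2.
Proof.
  apply (dominated_iter _ 2); [lia|apply graded_Dcoef, graded_Dcoef, graded_U|apply pnorm_D2].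
Qed.

Lemma dominated_D3 : dominated DU3.
Proof.
  apply (dominated_iter _ 3); [lia|apply graded_Dcoef, graded_Dcoef, graded_Dcoef, graded_U|].
  intros k.
  eapply Rle_trans; [apply pnorm_Dcoef; [exact m_pos|apply graded_Dcoef, graded_Dcoef, graded_U]|].
  pose proof (pnorm_D2 k). pose proof (pos_INR k).
  replace ((2 * INR k) ^ 3 * pnorm (rho m) (Uc k))
    with (2 * INR k * ((2 * INR k) ^ 2 * pnorm (rho m) (Uc k))) by ring.
  apply Rmult_le_compat_l; [lra|assumption].
Qed.

Lemma vterm_dominated (P : nat -> list R) (k : nat) (t : R) : dominated P ->
  Rabs (vterm m P k t) <= (sig_log m t / (s / 8)) ^ k * (8 * g k).
Proof.
  intros (HG & HP). destruct s_small as ((Hs & _) & _).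
  eapply Rle_trans; [now apply vterm_bound|].
  replace (sig_log m t ^ k) with ((sig_log m t / (s / 8)) ^ k * (s / 8) ^ k).
  - rewrite Rmult_assoc. apply Rmult_le_compat_l.
    + apply pow_le. apply Rle_mult_inv_pos; [|lra].
      pose proof (yexp_le_sig_log m t). pose proof (yexp_pos m t). lra.
    + rewrite Rmult_comm. apply HP.
  - rewrite <- Rpow_mult_distr. f_equal. field. lra.
Qed.

Lemma in_domain_ratio (t : R) : in_domain t -> 0 <= sig_log m t / (s / 8) <= 1.
Proof.
  intros Ht. unfold in_domain in Ht. destruct s_small as ((Hs & _) & _). split.
  - apply Rle_mult_inv_pos; [|lra]. pose proof (yexp_le_sig_log m t). pose proof (yexp_pos m t). lra.
  - apply (Rmult_le_reg_r (s / 8)); [lra|]. unfold Rdiv at 1.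
    rewrite Rmult_assoc, Rinv_l by lra. lra.
Qed.

Lemma vterm_dominated_domain (P : nat -> list R) (k : nat) (t : R) :
  dominated P -> in_domain t -> Rabs (vterm m P k t) <= 8 * g k.
Proof.
  intros HP Ht. eapply Rle_trans; [now apply vterm_dominated|].
  pose proof (in_domain_ratio t Ht) as Hr.
  assert (0 <= g k) by now apply (U_term_nonneg m p kap b).
  assert ((sig_log m t / (s / 8)) ^ k <= 1) by (rewrite <- (pow1 k); now apply pow_incr).
  nra.
Qed.

Lemma ex_series_U_majorant : ex_series (fun k => 8 * g k).
Proof. apply (ex_series_scal_l 8 g). apply U_terms_summable. Qed.

Lemma ex_series_vterm (P : nat -> list R) (t : R) :
  dominated P -> in_domain t -> ex_series (fun k => vterm m P k t).
Proof.
  intros HP Ht. apply (ex_series_dominated _ (fun k => 8 * g k)); [|apply ex_series_U_majorant].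
  intros k. now apply vterm_dominated_domain.
Qed.

(** The majorant of the term of weight 0 vanishes, so one factor of the ratio comes out of every
    term; 2 is 8 times the bound 1/4 on the majorant series. *)
Lemma vsum_small (P : nat -> list R) (t : R) :
  dominated P -> in_domain t -> Rabs (vsum m P t) <= sig_log m t / (s / 8) * 2.
Proof.
  intros HP Ht. pose proof (in_domain_ratio t Ht) as Hr. set (q := sig_log m t / (s / 8)) in *.
  unfold vsum. apply Rle_trans with (Series (fun k => q * (8 * g k))).
  - apply Series_abs_le.
    + intros k. eapply Rle_trans; [now apply vterm_dominated|]. fold q.
      assert (0 <= g k) by now apply (U_term_nonneg m p kap b).
      destruct k as [|k].
      * unfold g, Uc. rewrite U_coef_0. simpl. lra.
      * apply Rmult_le_compat_r; [lra|]. simpl.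
        assert (q ^ k <= 1) by (rewrite <- (pow1 k); now apply pow_incr).
        assert (0 <= q ^ k) by (apply pow_le; lra). nra.
    + apply (ex_series_scal_l q (fun k => 8 * g k)), ex_series_U_majorant.
  - rewrite Series_scal_l, Series_scal_l. pose proof (proj2 U_terms_summable). nra.
Qed.

Lemma is_derive_vsum (P : nat -> list R) (T : R) :
  dominated P -> dominated (Dcoef m P) -> (forall t, t < T -> in_domain t) ->
  forall t, t < T -> is_derive (vsum m P) t (vsum m (Dcoef m P) t).
Proof.
  intros HP HD HT.
  apply (is_derive_Series (vterm m P) (vterm m (Dcoef m P)) (vterm m (Dcoef m (Dcoef m P)))
           (fun k => 8 * g k)).
  - apply ex_series_U_majorant.
  - intros; apply is_derive_vterm.
  - intros; apply is_derive_vterm.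
  - intros; apply vterm_dominated_domain; auto.
  - intros; apply vterm_dominated_domain; auto.
Qed.

Lemma in_domain_left : exists T, T < 0 /\ forall t, t < T -> in_domain t.
Proof.
  destruct s_small as ((Hs & _) & _).
  destruct (exp_decay (bet m) (s / 8) 1) as (T & HT0 & HT).
  - split; [now apply bet_pos|now apply bet_le1].
  - lia.
  - lra.
  - exists T. split; [exact HT0|]. intros t Ht. unfold in_domain, sig_log, yexp.
    pose proof (HT t Ht) as H. rewrite pow_1 in H. lra.
Qed.

(* D^3 - D = (D + 1) D (D - 1), with D acting as [INR k * bet + d/dL] on weight k. *)
Lemma coefficient_equation (k : nat) (x : R) : (1 <= k)%nat ->
  peval (DU3 k) x - peval (DU1 k) x = peval (rhs_coef m kap Fc k) x.
Proof.
  intros Hk. set (w := INR k * bet m).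
  assert (HD : forall P y, peval (Dcoef m P k) y = w * peval (P k) y + peval (pderiv (P k)) y).
  { intros P y. unfold Dcoef. rewrite peval_padd, peval_pscal. reflexivity. }
  assert (HD' : forall P y, peval (pderiv (Dcoef m P k)) y
                = w * peval (pderiv (P k)) y + 1 * peval (pderiv (pderiv (P k))) y).
  { intros P. apply (peval_pderiv_lin _ (P k) (pderiv (P k)) w 1). intros y. rewrite HD. ring. }
  assert (HD'' : forall P y, peval (pderiv (pderiv (Dcoef m P k))) y
                = w * peval (pderiv (pderiv (P k))) y + 1 * peval (pderiv (pderiv (pderiv (P k)))) y).
  { intros P. apply (peval_pderiv_lin _ (pderiv (P k)) (pderiv (pderiv (P k))) w 1), HD'. }
  unfold DU3, DU2, DU1. rewrite !HD, !HD', !HD''.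
  set (e0 := peval (Uc k) x). set (e1 := peval (pderiv (Uc k)) x).
  set (e2 := peval (pderiv (pderiv (Uc k))) x). set (e3 := peval (pderiv (pderiv (pderiv (Uc k)))) x).
  destruct (Nat.eq_dec k m) as [Ekm|Hkm].
  - assert (Hw : w = 1) by (unfold w; rewrite Ekm; now apply m_bet).
    set (r := rhs_coef m kap Fc k).
    assert (EU : Uc k = [b; hd 0 r / 2]).
    { unfold Uc, U_coef, u_coef. rewrite (proj2 (Nat.eqb_neq k 0)), (proj2 (Nat.eqb_eq k m)) by lia.
      reflexivity. }
    assert (Er : peval r x = hd 0 r).
    { assert (Lr : (length r * m <= (k - 1) + m)%nat).
      { apply length_rhs_coef; [exact m_pos|exact Hk|]. intros; now apply length_F_coef. }
      assert (length r <= 1)%nat by nia.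
      destruct r as [|c [|d r]]; simpl in *; try lia; ring. }
    unfold e0, e1, e2, e3. rewrite Er, EU, Hw. simpl. field.
  - assert (Hw1 : w - 1 <> 0).
    { intros E. apply Hkm. apply INR_eq. unfold w in E. pose proof (m_bet m m_pos).
      pose proof (bet_pos m m_pos). apply (Rmult_eq_reg_r (bet m)); lra. }
    assert (Hw0 : 0 < w).
    { unfold w. pose proof (bet_pos m m_pos). apply Rmult_lt_0_compat; [|lra].
      apply lt_0_INR. lia. }
    set (r := rhs_coef m kap Fc k).
    set (P1 := pinv (w - 1) r). set (P2 := pinv w P1).
    assert (EU : Uc k = pinv (w + 1) P2).
    { unfold Uc, U_coef, u_coef. rewrite (proj2 (Nat.eqb_neq k 0)), (proj2 (Nat.eqb_neq k m)) by lia.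
      reflexivity. }
    assert (S3 : forall y, peval P2 y = (w + 1) * peval (Uc k) y + 1 * peval (pderiv (Uc k)) y).
    { intros y. rewrite EU, <- (pinv_spec (w + 1) P2) by lra. ring. }
    pose proof (peval_pderiv_lin _ _ _ _ _ S3) as S3'.
    pose proof (peval_pderiv_lin _ _ _ _ _ S3') as S3''.
    assert (S2 : forall y, peval P1 y = w * peval P2 y + 1 * peval (pderiv P2) y).
    { intros y. unfold P2. rewrite <- (pinv_spec w P1) at 1 by lra. ring. }
    pose proof (peval_pderiv_lin _ _ _ _ _ S2) as S2'.
    pose proof (pinv_spec (w - 1) r Hw1 x) as S1. fold P1 in S1.
    rewrite <- S1, S2', S2, S3'', S3', S3. fold e0 e1 e2 e3. ring.
Qed.

Definition u_sum (t : R) : R := vsum m Uc t.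

Lemma F_term_decay (k : nat) (t : R) : in_domain t ->
  Rabs (vterm m Fc k t) <= (/ 8) ^ k * f k.
Proof.
  intros Ht. unfold in_domain in Ht. pose proof (rho_ge4 m m_pos) as Hr.
  eapply Rle_trans; [apply vterm_bound; [exact m_pos|intros j; now apply length_F_coef]|].
  fold Fc. unfold f.
  replace ((/ 8) ^ k * (pnorm (rho m) (Fc k) * s ^ k))
    with ((s / 8) ^ k * pnorm (rho m) (Fc k)).
  - apply Rmult_le_compat_r; [apply pnorm_nonneg; lra|]. apply pow_incr. split; [|exact Ht].
    pose proof (yexp_le_sig_log m t). pose proof (yexp_pos m t). lra.
  - unfold Rdiv. rewrite Rpow_mult_distr. ring.
Qed.

Lemma ex_series_F (t : R) : in_domain t -> ex_series (fun k => vterm m Fc k t).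
Proof.
  intros Ht. apply (ex_series_dominated _ f); [|apply F_terms_summable].
  intros k. eapply Rle_trans; [now apply F_term_decay|].
  assert (0 <= f k) by now apply (F_term_nonneg m p kap b).
  assert ((/ 8) ^ k <= 1) by (rewrite <- (pow1 k); apply pow_incr; lra). nra.
Qed.

Lemma u_equation_series (t : R) : in_domain t ->
  vsum m DU3 t - vsum m DU1 t
  = - kap * yexp m t * (1 - exp t) * vsum m Fc t.
Proof.
  intros Ht. set (y := yexp m t).
  unfold vsum.
  rewrite <- Series_minus by (apply ex_series_vterm; auto using dominated_D3, dominated_D1).
  assert (HF := ex_series_F t Ht).
  (* [h1] and [h2] are the terms of y F and of y^(m+1) F = y x F, shifted to their weights. *)
  set (h1 := fun k => if (k =? 0)%nat then 0 else y * vterm m Fc (k - 1) t).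
  set (h2 := fun k => if (m <? k)%nat then y ^ S m * vterm m Fc (k - 1 - m) t else 0).
  assert (X1 : ex_series h1).
  { apply ex_series_incr_1. apply (ex_series_ext (fun k => y * vterm m Fc k t)).
    - intros k. unfold h1. simpl. now rewrite Nat.sub_0_r.
    - now apply (ex_series_scal_l y (fun k => vterm m Fc k t)). }
  assert (X2 : ex_series h2).
  { apply (ex_series_incr_n _ (S m)). apply (ex_series_ext (fun k => y ^ S m * vterm m Fc k t)).
    - intros k. unfold h2. rewrite (proj2 (Nat.ltb_lt m (S m + k))) by lia.
      do 2 f_equal. lia.
    - now apply (ex_series_scal_l (y ^ S m) (fun k => vterm m Fc k t)). }
  assert (E1 : Series h1 = y * Series (fun k => vterm m Fc k t)).
  { rewrite Series_incr_1 by exact X1. unfold h1 at 1. simpl. rewrite Rplus_0_l, <- Series_scal_l.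
    apply Series_ext. intros k. unfold h1. simpl. now rewrite Nat.sub_0_r. }
  assert (E2 : Series h2 = y ^ S m * Series (fun k => vterm m Fc k t)).
  { rewrite (Series_incr_n h2 (S m)) by (try lia; exact X2).
    assert (Z : sum_f_R0 h2 (pred (S m)) = 0).
    { simpl pred. rewrite (sum_eq _ (fun _ => 0)).
      - clear. induction m as [|n IH]; simpl; lra.
      - intros i Hi. unfold h2. destruct (Nat.ltb_spec m i); [lia|reflexivity]. }
    rewrite Z, Rplus_0_l, <- Series_scal_l. apply Series_ext. intros k. unfold h2.
    rewrite (proj2 (Nat.ltb_lt m (S m + k))) by lia. do 2 f_equal. lia. }
  rewrite (Series_ext _ (fun k => - kap * (h1 k - h2 k))).
  - rewrite Series_scal_l, Series_minus by assumption. rewrite E1, E2. simpl.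
    unfold y at 3. rewrite yexp_pow_m by exact m_pos. ring.
  - intros k. unfold vterm. fold y. rewrite <- Rmult_minus_distr_l.
    destruct (Nat.eq_dec k 0) as [->|Hk].
    + assert (Z3 : DU3 0 = []) by reflexivity. assert (Z1 : DU1 0 = []) by reflexivity.
      rewrite Z3, Z1. unfold h1, h2. simpl.
      destruct (m <? 0)%nat eqn:E; [apply Nat.ltb_lt in E; lia|]. ring.
    + rewrite coefficient_equation by lia. unfold rhs_coef, h1, h2.
      rewrite (proj2 (Nat.eqb_neq k 0)) by exact Hk.
      rewrite peval_pscal, peval_padd. unfold vterm. fold y.
      destruct (Nat.ltb_spec m k).
      * rewrite peval_pscal.
        replace (y ^ k) with (y * y ^ (k - 1)) by (replace k with (S (k - 1)) at 2 by lia; reflexivity).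
        replace (y ^ S m * (y ^ (k - 1 - m) * peval (Fc (k - 1 - m)%nat) t))
          with (y * (y ^ (k - 1)) * peval (Fc (k - 1 - m)%nat) t).
        -- ring.
        -- rewrite <- Rmult_assoc, <- pow_add. replace (S m + (k - 1 - m))%nat with (S (k - 1)) by lia.
           simpl. ring.
      * replace (y ^ k) with (y * y ^ (k - 1)) by (replace k with (S (k - 1)) at 2 by lia; reflexivity).
        simpl. ring.
Qed.

End Sum.

(** * The series solution *)

Lemma sum_f_R0_shift (h : nat -> R) (n : nat) :
  sum_f_R0 (fun j => h (S j)) n = sum1 h (S n).
Proof. induction n as [|n IH]; [simpl; ring|]. cbn [sum_f_R0]. rewrite IH. reflexivity. Qed.

Lemma CV_radius_ge (a : nat -> R) (r M : R) :
  (forall n, Rabs (a n * r ^ n) <= M) -> Rbar_le r (CV_radius a).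
Proof. intros H. apply (proj1 (CV_radius_bounded a)). now exists M. Qed.

(** With ln x frozen, both sums are power series in y alone. The recursion is then (1 + g) f' + p f
    g' = 0, so f (1 + g)^p has derivative 0 and keeps its value 1 at y = 0. *)
Lemma PSeries_binomial_ode (f g : nat -> R) (p y r : R) :
  0 <= y < r -> Rbar_le r (CV_radius f) -> Rbar_le r (CV_radius g) ->
  f 0%nat = 1 -> g 0%nat = 0 ->
  (forall z, 0 <= z <= y -> 0 < 1 + PSeries g z) ->
  (forall k, INR (S k) * f (S k)
     = - sum1 (fun j => (p * INR j + INR (S k - j)) * (g j * f (S k - j)%nat)) (S k)) ->
  PSeries f y = Rpower (1 + PSeries g y) (- p).
Proof.
  intros Hy Hf Hg f0 g0 Hpos Hrec.
  assert (Hin : forall z, 0 <= z <= y -> Rbar_lt (Rabs z) (CV_radius f) /\ Rbar_lt (Rabs z) (CV_radius g)).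
  { intros z Hz. rewrite Rabs_right by lra.
    split; (eapply Rbar_lt_le_trans; [|eassumption]); simpl; lra. }
  assert (Hode : forall z, 0 <= z <= y ->
    (1 + PSeries g z) * PSeries (PS_derive f) z + p * (PSeries f z * PSeries (PS_derive g) z) = 0).
  { intros z Hz. destruct (Hin z Hz) as (Zf & Zg).
    assert (Zf' : Rbar_lt (Rabs z) (CV_radius (PS_derive f))) by (now rewrite CV_radius_derive).
    assert (Zg' : Rbar_lt (Rabs z) (CV_radius (PS_derive g))) by (now rewrite CV_radius_derive).
    replace ((1 + PSeries g z) * PSeries (PS_derive f) z + p * (PSeries f z * PSeries (PS_derive g) z))
      with (PSeries (PS_derive f) z + PSeries g z * PSeries (PS_derive f) z
            + p * (PSeries (PS_derive g) z * PSeries f z)) by ring.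
    rewrite <- !PSeries_mult by assumption. rewrite <- PSeries_scal.
    assert (X1 : ex_pseries (PS_derive f) z) by (apply CV_disk_correct, CV_disk_inside, Zf').
    assert (X2 : ex_pseries (PS_mult g (PS_derive f)) z) by (now apply ex_pseries_mult).
    assert (X3 : ex_pseries (PS_scal p (PS_mult (PS_derive g) f)) z).
    { apply ex_pseries_scal; [apply Rmult_comm|now apply ex_pseries_mult]. }
    rewrite <- PSeries_plus by assumption.
    rewrite <- PSeries_plus by (try assumption; now apply ex_pseries_plus).
    rewrite (PSeries_ext _ (fun _ => 0)); [apply PSeries_const_0|].
    intros n.
    change (INR (S n) * f (S n) + sum_f_R0 (fun k => g k * (INR (S (n - k)) * f (S (n - k)))) n
            + p * sum_f_R0 (fun k => INR (S k) * g (S k) * f (n - k)%nat) n = 0).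
    rewrite (sum1_sum_f_R0 (fun k => g k * (INR (S (n - k)) * f (S (n - k))))).
    rewrite (sum_f_R0_shift (fun j => INR j * g j * f (S n - j)%nat) n : sum_f_R0
      (fun k => INR (S k) * g (S k) * f (n - k)%nat) n = _).
    rewrite Hrec, g0.
    rewrite (sum1_ext (fun j => (p * INR j + INR (S n - j)) * (g j * f (S n - j)%nat))
      (fun j => p * (INR j * g j * f (S n - j)%nat) + g j * (INR (S n - j) * f (S n - j)%nat)))
      by (intros; ring).
    rewrite sum1_plus, sum1_scal.
    assert (E : sum1 (fun j => g j * (INR (S n - j) * f (S n - j)%nat)) (S n)
                = sum1 (fun k => g k * (INR (S (n - k)) * f (S (n - k)))) n).
    { cbn [sum1]. replace (S n - S n)%nat with 0%nat by lia. simpl (INR 0).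
      rewrite (sum1_ext _ (fun k => g k * (INR (S (n - k)) * f (S (n - k))))); [ring|].
      intros j Hj. replace (S n - j)%nat with (S (n - j)) by lia. reflexivity. }
    rewrite E. ring. }
  assert (HD : forall z, 0 <= z <= y ->
    is_derive (fun z => PSeries f z * Rpower (1 + PSeries g z) p) z 0).
  { intros z Hz. destruct (Hin z Hz) as (Zf & Zg).
    pose proof (is_derive_PSeries f z Zf) as Df. pose proof (is_derive_PSeries g z Zg) as Dg.
    pose proof (Hpos z Hz) as Hp.
    assert (Dr : is_derive (fun z => Rpower (1 + PSeries g z) p) z
       (PSeries (PS_derive g) z * (p * Rpower (1 + PSeries g z) (p - 1)))).
    { apply (is_derive_Rcomp (fun h => Rpower h p) (fun z => 1 + PSeries g z)).
      - now apply is_derive_Rpower.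
      - eapply is_derive_eq; [apply is_derive_Rplus; [apply is_derive_Rconst|exact Dg]|ring]. }
    eapply is_derive_eq; [apply is_derive_Rmult; [exact Df|exact Dr]|]. cbv beta.
    assert (E : Rpower (1 + PSeries g z) p = Rpower (1 + PSeries g z) (p - 1) * (1 + PSeries g z)).
    { rewrite <- (Rpower_1 (1 + PSeries g z)) at 3 by exact Hp. rewrite <- Rpower_plus.
      f_equal. ring. }
    rewrite E. pose proof (Hode z Hz) as Ho.
    replace (PSeries (PS_derive f) z * (Rpower (1 + PSeries g z) (p - 1) * (1 + PSeries g z)) +
      PSeries f z * (PSeries (PS_derive g) z * (p * Rpower (1 + PSeries g z) (p - 1))))
      with (Rpower (1 + PSeries g z) (p - 1) * ((1 + PSeries g z) * PSeries (PS_derive f) z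
            + p * (PSeries f z * PSeries (PS_derive g) z))) by ring.
    rewrite Ho. ring. }
  assert (E1 : PSeries f y * Rpower (1 + PSeries g y) p = 1).
  { assert (E0 : PSeries f 0 * Rpower (1 + PSeries g 0) p = 1).
    { rewrite !PSeries_0, f0, g0, Rplus_0_r. unfold Rpower. rewrite ln_1, Rmult_0_r, exp_0. apply Rmult_1_l. }
    transitivity (PSeries f 0 * Rpower (1 + PSeries g 0) p); [|exact E0]. apply Rle_antisym.
    - cut (- (PSeries f 0 * Rpower (1 + PSeries g 0) p)
           <= - (PSeries f y * Rpower (1 + PSeries g y) p)); [lra|].
      apply (le_of_derive_nonneg_closed (fun z => - (PSeries f z * Rpower (1 + PSeries g z) p))
               (fun _ => - 0)); [exact (proj1 Hy)| |intros; lra].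
      intros z Hz. apply is_derive_Ropp. now apply HD.
    - apply (le_of_derive_nonneg_closed (fun z => PSeries f z * Rpower (1 + PSeries g z) p)
               (fun _ => 0)); [exact (proj1 Hy)|exact HD|intros; lra]. }
  rewrite Rpower_Ropp. pose proof (Rpower_pos (1 + PSeries g y) p).
  apply (Rmult_eq_reg_r (Rpower (1 + PSeries g y) p)); [|lra].
  rewrite E1. field. lra.
Qed.

Section Solution.

Variables (m : nat) (p kap b s : R).
Hypothesis m_pos : (1 <= m)%nat.
Hypothesis p_range : 0 <= p <= 2.
Hypothesis kap_nonneg : 0 <= kap.
Hypothesis s_small : small_radius m kap b s.

Let Uc : nat -> list R := U_coef m p kap b.
Let Fc : nat -> list R := F_coef m p kap b.

(** The spare factor 8 shows that, at fixed t, the radius of convergence in y is at least 8 times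
    the value of y in use. *)
Lemma graded_pow_bound (P : nat -> list R) (t z : R) (k : nat) : graded m P ->
  in_domain m s t -> 0 <= z <= yexp m t ->
  Rabs (peval (P k) t) * (8 * z) ^ k <= pnorm (rho m) (P k) * s ^ k.
Proof.
  intros HP Ht Hz. unfold in_domain in Ht. pose proof (rho_ge4 m m_pos) as Hr.
  pose proof (vterm_bound m P k t m_pos HP) as HB. unfold vterm in HB.
  rewrite Rabs_mult, (Rabs_right (yexp m t ^ k)) in HB.
  2: { apply Rle_ge, pow_le, Rlt_le, yexp_pos. }
  rewrite Rpow_mult_distr.
  assert (H8 : 0 < 8 ^ k) by (apply pow_lt; lra).
  assert (Hzk : z ^ k <= yexp m t ^ k) by (now apply pow_incr).
  pose proof (Rabs_pos (peval (P k) t)) as H0.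
  pose proof (pnorm_nonneg (rho m) (P k) ltac:(lra)) as H1.
  assert (Hsig : sig_log m t ^ k <= (s / 8) ^ k).
  { apply pow_incr. pose proof (yexp_le_sig_log m t). pose proof (yexp_pos m t). lra. }
  replace (s ^ k) with (8 ^ k * (s / 8) ^ k).
  2: { rewrite <- Rpow_mult_distr. f_equal. field. }
  apply Rle_trans with (8 ^ k * (yexp m t ^ k * Rabs (peval (P k) t))).
  - assert (Rabs (peval (P k) t) * z ^ k <= Rabs (peval (P k) t) * yexp m t ^ k)
      by (now apply Rmult_le_compat_l).
    replace (Rabs (peval (P k) t) * (8 ^ k * z ^ k))
      with (8 ^ k * (Rabs (peval (P k) t) * z ^ k)) by ring.
    apply Rmult_le_compat_l; [lra|]. rewrite (Rmult_comm (yexp m t ^ k)). assumption.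
  - replace (pnorm (rho m) (P k) * (8 ^ k * (s / 8) ^ k))
      with (8 ^ k * ((s / 8) ^ k * pnorm (rho m) (P k))) by ring.
    apply Rmult_le_compat_l; [lra|]. eapply Rle_trans; [exact HB|].
    now apply Rmult_le_compat_r.
Qed.

Lemma vsum_PSeries (P : nat -> list R) (t : R) :
  vsum m P t = PSeries (fun k => peval (P k) t) (yexp m t).
Proof. apply Series_ext. intros k. unfold vterm. ring. Qed.

(** Stated for all z up to [yexp m t], since 1 + u must stay positive along the whole segment on
    which the equation in y is solved. *)
Lemma u_sum_small (t z : R) : in_domain m s t -> 0 <= z <= yexp m t ->
  Rabs (PSeries (fun k => peval (Uc k) t) z) <= 1 / 4.
Proof.
  intros Ht Hz. destruct (U_terms_summable m p kap b s m_pos p_range kap_nonneg s_small) as (Hex & Hle).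
  eapply Rle_trans; [apply (Series_abs_le _ (fun k => pnorm (rho m) (Uc k) * s ^ k))|exact Hle].
  - intros k. rewrite Rabs_mult, (Rabs_right (z ^ k)) by (apply Rle_ge, pow_le; lra).
    eapply Rle_trans; [|apply (graded_pow_bound Uc t z k); auto].
    + apply Rmult_le_compat_l; [apply Rabs_pos|]. apply pow_incr. lra.
    + intros j. now apply length_U.
  - exact Hex.
Qed.

Lemma F_sum_eq (t : R) : in_domain m s t ->
  vsum m Fc t = Rpower (1 + vsum m Uc t) (- p).
Proof.
  intros Ht. rewrite !vsum_PSeries. pose proof (yexp_pos m t) as Hy.
  destruct (U_terms_summable m p kap b s m_pos p_range kap_nonneg s_small) as (Gex & _).
  destruct (F_terms_summable m p kap b s m_pos p_range kap_nonneg s_small) as (Fex & _).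
  assert (HB : forall P, graded m P -> ex_series (fun k => pnorm (rho m) (P k) * s ^ k) ->
     Rbar_le (8 * yexp m t) (CV_radius (fun k => peval (P k) t))).
  { intros P HP HX. pose proof (rho_ge4 m m_pos) as Hr. destruct s_small as ((Hs & _) & _).
    apply (CV_radius_ge _ _ (Series (fun k => pnorm (rho m) (P k) * s ^ k))).
    intros n. rewrite Rabs_mult, (Rabs_right ((8 * yexp m t) ^ n)) by (apply Rle_ge, pow_le; lra).
    eapply Rle_trans; [apply (graded_pow_bound P t (yexp m t) n HP Ht); lra|].
    assert (Hnn : forall k, 0 <= pnorm (rho m) (P k) * s ^ k).
    { intros k. apply Rmult_le_pos; [apply pnorm_nonneg; lra|apply pow_le; lra]. }
    rewrite (Series_incr_n _ (S n)) by (try lia; exact HX). simpl pred.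
    assert (H1 : pnorm (rho m) (P n) * s ^ n <= sum_f_R0 (fun k => pnorm (rho m) (P k) * s ^ k) n).
    { destruct n as [|n]; [simpl; lra|]. rewrite tech5.
      assert (0 <= sum_f_R0 (fun k => pnorm (rho m) (P k) * s ^ k) n) by (now apply cond_pos_sum).
      lra. }
    assert (H2 : 0 <= Series (fun k => pnorm (rho m) (P (S n + k)%nat) * s ^ (S n + k))).
    { apply Series_nonneg.
      - intros k. apply Hnn.
      - now apply (ex_series_incr_n (fun k => pnorm (rho m) (P k) * s ^ k) (S n)). }
    lra. }
  apply (PSeries_binomial_ode _ _ p (yexp m t) (8 * yexp m t)).
  - lra.
  - apply HB; [intros j; now apply length_F_coef|exact Fex].
  - apply HB; [intros j; now apply length_U|exact Gex].
  - unfold Fc. rewrite F_coef_0. simpl. ring.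
  - reflexivity.
  - intros z Hz. pose proof (u_sum_small t z Ht Hz) as Hu.
    apply Rcomplements.Rabs_le_between in Hu. lra.
  - intros k. unfold Fc at 1. rewrite F_coef_S by exact m_pos. unfold F_step.
    rewrite peval_pscal, peval_psum1.
    assert (INR (S k) <> 0) by (apply not_0_INR; lia).
    rewrite <- Rmult_assoc. replace (INR (S k) * - / INR (S k)) with (- (1)) by (field; assumption).
    rewrite <- Ropp_mult_distr_l, Rmult_1_l. f_equal. apply sum1_ext. intros j Hj.
    rewrite peval_pscal, peval_pmul. reflexivity.
Qed.

Lemma vsum_lim0 (P : nat -> list R) : dominated m p kap b s P ->
  lim0 (fun x => vsum m P (ln x)) 0.
Proof.
  intros HP. pose proof s_small as ((Hs & _) & _).
  destruct (in_domain_left m kap b s m_pos s_small) as (T & HT0 & HT).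
  apply (lim0_squeeze _ (fun x => 16 / s * sig_log m (ln x)) _ (exp T)); [apply exp_pos| |].
  - intros x Hx. rewrite Rminus_0_r.
    assert (Hln : ln x < T) by (rewrite <- (ln_exp T); apply ln_increasing; lra).
    eapply Rle_trans; [apply (vsum_small m p kap b s m_pos p_range kap_nonneg s_small P);
      [exact HP|now apply HT]|].
    apply Req_le. field. lra.
  - apply (lim0_eq _ (16 / s * 0)); [|ring]. apply lim0_mult; [apply lim0_const|].
    apply lim0_intro. intros e He.
    destruct (exp_decay (bet m) e 1) as (T' & _ & HT').
    + split; [now apply bet_pos|now apply bet_le1].
    + lia.
    + exact He.
    + exists (exp T'). split; [apply exp_pos|]. intros x Hx.
      assert (Hln : ln x < T') by (rewrite <- (ln_exp T'); apply ln_increasing; lra).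
      specialize (HT' _ Hln). rewrite pow_1 in HT'. rewrite Rminus_0_r, Rabs_right; [exact HT'|].
      apply Rle_ge. pose proof (yexp_le_sig_log m (ln x)). pose proof (yexp_pos m (ln x)). lra.
Qed.

End Solution.

Section LocalSolution.

Variables (m : nat) (theta b s : R).
Hypothesis m_pos : (1 <= m)%nat.
Hypothesis theta_pos : 0 < theta.

Let p : R := 2 - bet m.
Let kap : R := Rpower theta (- p - 1).

Hypothesis s_small : small_radius m kap b s.

Lemma p_range_bet : 0 <= p <= 2.
Proof. pose proof (bet_pos m m_pos). pose proof (bet_le1 m m_pos). unfold p. lra. Qed.

Lemma kap_nonneg_theta : 0 <= kap.
Proof. apply Rlt_le, Rpower_pos. Qed.

Definition series_solution (x : R) : R := theta * x * (1 + u_sum m p kap b (ln x)).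

(** With D = x d/dx and H = theta x (1 + u) one has H' = theta (1 + u + Du), x H'' = theta (Du + D^2
    u) and x^2 H''' = theta (D^3 u - Du); [u_equation_series] and [F_sum_eq] turn the last one into
    the film equation. *)
Lemma series_solution_local : exists c H1 H2,
  0 < c <= 1 /\ (forall x, 0 < x < c -> in_domain m s (ln x)) /\
  local_solution p theta c series_solution H1 H2.
Proof.
  pose proof p_range_bet as Hp. pose proof kap_nonneg_theta as Hk.
  pose proof s_small as ((Hs & _) & _).
  destruct (in_domain_left m kap b s m_pos s_small) as (T & HT0 & HT).
  set (V := vsum m (U_coef m p kap b)). set (V1 := vsum m (DU1 m p kap b)).
  set (V2 := vsum m (DU2 m p kap b)). set (V3 := vsum m (DU3 m p kap b)).
  pose proof (dominated_U m p kap b s m_pos s_small) as DU.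
  pose proof (dominated_D1 m p kap b s m_pos s_small) as DD1.
  pose proof (dominated_D2 m p kap b s m_pos s_small) as DD2.
  pose proof (dominated_D3 m p kap b s m_pos s_small) as DD3.
  assert (Hln : forall x, 0 < x < exp T -> ln x < T).
  { intros x Hx. rewrite <- (ln_exp T). apply ln_increasing; lra. }
  assert (Hder : forall (W W' : R -> R), (forall t, t < T -> is_derive W t (W' t)) ->
    forall x, 0 < x < exp T -> is_derive (fun x => W (ln x)) x (W' (ln x) / x)).
  { intros W W' HW x Hx. eapply is_derive_eq.
    - apply (is_derive_Rcomp W ln); [apply HW; now apply Hln|].
      apply is_derive_Reals. apply derivable_pt_lim_ln. lra.
    - unfold Rdiv. ring. }
  assert (dV : forall x, 0 < x < exp T -> is_derive (fun x => V (ln x)) x (V1 (ln x) / x)).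
  { apply Hder. apply (is_derive_vsum m p kap b s m_pos p_range_bet Hk s_small); auto. }
  assert (dV1 : forall x, 0 < x < exp T -> is_derive (fun x => V1 (ln x)) x (V2 (ln x) / x)).
  { apply Hder. apply (is_derive_vsum m p kap b s m_pos p_range_bet Hk s_small); auto. }
  assert (dV2 : forall x, 0 < x < exp T -> is_derive (fun x => V2 (ln x)) x (V3 (ln x) / x)).
  { apply Hder. apply (is_derive_vsum m p kap b s m_pos p_range_bet Hk s_small); auto. }
  assert (VL : lim0 (fun x => V (ln x)) 0) by (now apply (vsum_lim0 m p kap b s)).
  assert (VL1 : lim0 (fun x => V1 (ln x)) 0) by (now apply (vsum_lim0 m p kap b s)).
  exists (exp T), (fun x => theta * (1 + V (ln x) + V1 (ln x))),
    (fun x => theta * ((V1 (ln x) + V2 (ln x)) * / x)).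
  split; [|split; [|split; [|split]]].
  - split; [apply exp_pos|]. rewrite <- exp_0. apply exp_le_mono. lra.
  - intros x Hx. now apply HT, Hln.
  - intros x Hx.
    assert (Hdom : in_domain m s (ln x)) by (now apply HT, Hln).
    assert (HV : 3 / 4 <= 1 + V (ln x)).
    { pose proof (u_sum_small m p kap b s m_pos p_range_bet Hk s_small (ln x) (yexp m (ln x)) Hdom) as Hu.
      rewrite <- vsum_PSeries in Hu. fold V in Hu.
      specialize (Hu ltac:(pose proof (yexp_pos m (ln x)); lra)).
      apply Rcomplements.Rabs_le_between in Hu. lra. }
    pose proof (dV x Hx) as E0. pose proof (dV1 x Hx) as E1. pose proof (dV2 x Hx) as E2.
    split; [|split; [|split]].
    + unfold series_solution, u_sum. fold V. apply Rmult_lt_0_compat; [apply Rmult_lt_0_compat|]; lra.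
    + unfold series_solution, u_sum. fold V. derive_as. field. lra.
    + derive_as. field. lra.
    + assert (Ei : is_derive (fun x => / x) x (- / (x * x))).
      { eapply is_derive_eq; [apply (is_derive_inv (fun x => x) x 1); [apply is_derive_Rid|lra]|].
        field. lra. }
      derive_as.
      pose proof (u_equation_series m p kap b s m_pos p_range_bet Hk s_small (ln x) Hdom) as HE.
      rewrite (F_sum_eq m p kap b s m_pos p_range_bet Hk s_small (ln x) Hdom) in HE.
      fold V V1 V3 in HE. rewrite exp_ln in HE by lra.
      unfold series_solution, u_sum. fold V.
      rewrite <- !Rpower_mult_distr by (try apply Rmult_lt_0_compat; lra).
      assert (Ey : yexp m (ln x) = Rpower x (- p) * (x * x)).
      { unfold yexp. change (exp (bet m * ln x)) with (Rpower x (bet m)).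
        replace (x * x) with (Rpower x 2).
        - rewrite <- Rpower_plus. f_equal. unfold p. ring.
        - replace 2 with (1 + 1) by ring. rewrite Rpower_plus, Rpower_1; lra. }
      assert (Ek : kap * theta = Rpower theta (- p)).
      { unfold kap. rewrite <- (Rpower_1 theta) at 2 by exact theta_pos.
        rewrite <- Rpower_plus. f_equal. ring. }
      rewrite Ey in HE. rewrite <- Ek.
      transitivity (theta * (V3 (ln x) - V1 (ln x)) / (x * x)).
      * field. lra.
      * rewrite HE. field. lra.
  - apply (lim0_eq _ (theta * 0 * (1 + 0))); [|ring].
    unfold series_solution, u_sum. fold V.
    apply lim0_mult; [apply lim0_mult; [apply lim0_const|apply lim0_id]|].
    apply lim0_plus; [apply lim0_const|exact VL].
  - apply (lim0_eq _ (theta * (1 + 0 + 0))); [|ring].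
    apply lim0_mult; [apply lim0_const|]. apply lim0_plus; [|exact VL1].
    apply lim0_plus; [apply lim0_const|exact VL].
Qed.

End LocalSolution.

(** * Dependence of the series on the free parameter *)

Section FreeParameter.

Variables (m : nat) (p kap b s : R).
Hypothesis m_pos : (1 <= m)%nat.
Hypothesis p_range : 0 <= p <= 2.
Hypothesis kap_nonneg : 0 <= kap.
Hypothesis s_small : small_radius m kap b s.
Hypothesis s_small0 : small_radius m kap 0 s.

(** The parameter enters the recursion only at the resonant weight m. *)
Lemma F_coef_below (k : nat) : (k < m)%nat -> F_coef m p kap b k = F_coef m p kap 0 k.
Proof.
  induction k as [k IH] using lt_wf_ind. intros Hk. destruct k as [|k]; [reflexivity|].
  rewrite !F_coef_S by exact m_pos. unfold F_step. f_equal. apply psum1_ext. intros j Hj.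
  f_equal. f_equal; [|apply IH; lia].
  rewrite (u_coef_ext m kap b m_pos _ (F_coef m p kap 0) j) by (intros; apply IH; lia).
  unfold u_coef. destruct (Nat.eqb_spec j m); [lia|reflexivity].
Qed.

Lemma U_below (k : nat) : (k < m)%nat -> U_coef m p kap b k = U_coef m p kap 0 k.
Proof.
  intros Hk. unfold U_coef.
  rewrite (u_coef_ext m kap b m_pos _ (F_coef m p kap 0) k) by (intros; apply F_coef_below; lia).
  unfold u_coef. destruct (Nat.eqb_spec k m); [lia|reflexivity].
Qed.

Lemma U_resonant (t : R) : peval (U_coef m p kap b m) t - peval (U_coef m p kap 0 m) t = b.
Proof.
  unfold U_coef.
  rewrite (u_coef_ext m kap b m_pos _ (F_coef m p kap 0) m) by (intros; apply F_coef_below; lia).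
  unfold u_coef. rewrite (proj2 (Nat.eqb_neq m 0)), (proj2 (Nat.eqb_eq m m)) by lia.
  simpl. ring.
Qed.

(** Weights below m cancel, weight m contributes exactly b x, and the tail is x times a quantity of
    order x^beta (1 + |ln x|)^(m+1). *)
Lemma parameter_lim :
  lim0 (fun x => (u_sum m p kap b (ln x) - u_sum m p kap 0 (ln x)) / x) b.
Proof.
  pose proof s_small as ((Hs & _) & _).
  destruct (in_domain_left m kap b s m_pos s_small) as (T & HT0 & HT).
  destruct (U_terms_summable m p kap b s m_pos p_range kap_nonneg s_small) as (Gb & Lb).
  destruct (U_terms_summable m p kap 0 s m_pos p_range kap_nonneg s_small0) as (G0 & L0).
  pose proof (dominated_U m p kap b s m_pos s_small) as DU.
  pose proof (dominated_U m p kap 0 s m_pos s_small0) as DU0.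
  (* The tail is at most 4 q^(m+1) with q = 8 [sig_log] / s: m of the factors x^beta make up x, and
     4 is 8 times the two bounds 1/4 on the majorant series. *)
  apply (lim0_squeeze _
    (fun x => 4 * (8 / s) ^ S m * (exp (bet m * ln x) * (1 + Rabs (ln x)) ^ S m)) _ (exp T));
    [apply exp_pos| |].
  - intros x Hx.
    assert (Hln : ln x < T) by (rewrite <- (ln_exp T); apply ln_increasing; lra).
    set (t := ln x) in *. assert (Hdom : in_domain m s t) by now apply HT.
    set (q := sig_log m t / (s / 8)).
    assert (Hq : 0 <= q <= 1) by now apply (in_domain_ratio m kap b s).
    set (gb := fun k => pnorm (rho m) (U_coef m p kap b k) * s ^ k) in *.
    set (g0 := fun k => pnorm (rho m) (U_coef m p kap 0 k) * s ^ k) in *.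
    assert (Hgb : forall k, 0 <= gb k) by (intros; now apply (U_term_nonneg m p kap b)).
    assert (Hg0 : forall k, 0 <= g0 k) by (intros; now apply (U_term_nonneg m p kap 0)).
    set (d := fun k => vterm m (U_coef m p kap b) k t - vterm m (U_coef m p kap 0) k t).
    assert (X1 : ex_series (fun k => vterm m (U_coef m p kap b) k t)).
    { now apply (ex_series_vterm m p kap b s). }
    assert (X2 : ex_series (fun k => vterm m (U_coef m p kap 0) k t)).
    { now apply (ex_series_vterm m p kap 0 s). }
    assert (Xd : ex_series d) by (now apply (ex_series_minus (fun k => vterm m (U_coef m p kap b) k t))).
    assert (Ex : yexp m t ^ m = x) by (rewrite yexp_pow_m by exact m_pos; unfold t; apply exp_ln; lra).
    assert (Esum : sum_f_R0 d m = x * b).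
    { replace m with (S (m - 1)) at 1 by lia. rewrite tech5. replace (S (m - 1)) with m by lia.
      rewrite (sum_eq d (fun _ => 0)).
      - replace (sum_f_R0 (fun _ : nat => 0) (m - 1)) with 0.
        + unfold d, vterm. rewrite <- Rmult_minus_distr_l, U_resonant, Ex. ring.
        + clear. induction (m - 1)%nat as [|n IH]; simpl; lra.
      - intros i Hi. unfold d, vterm. rewrite U_below by lia. ring. }
    assert (Ed : u_sum m p kap b t - u_sum m p kap 0 t = x * b + Series (fun k => d (S m + k)%nat)).
    { unfold u_sum, vsum. rewrite <- Series_minus by assumption. fold d.
      rewrite (Series_incr_n d (S m)) by (try lia; exact Xd). simpl pred. now rewrite Esum. }
    assert (Gt : ex_series (fun k => 8 * gb k + 8 * g0 k)).
    { apply (ex_series_plus (fun k => 8 * gb k) (fun k => 8 * g0 k)).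
      - now apply (ex_series_scal_l 8 gb).
      - now apply (ex_series_scal_l 8 g0). }
    assert (Bt : Rabs (Series (fun k => d (S m + k)%nat)) <= q ^ S m * 4).
    { eapply Rle_trans.
      - apply (Series_abs_le _ (fun k => q ^ S m * (8 * gb (S m + k)%nat + 8 * g0 (S m + k)%nat))).
        + intros k. unfold d.
          pose proof (vterm_dominated m p kap b s m_pos s_small _ (S m + k) t DU) as B1.
          pose proof (vterm_dominated m p kap 0 s m_pos s_small0 _ (S m + k) t DU0) as B2.
          fold q in B1, B2.
          assert (Hqk : q ^ (S m + k) <= q ^ S m).
          { rewrite pow_add. assert (q ^ k <= 1) by (rewrite <- (pow1 k); now apply pow_incr).
            assert (0 <= q ^ S m) by (apply pow_le; lra). nra. }
          pose proof (Hgb (S m + k)%nat) as Z1. pose proof (Hg0 (S m + k)%nat) as Z2.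
          unfold Rminus. eapply Rle_trans; [apply Rabs_triang|]. rewrite Rabs_Ropp.
          assert (q ^ (S m + k) * (8 * gb (S m + k)%nat) <= q ^ S m * (8 * gb (S m + k)%nat))
            by (apply Rmult_le_compat_r; lra).
          assert (q ^ (S m + k) * (8 * g0 (S m + k)%nat) <= q ^ S m * (8 * g0 (S m + k)%nat))
            by (apply Rmult_le_compat_r; lra).
          unfold gb, g0 in *. lra.
        + apply (ex_series_scal_l (q ^ S m) (fun k => 8 * gb (S m + k)%nat + 8 * g0 (S m + k)%nat)).
          now apply (ex_series_incr_n (fun k => 8 * gb k + 8 * g0 k) (S m)).
      - rewrite Series_scal_l. apply Rmult_le_compat_l; [apply pow_le; lra|].
        apply Rle_trans with (Series (fun k => 8 * gb k + 8 * g0 k)).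
        + rewrite (Series_incr_n (fun k => 8 * gb k + 8 * g0 k) (S m)) by (try lia; exact Gt).
          assert (0 <= sum_f_R0 (fun k => 8 * gb k + 8 * g0 k) (pred (S m))).
          { apply cond_pos_sum. intros k. pose proof (Hgb k). pose proof (Hg0 k). lra. }
          lra.
        + rewrite Series_plus, !Series_scal_l;
            [lra|now apply (ex_series_scal_l 8 gb)|now apply (ex_series_scal_l 8 g0)]. }
    rewrite Ed.
    replace ((x * b + Series (fun k => d (S m + k)%nat)) / x - b)
      with (Series (fun k => d (S m + k)%nat) / x) by (field; lra).
    unfold Rdiv at 1. rewrite Rabs_mult, Rabs_inv, (Rabs_right x) by lra.
    apply (Rmult_le_reg_r x); [lra|]. rewrite Rmult_assoc, Rinv_l, Rmult_1_r by lra.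
    eapply Rle_trans; [exact Bt|]. apply Req_le.
    replace (q ^ S m) with ((8 / s) ^ S m * sig_log m t ^ S m).
    + unfold sig_log. rewrite Rpow_mult_distr. fold (yexp m t).
      replace (yexp m t ^ S m) with (yexp m t * x) by (rewrite <- Ex; reflexivity). ring.
    + rewrite <- Rpow_mult_distr. f_equal. unfold q. field. lra.
  - apply (lim0_eq _ (4 * (8 / s) ^ S m * 0)); [|ring]. apply lim0_mult; [apply lim0_const|].
    apply lim0_intro. intros e He.
    destruct (exp_decay (bet m) e (S m)) as (T' & _ & HT').
    + split; [now apply bet_pos|now apply bet_le1].
    + lia.
    + exact He.
    + exists (exp T'). split; [apply exp_pos|]. intros x Hx.
      assert (Hln : ln x < T') by (rewrite <- (ln_exp T'); apply ln_increasing; lra).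
      specialize (HT' _ Hln). rewrite Rminus_0_r, Rabs_right; [exact HT'|].
      apply Rle_ge. apply Rmult_le_pos; [apply Rlt_le, exp_pos|].
      apply pow_le. pose proof (Rabs_pos (ln x)). lra.
Qed.

End FreeParameter.

(** * Absolutely convergent double series *)

Definition dabs (f : nat -> nat -> R) : Prop :=
  (forall i, ex_series (fun j => Rabs (f i j))) /\
  ex_series (fun i => Series (fun j => Rabs (f i j))).

Definition dsum (f : nat -> nat -> R) : R := Series (fun i => Series (fun j => f i j)).

Lemma dabs_ex_inner (f : nat -> nat -> R) (i : nat) : dabs f -> ex_series (fun j => f i j).
Proof. intros (H & _). apply ex_series_Rabs, H. Qed.

Lemma dabs_ex_outer (f : nat -> nat -> R) : dabs f -> ex_series (fun i => Series (fun j => f i j)).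
Proof.
  intros (H & H'). apply (ex_series_dominated _ (fun i => Series (fun j => Rabs (f i j)))); [|exact H'].
  intros i. apply Series_Rabs, H.
Qed.

Lemma dabs_is_abs_sum2 (f : nat -> nat -> R) : dabs f -> is_abs_sum2 f (dsum f).
Proof.
  intros Hf. split; [apply Hf|split; [apply Hf|]].
  apply (Series_correct (fun i => Series (f i))). now apply dabs_ex_outer.
Qed.

Lemma dabs_ext (f g : nat -> nat -> R) : (forall i j, f i j = g i j) -> dabs f -> dabs g.
Proof.
  intros E (H & H'). split.
  - intros i. apply (ex_series_ext (fun j => Rabs (f i j))); [|apply H]. intros j. now rewrite E.
  - apply (ex_series_ext (fun i => Series (fun j => Rabs (f i j)))); [|exact H'].
    intros i. apply Series_ext. intros j. now rewrite E.
Qed.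

Lemma dsum_ext (f g : nat -> nat -> R) : (forall i j, f i j = g i j) -> dsum f = dsum g.
Proof. intros E. apply Series_ext. intros i. apply Series_ext. intros j. apply E. Qed.

Lemma dabs_le (f g : nat -> nat -> R) :
  (forall i j, Rabs (f i j) <= g i j) -> dabs g -> dabs f.
Proof.
  intros H Hg.
  assert (Hi : forall i, ex_series (fun j => Rabs (f i j))).
  { intros i. apply (ex_series_dominated _ (g i)); [|now apply dabs_ex_inner].
    intros j. now rewrite Rabs_Rabsolu. }
  split; [exact Hi|].
  apply (ex_series_dominated _ (fun i => Series (fun j => g i j))); [|now apply dabs_ex_outer].
  intros i. apply Series_abs_le; [|now apply dabs_ex_inner].
  intros j. now rewrite Rabs_Rabsolu.
Qed.

Lemma sum_f_R0_Series (f : nat -> nat -> R) (n : nat) :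
  (forall j, ex_series (fun i => f i j)) ->
  ex_series (fun i => sum_f_R0 (fun j => f i j) n) /\
  sum_f_R0 (fun j => Series (fun i => f i j)) n = Series (fun i => sum_f_R0 (fun j => f i j) n).
Proof.
  intros H. induction n as [|n (IH1 & IH2)]; [split; [apply H|reflexivity]|].
  split.
  - apply (ex_series_plus (fun i => sum_f_R0 (fun j => f i j) n) (fun i => f i (S n))); auto.
  - simpl. rewrite IH2. symmetry. apply Series_plus; auto.
Qed.

Lemma sum_f_R0_le_Series (a : nat -> R) (n : nat) :
  (forall k, 0 <= a k) -> ex_series a -> sum_f_R0 a n <= Series a.
Proof.
  intros Ha Hex. rewrite (Series_incr_n a (S n)) by (try lia; exact Hex). simpl pred.
  assert (0 <= Series (fun k => a (S n + k)%nat)); [|lra].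
  apply Series_nonneg; [intros; apply Ha|]. now apply (ex_series_incr_n a (S n)).
Qed.

(** Finitely many columns can be summed inside the row series by linearity, and each partial row sum
    is below the full one. *)
Lemma fubini_nonneg_le (f : nat -> nat -> R) : (forall i j, 0 <= f i j) -> dabs f ->
  dabs (fun j i => f i j) /\ dsum (fun j i => f i j) <= dsum f.
Proof.
  intros Hp Hf.
  assert (Hj : forall j, ex_series (fun i => f i j)).
  { intros j. apply (ex_series_dominated _ (fun i => Series (fun j => f i j))); [|now apply dabs_ex_outer].
    intros i. rewrite Rabs_right by (apply Rle_ge, Hp).
    eapply Rle_trans; [|apply (sum_f_R0_le_Series (f i) j); [apply Hp|now apply dabs_ex_inner]].
    destruct j as [|j]; [simpl; lra|]. rewrite tech5.
    assert (0 <= sum_f_R0 (f i) j) by (apply cond_pos_sum; intros; apply Hp). lra. }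
  destruct (ex_series_of_bounded (fun j => Series (fun i => f i j)) (dsum f)) as (Hex & Hle).
  - intros j. apply Series_nonneg; [intros; apply Hp|apply Hj].
  - intros n. destruct (sum_f_R0_Series f n Hj) as (X & ->).
    apply Series_le; [|now apply dabs_ex_outer]. intros i. split.
    + apply cond_pos_sum. intros; apply Hp.
    + apply sum_f_R0_le_Series; [apply Hp|now apply dabs_ex_inner].
  - split; [split|exact Hle].
    + intros j. apply (ex_series_ext (fun i => f i j)); [|apply Hj].
      intros i. now rewrite Rabs_right by (apply Rle_ge, Hp).
    + apply (ex_series_ext (fun j => Series (fun i => f i j))); [|exact Hex].
      intros j. apply Series_ext. intros i. now rewrite Rabs_right by (apply Rle_ge, Hp).
Qed.

(** Applying the inequality to the transpose as well gives equality. *)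
Lemma fubini_nonneg (f : nat -> nat -> R) : (forall i j, 0 <= f i j) -> dabs f ->
  dabs (fun j i => f i j) /\ dsum (fun j i => f i j) = dsum f.
Proof.
  intros Hp Hf. destruct (fubini_nonneg_le f Hp Hf) as (Hf' & Hle). split; [exact Hf'|].
  apply Rle_antisym; [exact Hle|].
  exact (proj2 (fubini_nonneg_le (fun j i => f i j) (fun j i => Hp i j) Hf')).
Qed.

Lemma dabs_Rabs (f : nat -> nat -> R) : dabs f -> dabs (fun i j => Rabs (f i j)).
Proof.
  intros (H & H'). split.
  - intros i. apply (ex_series_ext (fun j => Rabs (f i j))); [|apply H].
    intros j. now rewrite Rabs_Rabsolu.
  - apply (ex_series_ext (fun i => Series (fun j => Rabs (f i j)))); [|exact H'].
    intros i. apply Series_ext. intros j. now rewrite Rabs_Rabsolu.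
Qed.

Lemma dsum_minus (f g : nat -> nat -> R) : dabs f -> dabs g ->
  dsum (fun i j => f i j - g i j) = dsum f - dsum g.
Proof.
  intros Hf Hg. unfold dsum. rewrite <- Series_minus by now apply dabs_ex_outer.
  apply Series_ext. intros i. apply Series_minus; now apply dabs_ex_inner.
Qed.

Lemma dabs_scal (c : R) (f : nat -> nat -> R) : dabs f -> dabs (fun i j => c * f i j).
Proof.
  intros (H & H'). split.
  - intros i. apply (ex_series_ext (fun j => Rabs c * Rabs (f i j))); [intros; now rewrite Rabs_mult|].
    now apply (ex_series_scal_l (Rabs c) (fun j => Rabs (f i j))).
  - apply (ex_series_ext (fun i => Rabs c * Series (fun j => Rabs (f i j)))).
    + intros i. rewrite <- Series_scal_l. apply Series_ext. intros j. now rewrite Rabs_mult.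
    + now apply (ex_series_scal_l (Rabs c) (fun i => Series (fun j => Rabs (f i j)))).
Qed.

(** Reduced to nonnegative terms by writing f as |f| - (|f| - f). *)
Lemma fubini (f : nat -> nat -> R) : dabs f ->
  dabs (fun j i => f i j) /\ dsum (fun j i => f i j) = dsum f.
Proof.
  intros Hf. pose proof (dabs_Rabs f Hf) as Ha.
  set (g := fun i j => Rabs (f i j) - f i j).
  assert (Hg : dabs g).
  { apply (dabs_le g (fun i j => 2 * Rabs (f i j))); [|now apply dabs_scal].
    intros i j. unfold g. unfold Rabs. repeat destruct Rcase_abs; lra. }
  assert (Hgp : forall i j, 0 <= g i j).
  { intros i j. unfold g. pose proof (Rle_abs (f i j)). lra. }
  destruct (fubini_nonneg _ (fun i j => Rabs_pos (f i j)) Ha) as (Ta & Ea).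
  destruct (fubini_nonneg g Hgp Hg) as (Tg & Eg).
  split.
  - apply (dabs_le _ (fun j i => Rabs (f i j))); [intros; lra|exact Ta].
  - rewrite (dsum_ext (fun j i => f i j) (fun j i => Rabs (f i j) - g i j)) by (intros; unfold g; ring).
    rewrite (dsum_ext f (fun i j => Rabs (f i j) - g i j)) by (intros; unfold g; ring).
    rewrite !dsum_minus by assumption. now rewrite Ea, Eg.
Qed.

(** * Change of centre of a power series *)

Lemma is_series_finite (h : nat -> R) (n : nat) :
  is_series (fun k => if (k <=? n)%nat then h k else 0) (sum_f_R0 h n).
Proof.
  set (a := fun k => if (k <=? n)%nat then h k else 0).
  assert (E : sum_f_R0 h n = sum_f_R0 a n).
  { apply sum_eq. intros i Hi. unfold a. now rewrite (proj2 (Nat.leb_le i n) Hi). }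
  rewrite E, <- sum_n_Reals.
  change (is_lim_seq (sum_n a) (Finite (sum_n a n))).
  apply (is_lim_seq_incr_n (sum_n a) (S n)).
  apply (is_lim_seq_ext (fun _ => sum_n a n)); [|apply is_lim_seq_const].
  intros k. assert (Ek : forall k, sum_n a (n + k) = sum_n a n).
  { clear k. intros k. induction k as [|k IH]; [now rewrite Nat.add_0_r|].
    rewrite Nat.add_succ_r, sum_Sn, IH. unfold a at 2.
    rewrite (proj2 (Nat.leb_gt (S (n + k)) n)) by lia. apply Rplus_0_r. }
  rewrite <- (Ek (S k)). f_equal. lia.
Qed.

Lemma is_series_Rscal (c : R) (a : nat -> R) (l : R) :
  is_series a l -> is_series (fun k => c * a k) (c * l).
Proof. intros H. exact (@is_series_scal_l R_AbsRing R_NormedModule c a l H). Qed.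

Definition binom_term (p y : R) (i k : nat) : R :=
  if (k <=? i)%nat then Binomial.C i k * y ^ k * p ^ (i - k) else 0.

Lemma C_nonneg (n k : nat) : 0 <= Binomial.C n k.
Proof.
  unfold Binomial.C. apply Rle_mult_inv_pos; [apply Rlt_le, INR_fact_lt_0|].
  apply Rmult_lt_0_compat; apply INR_fact_lt_0.
Qed.

Lemma is_series_binom (p y : R) (i : nat) : is_series (binom_term p y i) ((p + y) ^ i).
Proof.
  rewrite Rplus_comm, binomial. apply (is_series_finite (fun k => Binomial.C i k * y ^ k * p ^ (i - k))).
Qed.

Lemma Rabs_binom_term (p y : R) (i k : nat) :
  Rabs (binom_term p y i k) = binom_term (Rabs p) (Rabs y) i k.
Proof.
  unfold binom_term. destruct (k <=? i)%nat; [|apply Rabs_R0].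
  rewrite !Rabs_mult, !RPow_abs, (Rabs_right (Binomial.C i k)) by (apply Rle_ge, C_nonneg). reflexivity.
Qed.

Lemma binom_term_pow (p y : R) (i k : nat) : binom_term p y i k = binom_term p 1 i k * y ^ k.
Proof. unfold binom_term. destruct (k <=? i)%nat; [rewrite pow1|]; ring. Qed.

(** The k-th Taylor coefficient at p of the power series with coefficients b. *)
Definition recenter (b : nat -> R) (p : R) (k : nat) : R :=
  Series (fun i => b i * binom_term p 1 i k).

Lemma recenter_dabs (b : nat -> R) (p y R0 : R) :
  Rabs p + Rabs y <= R0 -> ex_series (fun i => Rabs (b i) * R0 ^ i) ->
  dabs (fun i k => b i * binom_term p y i k).
Proof.
  intros Hle Hb. pose proof (Rabs_pos p). pose proof (Rabs_pos y).
  assert (Hi : forall i, is_series (fun k => Rabs (b i * binom_term p y i k))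
     (Rabs (b i) * (Rabs p + Rabs y) ^ i)).
  { intros i. apply (is_series_ext (fun k => Rabs (b i) * binom_term (Rabs p) (Rabs y) i k)).
    - intros k. now rewrite Rabs_mult, Rabs_binom_term.
    - apply is_series_Rscal. apply is_series_binom. }
  split; [intros i; eexists; apply Hi|].
  apply (ex_series_dominated _ (fun i => Rabs (b i) * R0 ^ i)); [|exact Hb].
  intros i. rewrite (is_series_unique _ _ (Hi i)).
  rewrite Rabs_right by (apply Rle_ge, Rmult_le_pos; [apply Rabs_pos|apply pow_le; lra]).
  apply Rmult_le_compat_l; [apply Rabs_pos|]. apply pow_incr. lra.
Qed.

Lemma recenter_value (b : nat -> R) (p y R0 : R) :
  Rabs p + Rabs y <= R0 -> ex_series (fun i => Rabs (b i) * R0 ^ i) ->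
  Series (fun k => recenter b p k * y ^ k) = Series (fun i => b i * (p + y) ^ i).
Proof.
  intros Hle Hb. destruct (fubini _ (recenter_dabs b p y R0 Hle Hb)) as (_ & E).
  transitivity (dsum (fun k i => b i * binom_term p y i k)).
  - apply Series_ext. intros k. unfold recenter. rewrite <- Series_scal_r.
    apply Series_ext. intros i. rewrite (binom_term_pow p y). ring.
  - rewrite E. apply Series_ext. intros i. rewrite Series_scal_l.
    now rewrite (is_series_unique _ _ (is_series_binom p y i)).
Qed.

Lemma recenter_abs_le (b : nat -> R) (p r R0 : R) : 0 <= r ->
  Rabs p + r <= R0 -> ex_series (fun i => Rabs (b i) * R0 ^ i) ->
  ex_series (fun k => Rabs (recenter b p k * r ^ k)) /\
  Series (fun k => Rabs (recenter b p k * r ^ k)) <= Series (fun i => Rabs (b i) * R0 ^ i).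
Proof.
  intros Hr Hle Hb. pose proof (Rabs_pos p).
  assert (Hb' : ex_series (fun i => Rabs (Rabs (b i)) * R0 ^ i)).
  { apply (ex_series_ext (fun i => Rabs (b i) * R0 ^ i)); [|exact Hb].
    intros i. now rewrite Rabs_Rabsolu. }
  assert (Hle' : Rabs (Rabs p) + Rabs r <= R0) by (rewrite Rabs_Rabsolu, (Rabs_right r); lra).
  destruct (fubini _ (recenter_dabs (fun i => Rabs (b i)) (Rabs p) r R0 Hle' Hb')) as (TD & TE).
  assert (Hpt : forall k, Rabs (recenter b p k * r ^ k)
     <= Series (fun i => Rabs (b i) * binom_term (Rabs p) r i k)).
  { intros k. unfold recenter. rewrite <- Series_scal_r. apply Series_abs_le.
    - intros i. rewrite Rmult_assoc, <- binom_term_pow, Rabs_mult, Rabs_binom_term.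
      rewrite (Rabs_right r) by lra. apply Rle_refl.
    - apply (dabs_ex_inner _ k TD). }
  assert (Xo : ex_series (fun k => Series (fun i => Rabs (b i) * binom_term (Rabs p) r i k)))
    by apply (dabs_ex_outer _ TD).
  split.
  - apply (ex_series_dominated _ _ (fun k => ltac:(rewrite Rabs_Rabsolu; apply Hpt)) Xo).
  - eapply Rle_trans; [apply Series_le; [|exact Xo]; intros k; split; [apply Rabs_pos|apply Hpt]|].
    fold (dsum (fun k i => Rabs (b i) * binom_term (Rabs p) r i k)). rewrite TE.
    apply Series_le; [|exact Hb]. intros i.
    rewrite Series_scal_l, (is_series_unique _ _ (is_series_binom (Rabs p) r i)).
    split; [apply Rmult_le_pos; [apply Rabs_pos|apply pow_le; lra]|].
    apply Rmult_le_compat_l; [apply Rabs_pos|]. apply pow_incr. lra.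
Qed.

Definition monomials (a : nat -> nat -> R) (x1 x2 : R) (i j : nat) : R := a i j * x1 ^ i * x2 ^ j.

Lemma dabs_monomials_le (a : nat -> nat -> R) (x1 x2 R1 R2 : R) :
  Rabs x1 <= R1 -> Rabs x2 <= R2 -> dabs (monomials a R1 R2) -> dabs (monomials a x1 x2).
Proof.
  intros H1 H2 Ha. pose proof (Rabs_pos x1). pose proof (Rabs_pos x2).
  apply (dabs_le _ (fun i j => Rabs (monomials a R1 R2 i j))); [|now apply dabs_Rabs].
  intros i j. unfold monomials. rewrite !Rabs_mult, <- !RPow_abs.
  rewrite (Rabs_right R1), (Rabs_right R2) by lra.
  apply Rmult_le_compat.
  - apply Rmult_le_pos; [apply Rabs_pos|]. apply pow_le. lra.
  - apply pow_le. lra.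
  - apply Rmult_le_compat_l; [apply Rabs_pos|]. now apply pow_incr.
  - now apply pow_incr.
Qed.

(** Only the second variable is moved to p, which is a one-variable statement for each i. Its norm
    estimate has constant 1, so the sum over i still converges. *)
Lemma recenter_inner (a : nat -> nat -> R) (R1 R2 p r : R) :
  0 < R1 -> 0 < R2 -> 0 <= r -> Rabs p + r <= R2 -> dabs (monomials a R1 R2) ->
  dabs (monomials (fun i => recenter (a i) p) R1 r) /\
  forall x1 y, Rabs y <= r ->
    dsum (monomials (fun i => recenter (a i) p) x1 y) = dsum (monomials a x1 (p + y)).
Proof.
  intros H1 H2 Hr Hp Ha.
  assert (Hi : forall i, ex_series (fun j => Rabs (a i j) * R2 ^ j)).
  { intros i. destruct Ha as (Ha & _). specialize (Ha i).
    assert (HR : 0 < R1 ^ i) by (now apply pow_lt).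
    apply (ex_series_ext (fun j => / R1 ^ i * Rabs (monomials a R1 R2 i j))).
    - intros j. unfold monomials. rewrite !Rabs_mult, (Rabs_right (R1 ^ i)), (Rabs_right (R2 ^ j)).
      + change (/ R1 ^ i * (Rabs (a i j) * R1 ^ i * R2 ^ j) = Rabs (a i j) * R2 ^ j). field. lra.
      + apply Rle_ge, pow_le. lra.
      + lra.
    - now apply (ex_series_scal_l (/ R1 ^ i) (fun j => Rabs (monomials a R1 R2 i j))). }
  split.
  - assert (Eabs : forall i l, Rabs (monomials (fun i => recenter (a i) p) R1 r i l)
       = R1 ^ i * Rabs (recenter (a i) p l * r ^ l)).
    { intros i l. unfold monomials. rewrite !Rabs_mult, (Rabs_right (R1 ^ i)); [ring|].
      apply Rle_ge, pow_le. lra. }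
    assert (Xi : forall i, ex_series (fun l => Rabs (monomials (fun i => recenter (a i) p) R1 r i l))).
    { intros i. apply (ex_series_ext (fun l => R1 ^ i * Rabs (recenter (a i) p l * r ^ l))).
      - intros l. now rewrite Eabs.
      - apply (ex_series_scal_l (R1 ^ i) (fun l => Rabs (recenter (a i) p l * r ^ l))).
        now apply (recenter_abs_le (a i) p r R2). }
    split; [exact Xi|].
    apply (ex_series_dominated _ (fun i => Series (fun j => Rabs (monomials a R1 R2 i j)))); [|apply Ha].
    intros i. rewrite Rabs_right by (apply Rle_ge, Series_nonneg; [intros; apply Rabs_pos|apply Xi]).
    rewrite (Series_ext _ (fun l => R1 ^ i * Rabs (recenter (a i) p l * r ^ l))) by apply Eabs.
    rewrite (Series_ext (fun j => Rabs (monomials a R1 R2 i j))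
               (fun j => R1 ^ i * (Rabs (a i j) * R2 ^ j))).
    + rewrite !Series_scal_l. apply Rmult_le_compat_l; [apply pow_le; lra|].
      now apply (recenter_abs_le (a i) p r R2).
    + intros j. unfold monomials. rewrite !Rabs_mult, (Rabs_right (R1 ^ i)), (Rabs_right (R2 ^ j)).
      * ring.
      * apply Rle_ge, pow_le. lra.
      * apply Rle_ge, pow_le. lra.
  - intros x1 y Hy. apply Series_ext. intros i. unfold monomials.
    rewrite (Series_ext _ (fun l => x1 ^ i * (recenter (a i) p l * y ^ l))) by (intros; ring).
    rewrite (Series_ext (fun j => a i j * x1 ^ i * (p + y) ^ j)
               (fun j => x1 ^ i * (a i j * (p + y) ^ j))) by (intros; ring).
    rewrite !Series_scal_l. f_equal. apply (recenter_value (a i) p y R2); [lra|apply Hi].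
Qed.

(** A two-variable Taylor shift as two one-variable ones: recenter the second variable, transpose by
    Fubini, recenter the other variable, transpose back. *)
Lemma analytic2_of_dabs (a : nat -> nat -> R) (R1 R2 p1 p2 : R) :
  dabs (monomials a R1 R2) -> Rabs p1 < R1 -> Rabs p2 < R2 ->
  analytic2_at (fun x1 x2 => dsum (monomials a x1 x2)) p1 p2.
Proof.
  intros Ha H1 H2. pose proof (Rabs_pos p1). pose proof (Rabs_pos p2).
  set (r1 := R1 - Rabs p1). set (r2 := R2 - Rabs p2).
  destruct (recenter_inner a R1 R2 p2 r2) as (Ha1 & Ev1);
    [lra|lra|unfold r2; lra|unfold r2; lra|exact Ha|].
  set (a1 := fun i => recenter (a i) p2) in *.
  set (a1T := fun l i => a1 i l).
  assert (Ha1T : dabs (monomials a1T r2 R1)).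
  { apply (dabs_ext (fun l i => monomials a1 R1 r2 i l)).
    - intros l i. unfold monomials, a1T. ring.
    - now apply fubini. }
  destruct (recenter_inner a1T r2 R1 p1 r1) as (Ha2 & Ev2);
    [unfold r2; lra|lra|unfold r1; lra|unfold r1; lra|exact Ha1T|].
  set (a2 := fun l => recenter (a1T l) p1) in *.
  set (c := fun k l => a2 l k).
  assert (Hc : dabs (monomials c r1 r2)).
  { apply (dabs_ext (fun k l => monomials a2 r2 r1 l k)).
    - intros k l. unfold monomials, c. ring.
    - now apply fubini. }
  exists c, (Rmin r1 r2). split; [unfold r1, r2; apply Rmin_glb_lt; lra|].
  intros x1 x2 (B1 & B2). pose proof (Rmin_l r1 r2). pose proof (Rmin_r r1 r2).
  set (y1 := x1 - p1) in *. set (y2 := x2 - p2) in *.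
  assert (Dc : dabs (monomials c y1 y2)) by (apply (dabs_monomials_le c y1 y2 r1 r2); lra || exact Hc).
  assert (Da2 : dabs (monomials a2 y2 y1)) by (apply (dabs_monomials_le a2 y2 y1 r2 r1); lra || exact Ha2).
  assert (Hx1 : Rabs x1 <= R1).
  { replace x1 with (p1 + y1) by (unfold y1; ring). pose proof (Rabs_triang p1 y1). unfold r1 in *. lra. }
  assert (Da1T : dabs (monomials a1T y2 x1)).
  { apply (dabs_monomials_le a1T y2 x1 r2 R1); lra || exact Ha1T. }
  replace (dsum (monomials a x1 x2)) with (dsum (monomials c y1 y2)).
  { exact (dabs_is_abs_sum2 _ Dc). }
  transitivity (dsum (monomials a2 y2 y1)).
  { rewrite <- (proj2 (fubini _ Dc)). apply dsum_ext. intros i j. unfold monomials, c. ring. }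
  rewrite Ev2 by lra. replace (p1 + y1) with x1 by (unfold y1; ring).
  transitivity (dsum (monomials a1 x1 y2)).
  { rewrite <- (proj2 (fubini _ Da1T)). apply dsum_ext. intros i j. unfold monomials, a1T. ring. }
  rewrite Ev1 by lra. f_equal. unfold y2. f_equal. ring.
Qed.

(** Passes from the weight k to the exponent j = k - i m of xi; the degree bound makes row i vanish
    below weight i m, so no term is lost. *)
Lemma dabs_shift (f : nat -> nat -> R) (m : nat) :
  (forall i k, (k < i * m)%nat -> f i k = 0) -> dabs f ->
  dabs (fun i j => f i (i * m + j)%nat) /\ dsum (fun i j => f i (i * m + j)%nat) = dsum f.
Proof.
  intros Hz Hf.
  assert (Hgen : forall h : nat -> nat -> R, (forall i k, (k < i * m)%nat -> h i k = 0) ->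
    (forall i, ex_series (h i)) ->
    forall i, Series (fun j => h i (i * m + j)%nat) = Series (h i)).
  { intros h Hh Hex i. destruct (i * m)%nat as [|n] eqn:E; [reflexivity|].
    rewrite (Series_incr_n (h i) (S n)) by (try lia; apply Hex).
    simpl pred. rewrite (sum_eq _ (fun _ => 0)).
    - replace (sum_f_R0 (fun _ : nat => 0) n) with 0; [ring|].
      clear. induction n as [|n IH]; simpl; lra.
    - intros k Hk. apply Hh. lia. }
  split; [split|].
  - intros i. apply (ex_series_incr_n (fun k => Rabs (f i k)) (i * m)). apply Hf.
  - apply (ex_series_ext (fun i => Series (fun k => Rabs (f i k)))); [|apply Hf].
    intros i. symmetry. apply (Hgen (fun i k => Rabs (f i k))).
    + intros i' k Hk. rewrite Hz by exact Hk. apply Rabs_R0.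
    + apply Hf.
  - apply Series_ext. intros i. apply (Hgen f Hz). intros i'. now apply dabs_ex_inner.
Qed.

Lemma is_series_pnorm (r : R) (P : list R) :
  is_series (fun i => Rabs (nth i P 0) * r ^ i) (pnorm r P).
Proof.
  induction P as [|a P IH].
  - apply (is_series_ext (fun k => if (k <=? 0)%nat then 0 else 0)).
    + intros [|k]; simpl; rewrite Rabs_R0; ring.
    + apply (is_series_finite (fun _ => 0) 0).
  - apply is_series_decr_1. cbn [pnorm nth].
    match goal with |- is_series _ ?l => replace l with (r * pnorm r P) end.
    2: { unfold plus, opp; simpl. ring. }
    apply (is_series_ext (fun i => r * (Rabs (nth i P 0) * r ^ i))).
    + intros i. simpl. ring.
    + apply is_series_Rscal. exact IH.
Qed.

Lemma is_series_peval (x : R) (P : list R) : is_series (fun i => nth i P 0 * x ^ i) (peval P x).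
Proof.
  induction P as [|a P IH].
  - apply (is_series_ext (fun k => if (k <=? 0)%nat then 0 else 0)).
    + intros [|k]; simpl; ring.
    + apply (is_series_finite (fun _ => 0) 0).
  - apply is_series_decr_1. cbn [peval nth].
    match goal with |- is_series _ ?l => replace l with (x * peval P x) end.
    2: { unfold plus, opp; simpl. ring. }
    apply (is_series_ext (fun i => x * (nth i P 0 * x ^ i))).
    + intros i. simpl. ring.
    + apply is_series_Rscal. exact IH.
Qed.

(** * The expansion of the solution *)

Section Expansion.

Variables (m : nat) (p kap b s : R).
Hypothesis m_pos : (1 <= m)%nat.
Hypothesis p_range : 0 <= p <= 2.
Hypothesis kap_nonneg : 0 <= kap.
Hypothesis s_small : small_radius m kap b s.

(* Coefficient of eta^i xi^j, where eta = x ln x and xi = x^bet: since eta^i xi^j has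
   weight i m + j, it is the coefficient of (ln x)^i in weight i m + j. *)
Definition v_coef (i j : nat) : R := nth i (U_coef m p kap b (i * m + j)%nat) 0.

Lemma nth_U_zero (i k : nat) : (k < i * m)%nat -> nth i (U_coef m p kap b k) 0 = 0.
Proof.
  intros H. apply nth_overflow. pose proof (length_U m p kap b m_pos k). nia.
Qed.

Lemma dabs_coefficients : dabs (fun k i => nth i (U_coef m p kap b k) 0 * rho m ^ i * s ^ k).
Proof.
  pose proof s_small as ((Hs & _) & _). pose proof (rho_ge4 m m_pos) as Hr.
  assert (Hi : forall k, is_series (fun i => Rabs (nth i (U_coef m p kap b k) 0 * rho m ^ i * s ^ k))
     (s ^ k * pnorm (rho m) (U_coef m p kap b k))).
  { intros k. apply (is_series_ext
      (fun i => s ^ k * (Rabs (nth i (U_coef m p kap b k) 0) * rho m ^ i))).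
    - intros i. rewrite !Rabs_mult, (Rabs_right (rho m ^ i)), (Rabs_right (s ^ k)).
      + apply Rmult_comm.
      + apply Rle_ge, pow_le. lra.
      + apply Rle_ge, pow_le. lra.
    - apply is_series_Rscal, is_series_pnorm. }
  split; [intros k; eexists; apply Hi|].
  apply (ex_series_ext (fun k => pnorm (rho m) (U_coef m p kap b k) * s ^ k)).
  - intros k. rewrite (is_series_unique _ _ (Hi k)). apply Rmult_comm.
  - apply (U_terms_summable m p kap b s); assumption.
Qed.

(** The radius for eta = x ln x is rho s^m because eta has weight m; the one for xi = x^bet is s. *)
Lemma dabs_v_coef : dabs (monomials v_coef (rho m * s ^ m) s).
Proof.
  destruct (fubini _ dabs_coefficients) as (HT & _).
  destruct (dabs_shift (fun i k => nth i (U_coef m p kap b k) 0 * rho m ^ i * s ^ k) m) as (HS & _).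
  { intros i k Hk. rewrite nth_U_zero by exact Hk. ring. }
  { exact HT. }
  eapply dabs_ext; [|exact HS]. intros i j. unfold monomials, v_coef.
  rewrite Rpow_mult_distr, pow_add, <- pow_mult, (Nat.mul_comm m i). ring.
Qed.

Lemma v_coef_value (t : R) : in_domain m s t ->
  dsum (monomials v_coef (exp t * t) (yexp m t)) = u_sum m p kap b t.
Proof.
  intros Ht. pose proof s_small as ((Hs & _) & _). pose proof (rho_ge4 m m_pos) as Hr.
  set (y := yexp m t). unfold in_domain in Ht.
  pose proof (yexp_pos m t) as Hy. pose proof (yexp_le_sig_log m t) as Hys. fold y in Hy, Hys.
  set (sg := sig_log m t) in *.
  set (h := fun k i => nth i (U_coef m p kap b k) 0 * t ^ i * y ^ k).
  assert (Hh : dabs h).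
  { apply (dabs_le h (fun k i => Rabs (nth i (U_coef m p kap b k) 0 * rho m ^ i * s ^ k)));
      [|apply dabs_Rabs, dabs_coefficients].
    (* In a nonzero term k >= i m, so each ln x can be paired with y^m, and y^m |ln x| <= rho
       s^m. *)
    intros k i. unfold h. destruct (Nat.lt_ge_cases k (i * m)) as [Hlt|Hge].
    - rewrite nth_U_zero by exact Hlt. rewrite !Rmult_0_l, Rabs_R0. lra.
    - rewrite !Rmult_assoc, !(Rabs_mult (nth i (U_coef m p kap b k) 0)).
      apply Rmult_le_compat_l; [apply Rabs_pos|].
      rewrite !Rabs_mult, <- !RPow_abs, (Rabs_right y), (Rabs_right s), (Rabs_right (rho m)) by lra.
      replace k with (m * i + (k - i * m))%nat by lia. rewrite !pow_add, !pow_mult.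
      replace (Rabs t ^ i * ((y ^ m) ^ i * y ^ (k - i * m)))
        with ((y ^ m * Rabs t) ^ i * y ^ (k - i * m)) by (rewrite Rpow_mult_distr; ring).
      replace (rho m ^ i * ((s ^ m) ^ i * s ^ (k - i * m)))
        with ((rho m * s ^ m) ^ i * s ^ (k - i * m)) by (rewrite Rpow_mult_distr; ring).
      assert (Hb : y ^ m * Rabs t <= rho m * s ^ m).
      { eapply Rle_trans; [apply yexp_pow_m_sigma; exact m_pos|]. fold sg.
        apply Rmult_le_compat_l; [lra|]. apply pow_incr. lra. }
      assert (0 <= y ^ m * Rabs t) by (apply Rmult_le_pos; [apply pow_le; lra|apply Rabs_pos]).
      apply Rmult_le_compat.
      + now apply pow_le.
      + apply pow_le. lra.
      + now apply pow_incr.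
      + apply pow_incr. lra. }
  transitivity (dsum h).
  - destruct (fubini _ Hh) as (HT & <-).
    destruct (dabs_shift (fun i k => h k i) m) as (_ & <-).
    { intros i k Hk. unfold h. rewrite nth_U_zero by exact Hk. ring. }
    { exact HT. }
    apply dsum_ext. intros i j. unfold monomials, v_coef, h.
    rewrite <- (yexp_pow_m m t m_pos). fold y.
    rewrite Rpow_mult_distr, pow_add, <- pow_mult, (Nat.mul_comm m i). ring.
  - unfold u_sum, vsum. apply Series_ext. intros k. unfold h, vterm. fold y.
    rewrite Series_scal_r, (is_series_unique _ _ (is_series_peval t (U_coef m p kap b k))). ring.
Qed.

Definition v_fun (x1 x2 : R) : R := dsum (monomials v_coef x1 x2).

Lemma v_fun_0 : v_fun 0 0 = 0.
Proof.
  unfold v_fun. rewrite (dsum_ext _ (fun i j => 0 * monomials v_coef 0 0 i j)).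
  - unfold dsum. rewrite (Series_ext _ (fun i => 0 * Series (fun j => monomials v_coef 0 0 i j))).
    + rewrite Series_scal_l. ring.
    + intros i. apply Series_scal_l.
  - intros i j. unfold monomials. destruct i as [|i]; [destruct j as [|j]|]; try (simpl; ring).
    unfold v_coef. simpl. unfold U_coef, u_coef. simpl. ring.
Qed.

End Expansion.

Lemma small_radius_0 (m : nat) (kap b s : R) :
  (1 <= m)%nat -> small_radius m kap b s -> small_radius m kap 0 s.
Proof.
  intros Hm (Hs & Hb). split; [exact Hs|]. rewrite Rabs_R0. pose proof (Rabs_pos b).
  assert (s * (4 * u_const m kap + 0) <= s * (4 * u_const m kap + Rabs b))
    by (apply Rmult_le_compat_l; lra). lra.
Qed.

Lemma film_solution_is_series (m : nat) (n theta : R) (H : R -> R) :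
  (1 <= m)%nat -> n = 3 - 1 / INR m -> 0 < theta -> film_solution n theta H ->
  exists b c, 0 < c <= 1 /\ forall x, 0 < x < c -> H x = series_solution m theta b x.
Proof.
  intros Hm En Ht HH.
  set (p := 2 - bet m). set (kap := Rpower theta (- p - 1)).
  pose proof (bet_pos m Hm) as Hb. pose proof (bet_le1 m Hm) as Hb1.
  assert (Ep : n - 1 = p) by (unfold p, bet; rewrite En; unfold Rdiv; ring).
  pose proof (film_solution_local n theta H HH) as HL. rewrite Ep in HL.
  assert (Hkap : 0 <= kap) by (apply Rlt_le, Rpower_pos).
  destruct (small_radius_exists m kap 0 Hm Hkap) as (s0 & Hs0).
  destruct (series_solution_local m theta 0 s0 Hm Ht Hs0) as (c0 & K1 & K2 & Hc0 & _ & HK).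
  destruct (comparison_quotient_lim p theta c0 H (Derive_n H 1) (Derive_n H 2)
              (series_solution m theta 0) K1 K2) as (l & Hl);
    [unfold p; lra|exact Ht|lra|lra|now apply (local_solution_restrict p theta 1); [lra|]|exact HK|].
  (* Changing the parameter from 0 to b adds theta b x^2 + o(x^2) to the series solution, so this
     choice cancels the limit l. *)
  set (b := l / theta).
  destruct (small_radius_exists m kap b Hm Hkap) as (s & Hs).
  pose proof (small_radius_0 m kap b s Hm Hs) as Hs'.
  destruct (series_solution_local m theta b s Hm Ht Hs) as (c & J1 & J2 & Hc & _ & HJ).
  destruct (comparison_equal_of_quotient_lim p theta c (bet m) H (Derive_n H 1) (Derive_n H 2)
              (series_solution m theta b) J1 J2) as (c' & Hc' & E);
    [unfold p; lra|exact Ht|lra|lra|exact Hb|reflexivity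
     |now apply (local_solution_restrict p theta 1); [lra|]|exact HJ| |].
  - pose proof (parameter_lim m p kap b s Hm (p_range_bet m Hm) Hkap Hs Hs') as Hpar.
    apply (lim0_ext_loc (fun x => (H x - series_solution m theta 0 x) / (x * x)
      - theta * ((u_sum m p kap b (ln x) - u_sum m p kap 0 (ln x)) / x)) _ _ 1); [lra| |].
    + intros x Hx. unfold series_solution. fold p. fold kap. field. lra.
    + apply (lim0_eq _ (l - theta * b)); [|unfold b; field; lra].
      apply lim0_minus; [exact Hl|]. apply lim0_mult; [apply lim0_const|exact Hpar].
  - exists b, c'. split; [lra|exact E].
Qed.

Lemma film_expansion_exists (m : nat) (n theta : R) (H : R -> R) :
  (1 <= m)%nat -> n = 3 - 1 / INR m -> 0 < theta -> film_solution n theta H ->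
  exists (v : R -> R -> R) (r : R), film_expansion n theta H v r /\ nonzero_on_box v r.
Proof.
  intros Hm En Ht HH.
  destruct (film_solution_is_series m n theta H Hm En Ht HH) as (b & c & Hc & E).
  set (p := 2 - bet m). set (kap := Rpower theta (- p - 1)).
  pose proof (bet_pos m Hm) as Hb. pose proof (bet_le1 m Hm) as Hb1.
  pose proof (p_range_bet m Hm) as Hp.
  assert (Hkap : 0 <= kap) by (apply Rlt_le, Rpower_pos).
  destruct (small_radius_exists m kap b Hm Hkap) as (s & Hs).
  pose proof Hs as ((Hs0 & Hs1) & _). pose proof (rho_ge4 m Hm) as Hr.
  set (v := v_fun m p kap b). set (R1 := rho m * s ^ m). set (r := Rmin R1 s).
  assert (HR1 : 0 < R1) by (apply Rmult_lt_0_compat; [lra|apply pow_lt; lra]).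
  assert (Hr0 : 0 < r) by (apply Rmin_glb_lt; lra).
  assert (Hr1 : r <= R1) by apply Rmin_l. assert (Hr2 : r <= s) by apply Rmin_r.
  (* s/8 keeps ln x in the domain of the series, and r / rho gives |x ln x| <= rho [sig_log] < r. *)
  set (e := Rmin (r / rho m) (s / 8)).
  assert (Hrr : 0 < r / rho m <= r).
  { split; [apply Rdiv_lt_0_compat; lra|]. apply (Rmult_le_reg_r (rho m)); [lra|].
    unfold Rdiv. rewrite Rmult_assoc, Rinv_l by lra. nra. }
  assert (He : 0 < e) by (apply Rmin_glb_lt; lra).
  assert (He1 : e <= r / rho m) by apply Rmin_l. assert (He2 : e <= s / 8) by apply Rmin_r.
  destruct (exp_decay (bet m) e 1) as (T & HT0 & HT); [lra|lia|exact He|].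
  set (c1 := Rmin (c / 2) (exp T / 2)). pose proof (exp_pos T) as HeT.
  assert (Hc1 : 0 < c1) by (apply Rmin_glb_lt; lra).
  assert (Hc1a : c1 <= c / 2) by apply Rmin_l. assert (Hc1b : c1 <= exp T / 2) by apply Rmin_r.
  assert (Hbeta : 3 - n = bet m) by (rewrite En; unfold bet, Rdiv; ring).
  assert (Hsig : forall x, 0 < x <= c1 -> sig_log m (ln x) < e).
  { intros x Hx. assert (Hln : ln x < T) by (rewrite <- (ln_exp T); apply ln_increasing; lra).
    specialize (HT _ Hln). rewrite pow_1 in HT. exact HT. }
  assert (Hrpow : forall x, 0 < x -> rpow x (3 - n) = yexp m (ln x)).
  { intros x Hx. unfold rpow. destruct (Rle_dec x 0); [lra|]. rewrite Hbeta. reflexivity. }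
  assert (Hexp : forall x, 0 <= x <= c1 ->
      box 0 0 r (x * ln x) (rpow x (3 - n)) /\
      H x = theta * x * (1 + v (x * ln x) (rpow x (3 - n)))).
  { intros x Hx. destruct (Req_dec x 0) as [->|Hx0].
    - unfold rpow. destruct (Rle_dec 0 0); [|lra]. rewrite Rmult_0_l. split.
      + unfold box. rewrite Rminus_0_r, Rabs_R0. lra.
      + destruct HH as (? & _ & _ & _ & _ & E0 & _). rewrite E0. ring.
    - specialize (Hsig x ltac:(lra)). rewrite Hrpow by lra.
      pose proof (yexp_pos m (ln x)) as Hy. pose proof (yexp_le_sig_log m (ln x)) as Hys.
      pose proof (exp_ln x ltac:(lra)) as Hel. split.
      + unfold box. rewrite !Rminus_0_r. split; [|rewrite Rabs_right; lra].
        rewrite Rabs_mult, (Rabs_right x) by lra. rewrite <- Hel at 1.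
        rewrite <- (yexp_pow_m m (ln x) Hm).
        eapply Rle_lt_trans; [now apply yexp_pow_m_sigma|].
        assert (Hpw : sig_log m (ln x) ^ m <= sig_log m (ln x)).
        { replace m with (S (m - 1)) at 2 by lia. simpl.
          assert (sig_log m (ln x) ^ (m - 1) <= 1)
            by (rewrite <- (pow1 (m - 1)); apply pow_incr; lra). nra. }
        apply Rle_lt_trans with (rho m * sig_log m (ln x)); [apply Rmult_le_compat_l; lra|].
        apply Rlt_le_trans with (rho m * (r / rho m)); [apply Rmult_lt_compat_l; lra|].
        apply Req_le. field. lra.
      + rewrite E by lra. unfold series_solution. fold p. fold kap. do 2 f_equal.
        rewrite <- Hel at 2. unfold v, v_fun.
        symmetry. apply (v_coef_value m p kap b s Hm Hp Hkap Hs). unfold in_domain. lra. }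
  exists v, r. split.
  - split; [exact Hr0|split; [|split]].
    + intros p1 p2 (B1 & B2). rewrite Rminus_0_r in B1, B2.
      apply (analytic2_of_dabs (v_coef m p kap b) R1 s); [now apply dabs_v_coef|lra|lra].
    + apply v_fun_0.
    + exists c1. split; [lra|exact Hexp].
  - apply NNPP. intros Hn.
    (* If v vanished on the box, H would be linear near 0 with H''' = 0, whereas the equation makes
       H''' strictly negative. *)
    assert (HHx : forall x, 0 < x < c1 -> H x = theta * x).
    { intros x Hx. destruct (Hexp x ltac:(lra)) as (HB & ->).
      replace (v (x * ln x) (rpow x (3 - n))) with 0; [ring|].
      apply NNPP. intros Hv. apply Hn. exists (x * ln x), (rpow x (3 - n)).
      split; [exact HB|]. intros E0. now apply Hv. }
    assert (HHd : forall x, 0 < x < c1 -> is_derive H x ((fun _ => theta) x)).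
    { intros x Hx. apply (is_derive_ext_itv (fun x => theta * x) H 0 c1); [exact Hx| |].
      - intros y Hy. symmetry. now apply HHx.
      - derive_as. ring. }
    destruct (Derive_n_of_chain H (fun _ => theta) (fun _ => 0) (fun _ => 0) 0 c1 HHd
      (fun x _ => is_derive_Rconst theta x) (fun x _ => is_derive_Rconst 0 x) (c1 / 2) ltac:(lra))
      as (_ & _ & E3 & _).
    destruct (film_solution_local n theta H HH) as (HL & _).
    destruct (HL (c1 / 2) ltac:(lra)) as (_ & _ & _ & D3').
    change (Derive (Derive_n H 2) (c1 / 2) = 0) in E3.
    rewrite (is_derive_unique (Derive_n H 2) (c1 / 2) _ D3') in E3.
    pose proof (Rpower_pos (H (c1 / 2)) (- (n - 1))). nra.
Qed.

(** * Dependence on both variables *)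

Lemma Series_first (a : nat -> R) : (forall k, a (S k) = 0) -> Series a = a 0%nat.
Proof.
  intros H. apply is_series_unique.
  apply (is_series_ext (fun k => if (k <=? 0)%nat then a k else 0)).
  - intros [|k]; [reflexivity|]. simpl. symmetry. apply H.
  - apply (is_series_finite a 0).
Qed.

(** Absolute convergence at a point strictly between |z| and d bounds the terms there, so the radius
    exceeds |z|. *)
Lemma CV_radius_gt_of_abs (g : nat -> R) (d : R) : 0 < d ->
  (forall z, Rabs z < d -> ex_series (fun j => Rabs (g j * z ^ j))) ->
  forall z, Rabs z < d -> Rbar_lt (Rabs z) (CV_radius g).
Proof.
  intros Hd H z Hz. set (w := (Rabs z + d) / 2).
  assert (Hw : 0 <= w /\ Rabs z < w < d) by (unfold w; pose proof (Rabs_pos z); lra).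
  apply Rbar_lt_le_trans with (Finite w); [simpl; lra|].
  apply (CV_radius_ge g w (Series (fun j => Rabs (g j * w ^ j)))).
  intros n. eapply Rle_trans; [|apply (sum_f_R0_le_Series (fun j => Rabs (g j * w ^ j)) n)].
  - destruct n as [|n]; [simpl; lra|]. rewrite tech5.
    assert (0 <= sum_f_R0 (fun j => Rabs (g j * w ^ j)) n)
      by (apply cond_pos_sum; intros; apply Rabs_pos). lra.
  - intros; apply Rabs_pos.
  - apply H. rewrite Rabs_right; lra.
Qed.

(** An admissible v that does not depend on one variable is determined on the box by its values on
    an axis, where it is a power series in one variable near 0; the contradictions are derived from
    that series. *)
Lemma analytic2_axis_snd (v : R -> R -> R) : analytic2_at v 0 0 ->
  exists (g : nat -> R) (d : R), 0 < d /\
    (forall z, Rabs z < d -> Rbar_lt (Rabs z) (CV_radius g)) /\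
    (forall z, Rabs z < d -> v 0 z = PSeries g z).
Proof.
  intros (a & d & Hd & Ha). exists (a 0%nat), d. split; [exact Hd|].
  assert (Hb : forall z, Rabs z < d -> box 0 0 d 0 z).
  { intros z Hz. unfold box. rewrite !Rminus_0_r, Rabs_R0. lra. }
  split.
  - apply CV_radius_gt_of_abs; [exact Hd|]. intros z Hz.
    destruct (Ha 0 z (Hb z Hz)) as (H1 & _ & _).
    apply (ex_series_ext (fun j => Rabs (a 0%nat j * (0 - 0) ^ 0 * (z - 0) ^ j))); [|apply H1].
    intros j. rewrite !Rminus_0_r. simpl. f_equal. ring.
  - intros z Hz. destruct (Ha 0 z (Hb z Hz)) as (_ & _ & H3).
    rewrite <- (is_series_unique _ _ H3), Series_first.
    + apply Series_ext. intros j. rewrite !Rminus_0_r. simpl. ring.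
    + intros k. rewrite (Series_ext _ (fun j => 0 * 0)); [rewrite Series_scal_l; ring|].
      intros j. rewrite !Rminus_0_r. simpl. ring.
Qed.

Lemma analytic2_axis_fst (v : R -> R -> R) : analytic2_at v 0 0 ->
  exists (g : nat -> R) (d : R), 0 < d /\
    (forall z, Rabs z < d -> Rbar_lt (Rabs z) (CV_radius g)) /\
    (forall z, Rabs z < d -> v z 0 = PSeries g z).
Proof.
  intros (a & d & Hd & Ha). exists (fun i => a i 0%nat), d. split; [exact Hd|].
  assert (Hb : forall z, Rabs z < d -> box 0 0 d z 0).
  { intros z Hz. unfold box. rewrite !Rminus_0_r, Rabs_R0. lra. }
  split.
  - apply CV_radius_gt_of_abs; [exact Hd|]. intros z Hz.
    destruct (Ha z 0 (Hb z Hz)) as (_ & H2 & _).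
    eapply ex_series_ext; [|exact H2]. intros i. cbv beta. rewrite Series_first.
    + rewrite !Rminus_0_r. f_equal. simpl. ring.
    + intros k. rewrite !Rminus_0_r. simpl. rewrite Rmult_0_l, Rmult_0_r. apply Rabs_R0.
  - intros z Hz. destruct (Ha z 0 (Hb z Hz)) as (_ & _ & H3).
    rewrite <- (is_series_unique _ _ H3). unfold PSeries. symmetry. apply Series_ext.
    intros i. rewrite Series_first.
    + rewrite !Rminus_0_r. simpl. ring.
    + intros k. rewrite !Rminus_0_r. simpl. ring.
Qed.

(** For n = 2 the factor H^(n-1) is H itself, so an expansion can be inserted without fractional
    powers. *)
Lemma film_ode_third (H G1 G2 G3 : R -> R) (c : R) :
  0 < c <= 1 -> film_solution 2 1 H ->
  (forall x, 0 < x < c -> is_derive H x (G1 x)) ->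
  (forall x, 0 < x < c -> is_derive G1 x (G2 x)) ->
  (forall x, 0 < x < c -> is_derive G2 x (G3 x)) ->
  forall x, 0 < x < c -> H x * G3 x = - 1 + x.
Proof.
  intros Hc HH E1 E2 E3 x Hx.
  destruct (Derive_n_of_chain H G1 G2 G3 0 c E1 E2 E3 x Hx) as (_ & _ & D3 & _).
  destruct HH as (dH & _ & _ & Hpos & Hode & _).
  specialize (Hode x ltac:(lra)). rewrite D3 in Hode.
  replace (2 - 1) with 1 in Hode by ring. rewrite Rpower_1 in Hode by (apply Hpos; lra).
  exact Hode.
Qed.

Section PowerSeriesDerivatives.

Variables (g : nat -> R) (d : R).
Hypothesis d_pos : 0 < d.
Hypothesis g_radius : forall z, Rabs z < d -> Rbar_lt (Rabs z) (CV_radius g).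

Definition dser (k : nat) (z : R) : R := PSeries (PS_derive_n k g) z.

Lemma dser_0 (z : R) : dser 0 z = PSeries g z.
Proof.
  apply PSeries_ext. intros n. unfold PS_derive_n. rewrite Nat.add_0_r. field.
  apply INR_fact_neq_0.
Qed.

Lemma is_derive_dser (k : nat) (z : R) : Rabs z < d -> is_derive (dser k) z (dser (S k) z).
Proof.
  intros Hz. unfold dser.
  replace (PSeries (PS_derive_n (S k) g) z) with (PSeries (PS_derive (PS_derive_n k g)) z).
  - apply is_derive_PSeries. rewrite CV_radius_derive_n. now apply g_radius.
  - apply PSeries_ext. intros n. unfold PS_derive, PS_derive_n.
    replace (S n + k)%nat with (n + S k)%nat by lia.
    rewrite (fact_simpl n), mult_INR. field. split.
    + apply INR_fact_neq_0.
    + apply not_0_INR. lia.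
Qed.

Lemma dser_continuity (k : nat) : continuity_pt (dser k) 0.
Proof.
  eapply is_derive_continuity_pt, is_derive_dser. rewrite Rabs_R0. exact d_pos.
Qed.

End PowerSeriesDerivatives.

Lemma lim0_pow_ln (N : nat) : lim0 (fun x => x * ln x ^ N) 0.
Proof.
  apply lim0_intro. intros e He. destruct (exp_decay 1 e (S N)) as (T & HT0 & HT); [lra|lia|exact He|].
  exists (exp T). split; [apply exp_pos|]. intros x Hx.
  assert (Hln : ln x < T) by (rewrite <- (ln_exp T); apply ln_increasing; lra).
  specialize (HT _ Hln). rewrite Rmult_1_l, exp_ln in HT by lra.
  rewrite Rminus_0_r, Rabs_mult, (Rabs_right x), <- RPow_abs by lra.
  eapply Rle_lt_trans; [|exact HT]. apply Rmult_le_compat_l; [lra|].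
  pose proof (Rabs_pos (ln x)). apply Rle_trans with ((1 + Rabs (ln x)) ^ N).
  - apply pow_incr. lra.
  - apply Rle_pow; [lra|lia].
Qed.

Lemma lim0_xln : lim0 (fun x => x * ln x) 0.
Proof.
  apply (lim0_ext_loc (fun x => x * ln x ^ 1) _ _ 1); [lra| |apply lim0_pow_ln].
  intros x _. now rewrite pow_1.
Qed.

Lemma lim0_inv_ln : lim0 (fun x => / ln x) 0.
Proof.
  apply lim0_intro. intros e He. exists (exp (- / e)). split; [apply exp_pos|]. intros x Hx.
  assert (Hi : 0 < / e) by (now apply Rinv_0_lt_compat).
  assert (Hln : ln x < - / e) by (rewrite <- (ln_exp (- / e)); apply ln_increasing; lra).
  rewrite Rminus_0_r, Rabs_inv, Rabs_left by lra. rewrite <- (Rinv_inv e).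
  apply Rinv_lt_contravar; [|lra]. apply Rmult_lt_0_compat; lra.
Qed.

Lemma lim0_comp_xln (G : R -> R) : continuity_pt G 0 -> lim0 (fun x => G (x * ln x)) (G 0).
Proof.
  intros HG. apply lim0_intro. intros e He. destruct (HG e He) as (d & Hd & Hlim).
  destruct (lim0_elim _ _ lim0_xln d Hd) as (d' & Hd' & Hx').
  exists d'. split; [exact Hd'|]. intros x Hx. specialize (Hx' x Hx).
  destruct (Req_dec (x * ln x) 0) as [->|Hne].
  - rewrite Rminus_diag, Rabs_R0. exact He.
  - apply (Hlim (x * ln x)). split; [split; [exact I|lra]|exact Hx'].
Qed.

Lemma lim0_quotient_xln (G : R -> R) (l : R) : is_derive G 0 l -> G 0 = 0 ->
  lim0 (fun x => G (x * ln x) / (x * ln x)) l.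
Proof.
  intros HG G0. apply is_derive_Reals in HG. apply lim0_intro. intros e He.
  destruct (HG e He) as (d & Hlim).
  destruct (lim0_elim _ _ lim0_xln d (cond_pos d)) as (d' & Hd' & Hx').
  exists (Rmin d' 1). split; [apply Rmin_glb_lt; lra|]. intros x Hx.
  pose proof (Rmin_l d' 1). pose proof (Rmin_r d' 1).
  assert (Hln : ln x < 0) by (rewrite <- ln_1; apply ln_increasing; lra).
  specialize (Hx' x ltac:(lra)). rewrite Rminus_0_r in Hx'.
  assert (Hne : x * ln x <> 0) by (apply Rmult_integral_contrapositive; split; lra).
  specialize (Hlim (x * ln x) Hne Hx'). rewrite Rplus_0_l, G0, Rminus_0_r in Hlim. exact Hlim.
Qed.

Lemma no_expansion_in_snd (H : R -> R) (g : nat -> R) (d c : R) :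
  0 < d -> (forall z, Rabs z < d -> Rbar_lt (Rabs z) (CV_radius g)) ->
  film_solution 2 1 H -> 0 < c <= 1 -> c <= d ->
  (forall x, 0 < x < c -> H x = x * (1 + PSeries g x)) -> False.
Proof.
  intros Hd Hg HH Hc Hcd E.
  assert (Hin : forall k x, 0 < x < c -> is_derive (dser g k) x (dser g (S k) x)).
  { intros k x Hx. apply (is_derive_dser g d Hg). rewrite Rabs_right; lra. }
  assert (Hlim : forall k, lim0 (dser g k) (dser g k 0)).
  { intros k. apply continuity_pt_lim0. now apply (dser_continuity g d). }
  assert (D1' : forall x, 0 < x < c ->
    is_derive H x (1 + dser g 0 x + x * dser g 1 x)).
  { intros x Hx. apply (is_derive_ext_itv (fun x => x * (1 + dser g 0 x)) H 0 c); [exact Hx| |].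
    - intros y Hy. rewrite dser_0. symmetry. now apply E.
    - pose proof (Hin 0%nat x Hx). derive_as. ring. }
  pose proof (film_ode_third H (fun x => 1 + dser g 0 x + x * dser g 1 x)
    (fun x => 2 * dser g 1 x + x * dser g 2 x)
    (fun x => 3 * dser g 2 x + x * dser g 3 x) c Hc HH D1') as Hode.
  assert (Heq : forall x, 0 < x < c -> H x * (3 * dser g 2 x + x * dser g 3 x) = - 1 + x).
  { apply Hode.
    - intros x Hx. pose proof (Hin 0%nat x Hx). pose proof (Hin 1%nat x Hx). derive_as. ring.
    - intros x Hx. pose proof (Hin 1%nat x Hx). pose proof (Hin 2%nat x Hx). derive_as. ring. }
  destruct (film_solution_local 2 1 H HH) as (_ & HL & _).
  assert (L1 : lim0 (fun x => - 1 + x) (0 * (3 * dser g 2 0 + 0 * dser g 3 0))).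
  { apply (lim0_ext_loc (fun x => H x * (3 * dser g 2 x + x * dser g 3 x)) _ _ c); [lra|exact Heq|].
    apply lim0_mult; [exact HL|]. apply lim0_plus.
    - apply lim0_mult; [apply lim0_const|apply Hlim].
    - apply lim0_mult; [apply lim0_id|apply Hlim]. }
  assert (L2 : lim0 (fun x => - 1 + x) (- 1 + 0)) by (apply lim0_plus; [apply lim0_const|apply lim0_id]).
  pose proof (lim0_unique _ _ _ L1 L2). lra.
Qed.

(* With t = x ln x and L = ln x, the equation for H = x (1 + V(t)) reads
   (1 + V) (x^2 (L+1)^3 V''' + 3 x (L+1) (L+2) V'' + 2 V') = -1 + x.
   Its orders 1, x L^2 and x L force V'(0) = -1/2, V''(0) = 0 and V'(0)^2 + V''(0) = 0. *)
Lemma no_expansion_in_fst (H : R -> R) (g : nat -> R) (d c : R) :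
  0 < d -> (forall z, Rabs z < d -> Rbar_lt (Rabs z) (CV_radius g)) ->
  film_solution 2 1 H -> 0 < c <= 1 -> g 0%nat = 0 ->
  (forall x, 0 < x < c -> Rabs (x * ln x) < d /\ H x = x * (1 + PSeries g (x * ln x))) -> False.
Proof.
  intros Hd Hg HH Hc Hg0 E.
  set (V := fun k x => dser g k (x * ln x)).
  assert (HV : forall k x, 0 < x < c -> is_derive (V k) x ((ln x + 1) * V (S k) x)).
  { intros k x Hx. apply (is_derive_Rcomp (dser g k) (fun x => x * ln x)).
    - apply (is_derive_dser g d Hg). now apply E.
    - assert (is_derive ln x (/ x)) by (apply is_derive_Reals, derivable_pt_lim_ln; lra).
      derive_as. field. lra. }
  assert (Hln : forall x, 0 < x < c -> is_derive ln x (/ x)).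
  { intros x Hx. apply is_derive_Reals, derivable_pt_lim_ln. lra. }
  assert (Hneg : forall x, 0 < x < c -> ln x < 0).
  { intros x Hx. rewrite <- ln_1. apply ln_increasing; lra. }
  assert (Hlim : forall k, lim0 (V k) (dser g k 0)).
  { intros k. apply lim0_comp_xln. now apply (dser_continuity g d). }
  assert (V00 : dser g 0 0 = 0) by (rewrite dser_0, PSeries_0; exact Hg0).
  assert (D1' : forall x, 0 < x < c -> is_derive H x (1 + V 0%nat x + x * (ln x + 1) * V 1%nat x)).
  { intros x Hx. apply (is_derive_ext_itv (fun x => x * (1 + V 0%nat x)) H 0 c); [exact Hx| |].
    - intros y Hy. unfold V. rewrite dser_0. symmetry. now apply E.
    - pose proof (HV 0%nat x Hx). derive_as. ring. }
  pose proof (film_ode_third H (fun x => 1 + V 0%nat x + x * (ln x + 1) * V 1%nat x)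
    (fun x => (2 * ln x + 3) * V 1%nat x + x * (ln x + 1) * (ln x + 1) * V 2%nat x)
    (fun x => x * (ln x + 1) * (ln x + 1) * (ln x + 1) * V 3%nat x
              + 3 * (ln x + 1) * (ln x + 2) * V 2%nat x + 2 * V 1%nat x * / x)
    c Hc HH D1') as Hode.
  assert (Heq0 : forall x, 0 < x < c ->
    H x * (x * (ln x + 1) * (ln x + 1) * (ln x + 1) * V 3%nat x
              + 3 * (ln x + 1) * (ln x + 2) * V 2%nat x + 2 * V 1%nat x * / x) = - 1 + x).
  { apply Hode.
    - intros x Hx. pose proof (HV 0%nat x Hx). pose proof (HV 1%nat x Hx). pose proof (Hln x Hx).
      derive_as. field. lra.
    - intros x Hx. pose proof (HV 1%nat x Hx). pose proof (HV 2%nat x Hx). pose proof (Hln x Hx).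
      derive_as. field. lra. }
  set (A := fun x => 1 + V 0%nat x).
  assert (HA : lim0 A 1).
  { apply (lim0_eq _ (1 + dser g 0 0)); [|rewrite V00; ring].
    apply lim0_plus; [apply lim0_const|apply Hlim]. }
  set (z := fun t => 2 * (1 + dser g 0 t) * dser g 1 t + 1).
  assert (Heq : forall x, 0 < x < c ->
    A x * (x * x * (ln x + 1) * (ln x + 1) * (ln x + 1) * V 3%nat x
           + 3 * x * (ln x + 1) * (ln x + 2) * V 2%nat x) + z (x * ln x) = x).
  { intros x Hx. pose proof (Heq0 x Hx) as Ho. destruct (E x Hx) as (_ & EH).
    rewrite EH, <- dser_0 in Ho. fold (V 0%nat x) in Ho. fold (A x) in Ho.
    unfold z. fold (V 0%nat x) (V 1%nat x) (A x).
    replace (- 1 + x + 1) with x by ring.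
    transitivity (x * A x * (x * (ln x + 1) * (ln x + 1) * (ln x + 1) * V 3%nat x
      + 3 * (ln x + 1) * (ln x + 2) * V 2%nat x + 2 * V 1%nat x * / x) + 1).
    - field. lra.
    - rewrite Ho. ring. }
  assert (Lz : forall a, lim0 (fun x => x * ln x ^ a) 0) by apply lim0_pow_ln.
  assert (z0 : z 0 = 0).
  { apply (lim0_unique (fun x => z (x * ln x))).
    - apply lim0_comp_xln. unfold z.
      assert (Hc0 : Rabs 0 < d) by (rewrite Rabs_R0; exact Hd).
      pose proof (is_derive_dser g d Hg 0 0 Hc0). pose proof (is_derive_dser g d Hg 1 0 Hc0).
      eapply is_derive_continuity_pt. repeat derive_step.
    - apply (lim0_ext_loc (fun x => x - A x * (
        (x * (x * ln x ^ 3 + 3 * (x * ln x ^ 2) + 3 * (x * ln x ^ 1) + x)) * V 3%nat x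
         + (3 * (x * ln x ^ 2) + 9 * (x * ln x ^ 1) + 6 * x) * V 2%nat x)) _ _ c); [lra| |].
      + intros x Hx. pose proof (Heq x Hx) as Ho. rewrite <- Ho at 1. ring.
      + apply (lim0_eq _ (0 - 1 * ((0 * (0 + 3 * 0 + 3 * 0 + 0)) * dser g 3 0
           + (3 * 0 + 9 * 0 + 6 * 0) * dser g 2 0))); [|ring].
        repeat first [apply Hlim | apply HA | apply Lz | apply lim0_id | apply lim0_const
                     | apply lim0_minus | apply lim0_plus | apply lim0_mult]. }
  assert (V1 : dser g 1 0 = - / 2) by (unfold z in z0; rewrite V00 in z0; lra).
  assert (Dz : is_derive z 0 (/ 2 + 2 * dser g 2 0)).
  { assert (Hc0 : Rabs 0 < d) by (rewrite Rabs_R0; exact Hd).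
    pose proof (is_derive_dser g d Hg 0 0 Hc0). pose proof (is_derive_dser g d Hg 1 0 Hc0).
    unfold z. derive_as. rewrite V00, V1. field. }
  pose proof (lim0_quotient_xln z _ Dz z0) as Lq.
  pose proof lim0_inv_ln as Li.
  (* The equation is divided by x (ln x)^2: the third-derivative term keeps a factor x ln x, the
     quotient of z a factor 1 / ln x, and only 3 V''(0) survives. *)
  assert (V2 : dser g 2 0 = 0).
  { assert (L1 : lim0 (fun x => A x * (x * ln x ^ 1 * ((1 + / ln x) * (1 + / ln x) * (1 + / ln x)) * V 3%nat x
        + 3 * (1 + / ln x) * (1 + 2 * / ln x) * V 2%nat x)
        + z (x * ln x) / (x * ln x) * / ln x - / ln x * / ln x)
        (1 * (0 * ((1 + 0) * (1 + 0) * (1 + 0)) * dser g 3 0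
        + 3 * (1 + 0) * (1 + 2 * 0) * dser g 2 0)
        + (/ 2 + 2 * dser g 2 0) * 0 - 0 * 0)).
    { repeat first [apply Hlim | apply HA | apply Lz | apply Lq | apply Li | apply lim0_const
                   | apply lim0_minus | apply lim0_plus | apply lim0_mult]. }
    assert (L2 : lim0 (fun x => A x * (x * ln x ^ 1 * ((1 + / ln x) * (1 + / ln x) * (1 + / ln x)) * V 3%nat x
        + 3 * (1 + / ln x) * (1 + 2 * / ln x) * V 2%nat x)
        + z (x * ln x) / (x * ln x) * / ln x - / ln x * / ln x) 0).
    { apply (lim0_ext_loc (fun _ => 0) _ _ c); [lra| |apply lim0_const].
      intros x Hx. pose proof (Heq x Hx) as Ho. pose proof (Hneg x Hx).
      replace (z (x * ln x)) with (x - A x * (x * x * (ln x + 1) * (ln x + 1) * (ln x + 1) * V 3%nat x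
           + 3 * x * (ln x + 1) * (ln x + 2) * V 2%nat x)) by lra.
      field. lra. }
    pose proof (lim0_unique _ _ _ L1 L2). lra. }
  assert (Dq : is_derive (dser g 2) 0 (dser g 3 0)).
  { apply (is_derive_dser g d Hg). rewrite Rabs_R0. exact Hd. }
  pose proof (lim0_quotient_xln _ _ Dq V2) as Lq2.
  (* Now the division is by x ln x. As V''(0) = 0, V'' is of order x ln x and its term vanishes in
     the limit too, which leaves z'(0) = 1/2 equal to 0. *)
  assert (L1 : lim0 (fun x => A x * (x * ln x ^ 2 * ((1 + / ln x) * (1 + / ln x) * (1 + / ln x)) * V 3%nat x
        + 3 * (1 + / ln x) * (1 + 2 * / ln x) * (x * ln x ^ 2 * (V 2%nat x / (x * ln x))))
        + z (x * ln x) / (x * ln x) - / ln x)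
        (1 * (0 * ((1 + 0) * (1 + 0) * (1 + 0)) * dser g 3 0
        + 3 * (1 + 0) * (1 + 2 * 0) * (0 * dser g 3 0))
        + (/ 2 + 2 * dser g 2 0) - 0)).
  { repeat first [apply Hlim | apply HA | apply Lz | apply Lq | apply Lq2 | apply Li | apply lim0_const
                 | apply lim0_minus | apply lim0_plus | apply lim0_mult]. }
  assert (L2 : lim0 (fun x => A x * (x * ln x ^ 2 * ((1 + / ln x) * (1 + / ln x) * (1 + / ln x)) * V 3%nat x
        + 3 * (1 + / ln x) * (1 + 2 * / ln x) * (x * ln x ^ 2 * (V 2%nat x / (x * ln x))))
        + z (x * ln x) / (x * ln x) - / ln x) 0).
  { apply (lim0_ext_loc (fun _ => 0) _ _ c); [lra| |apply lim0_const].
    intros x Hx. pose proof (Heq x Hx) as Ho. pose proof (Hneg x Hx).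
    replace (z (x * ln x)) with (x - A x * (x * x * (ln x + 1) * (ln x + 1) * (ln x + 1) * V 3%nat x
         + 3 * x * (ln x + 1) * (ln x + 2) * V 2%nat x)) by lra.
    field. lra. }
  pose proof (lim0_unique _ _ _ L1 L2). lra.
Qed.

Lemma film_expansion_depends (H : R -> R) (v : R -> R -> R) (r : R) :
  film_solution 2 1 H -> film_expansion 2 1 H v r -> depends_on_fst v r /\ depends_on_snd v r.
Proof.
  intros HH (Hr & Han & Hv0 & c & Hc & Hexp).
  assert (B0 : box 0 0 r 0 0) by (unfold box; rewrite Rminus_0_r, Rabs_R0; lra).
  pose proof (Han 0 0 B0) as Ha.
  assert (Hrp : forall x, 0 < x -> rpow x (3 - 2) = x).
  { intros x Hx. unfold rpow. destruct (Rle_dec x 0); [lra|].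
    replace (3 - 2) with 1 by ring. now apply Rpower_1. }
  split; apply NNPP; intros Hn.
  - destruct (analytic2_axis_snd v Ha) as (g & d & Hd & Hg & Ev).
    set (c' := Rmin c d). assert (Hc' : 0 < c') by (apply Rmin_glb_lt; lra).
    assert (c' <= c) by apply Rmin_l. assert (c' <= d) by apply Rmin_r.
    apply (no_expansion_in_snd H g d c' Hd Hg HH); [lra|lra|].
    intros x Hx. destruct (Hexp x ltac:(lra)) as (HB & ->). rewrite Hrp in HB |- * by lra.
    rewrite <- Ev by (rewrite Rabs_right; lra). rewrite Rmult_1_l. do 2 f_equal.
    apply NNPP. intros Hne. apply Hn. exists (x * ln x), 0, x.
    split; [exact HB|split; [|exact Hne]].
    destruct HB as (_ & HB2). split; [rewrite Rminus_0_r, Rabs_R0; exact Hr|exact HB2].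
  - destruct (analytic2_axis_fst v Ha) as (g & d & Hd & Hg & Ev).
    destruct (lim0_elim _ _ lim0_xln d Hd) as (d' & Hd' & Hx').
    set (c' := Rmin c d'). assert (Hc' : 0 < c') by (apply Rmin_glb_lt; lra).
    assert (c' <= c) by apply Rmin_l. assert (c' <= d') by apply Rmin_r.
    apply (no_expansion_in_fst H g d c' Hd Hg HH); [lra| |].
    + rewrite <- (PSeries_0 g), <- Ev, Hv0 by (rewrite Rabs_R0; exact Hd). reflexivity.
    + intros x Hx. specialize (Hx' x ltac:(lra)). rewrite Rminus_0_r in Hx'.
      split; [exact Hx'|].
      destruct (Hexp x ltac:(lra)) as (HB & ->). rewrite Hrp in HB |- * by lra.
      rewrite <- Ev by exact Hx'. rewrite Rmult_1_l. do 2 f_equal.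
      apply NNPP. intros Hne. apply Hn. exists (x * ln x), x, 0.
      split; [exact HB|split; [|exact Hne]].
      destruct HB as (HB1 & _). split; [exact HB1|rewrite Rminus_0_r, Rabs_R0; exact Hr].
Qed.

Theorem theorem3p3 :
  (forall (m : nat) (n theta : R),
     (1 <= m)%nat -> n = 3 - 1 / INR m -> 0 < theta ->
     exists H : R -> R,
       film_solution n theta H /\
       (forall K : R -> R, film_solution n theta K ->
          forall x, unit_itv x -> K x = H x) /\
       exists (v : R -> R -> R) (r : R),
         film_expansion n theta H v r /\ nonzero_on_box v r)
  /\
  (exists (m : nat) (n theta : R),
     (1 <= m)%nat /\ n = 3 - 1 / INR m /\ 0 < theta /\
     forall (H : R -> R) (v : R -> R -> R) (r : R),
       film_solution n theta H -> film_expansion n theta H v r ->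
       depends_on_fst v r /\ depends_on_snd v r).
Proof.
  split.
  - intros m n theta Hm En Ht.
    pose proof (bet_pos m Hm) as Hb. pose proof (bet_le1 m Hm) as Hb1.
    assert (Eb : n = 3 - bet m) by (rewrite En; unfold bet, Rdiv; ring).
    destruct (film_solution_exists n theta (bet m) Hb Hb1 Eb Ht) as (H & HH).
    exists H. split; [exact HH|split].
    + intros K HK. apply (film_solution_unique n theta K H); [lra|exact Ht|exact HK|exact HH].
    + now apply (film_expansion_exists m).
  - exists 1%nat, 2, 1. split; [lia|split; [simpl; field|split; [lra|]]].
    intros H v r. apply film_expansion_depends.
Qed.
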